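(* Let $\beta\in(0,\frac{\pi}{2})$, let $a\in C^2(\mathbb{R})$ with $a(\cdot)>0$, and let $k_1,k_2\in C^2([0,\infty),\mathbb{R})$ be functions of $u$ only. Assume that there exists $\sigma\in(0,\tan\beta)$ with $|k_i(u)|\leqslant\tan\beta-\sigma$ for all $u\geqslant0$ ($i=1,2$), that $$\max k_1+\max k_2<0,$$ and that, for some $b>1$, $k_i(u)=k_i(bu)$ for all $u\geqslant0$ ($i=1,2$). Then the problem $$\left\{\begin{array}{l} u_t=a(u_x)u_{xx},\quad -\xi_1(t)<x<\xi_2(t),\ t<0,\\ u_x(x,t)=-k_1(u(x,t)),\ \ u(x,t)=-x\tan\beta\quad\text{for }x=-\xi_1(t),\ t<0,\\ u_x(x,t)=k_2(u(x,t)),\ \ u(x,t)=x\tan\beta\quad\text{for }x=\xi_2(t),\ t<0,\end{array}\right.$$ has a unique discrete shrinking self-similar solution $(\widehat U,\widehat\Xi_1,\widehat\Xi_2)$ in $(-\infty,0)$ (with factor $b$), and $\widehat U_t<0$, $\widehat\Xi_{1t}<0$, $\widehat\Xi_{2t}<0$ for $t\in(-\infty,0)$.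
   Context: The unknowns are positive functions $u(x,t)$ (defined for $-\xi_1(t)\leqslant x\leqslant\xi_2(t)$), $\xi_1(t)$ and $\xi_2(t)$; solutions are understood in the classical sense. The maxima are over $[0,\infty)$. A solution $(u,\xi_1,\xi_2)=(\widehat U,\widehat\Xi_1,\widehat\Xi_2)$, defined for $t\in(-\infty,0)$, of the free boundary problem $$\left\{\begin{array}{l} u_t=a(u_x)u_{xx},\quad -\xi_1(t)<x<\xi_2(t),\ t<0,\\ u_x(x,t)=-k_1(u(x,t)),\ \ u(x,t)=-x\tan\beta\quad\text{for }x=-\xi_1(t),\ t<0,\\ u_x(x,t)=k_2(u(x,t)),\ \ u(x,t)=x\tan\beta\quad\text{for }x=\xi_2(t),\ t<0,\end{array}\right.$$ is called a discrete shrinking self-similar solution in $(-\infty,0)$ with factor $b>1$ if $$\widehat U(x,t)=b\,\widehat U(b^{-1}x,b^{-2}t)\quad\text{for }-\widehat\Xi_1(t)\leqslant x\leqslant\widehat\Xi_2(t),\ t<0,$$ and $\widehat\Xi_i(t)=b\,\widehat\Xi_i(b^{-2}t)$ for $t<0$, $i=1,2$. *)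

(* Defs.v *)
From Stdlib Require Import Reals.
From Coquelicot Require Import Coquelicot.
Open Scope R_scope.

(* Derivative relative to [D]: one-sided at an endpoint of [D] lying in [D]. *)
Definition derivative_on (D : R -> Prop) (f f' : R -> R) : Prop :=
  forall x, D x -> filterdiff f (within D (locally x)) (fun y => scal y (f' x)).

Definition C2_on (D : R -> Prop) (f : R -> R) : Prop :=
  exists f1 f2 : R -> R,
    derivative_on D f f1 /\ derivative_on D f1 f2 /\ continuous_on D f2.

Definition is_max_on (D : R -> Prop) (f : R -> R) (m : R) : Prop :=
  (exists x, D x /\ f x = m) /\ (forall x, D x -> f x <= m).

Definition nonneg_half_line (u : R) : Prop := 0 <= u.

Definition C1_neg (xi : R -> R) : Prop :=
  forall t, t < 0 -> ex_derive xi t /\ continuous (Derive xi) t.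

Definition open_region (xi1 xi2 : R -> R) (q : R * R) : Prop :=
  snd q < 0 /\ - xi1 (snd q) < fst q < xi2 (snd q).

Definition closed_region (xi1 xi2 : R -> R) (q : R * R) : Prop :=
  snd q < 0 /\ - xi1 (snd q) <= fst q <= xi2 (snd q).

Definition continuous_on_region (xi1 xi2 : R -> R) (v : R -> R -> R) : Prop :=
  continuous_on (closed_region xi1 xi2) (fun q => v (fst q) (snd q)).

(* Up to the lateral boundary, partial derivatives are the continuous
   extensions of the interior ones: at a boundary point the slice
   {s | (x, s) in the region} may be degenerate, so a one-sided difference
   quotient in t need not make sense there. For u_x and u_xx the extension
   coincides with the one-sided derivative. *)
Definition is_dx (xi1 xi2 : R -> R) (v vx : R -> R -> R) : Prop :=
  continuous_on_region xi1 xi2 vx /\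
  forall x t, open_region xi1 xi2 (x, t) -> is_derive (fun y => v y t) x (vx x t).

Definition is_dt (xi1 xi2 : R -> R) (v vt : R -> R -> R) : Prop :=
  continuous_on_region xi1 xi2 vt /\
  forall x t, open_region xi1 xi2 (x, t) -> is_derive (fun s => v x s) t (vt x t).

(* Positive classical solutions on t < 0: u is C^{2,1} on the closed region and
   xi1, xi2 are C^1. Only the values of u on the closed region and those of
   xi1, xi2 on t < 0 are relevant. *)
Definition classical_solution (beta : R) (a k1 k2 : R -> R)
    (u : R -> R -> R) (xi1 xi2 : R -> R) : Prop :=
  C1_neg xi1 /\ C1_neg xi2 /\
  (forall t, t < 0 -> 0 < xi1 t /\ 0 < xi2 t) /\
  (forall x t, closed_region xi1 xi2 (x, t) -> 0 < u x t) /\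
  continuous_on_region xi1 xi2 u /\
  exists ux uxx ut : R -> R -> R,
    is_dx xi1 xi2 u ux /\ is_dx xi1 xi2 ux uxx /\ is_dt xi1 xi2 u ut /\
    (forall x t, open_region xi1 xi2 (x, t) -> ut x t = a (ux x t) * uxx x t) /\
    (forall x t, t < 0 -> x = - xi1 t ->
       ux x t = - k1 (u x t) /\ u x t = - x * tan beta) /\
    (forall x t, t < 0 -> x = xi2 t ->
       ux x t = k2 (u x t) /\ u x t = x * tan beta).

Definition discrete_shrinking_self_similar (beta : R) (a k1 k2 : R -> R) (b : R)
    (U : R -> R -> R) (Xi1 Xi2 : R -> R) : Prop :=
  classical_solution beta a k1 k2 U Xi1 Xi2 /\
  (forall x t, closed_region Xi1 Xi2 (x, t) -> U x t = b * U (x / b) (t / b ^ 2)) /\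
  (forall t, t < 0 -> Xi1 t = b * Xi1 (t / b ^ 2) /\ Xi2 t = b * Xi2 (t / b ^ 2)).

Definition same_solution (U : R -> R -> R) (Xi1 Xi2 : R -> R)
    (V : R -> R -> R) (Eta1 Eta2 : R -> R) : Prop :=
  (forall t, t < 0 -> Xi1 t = Eta1 t /\ Xi2 t = Eta2 t) /\
  (forall x t, closed_region Xi1 Xi2 (x, t) -> U x t = V x t).

(* Main.v *)
Require Import Defs.
From Stdlib Require Import Reals Lra Lia Psatz.
From Coquelicot Require Import Coquelicot.
Open Scope R_scope.

(** Continuity at [0] together with [k (b u) = k u] forces [k1] and [k2] to be constants; put
    [p0 = k2], [p1 = - k1] and [T = tan beta], so that [- T < p0 < p1 < T].

    Existence: the exact self-similar ansatz [u = lam phi (x / lam)], [lam = sqrt (- 2 t)],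
    becomes under the Legendre transform [w(p) = phi - y p], [p = phi'], the Robin problem
    [w'' = a / w] on [[p0, p1]], which is solved by shooting.

    Uniqueness: for an arbitrary discrete self-similar solution, the strong maximum principle and
    Hopf's lemma applied to difference quotients over one period give [p0 <= u_x <= p1] and then
    [u_xx < 0] up to the boundary. The Legendre transform [w(p, t)] is therefore
    defined on the fixed interval [[p0, p1]], with [w_t = - a / w_pp] and linear Robin conditions.
    The energy [int a log w - (int a / 2) log (- t) + (int w w_pp) / (4 t)] is nonincreasing,
    with dissipation [int (a + w w_pp / (2 t))^2 / (w w_pp)], and it takes the same value at [t]
    and at [t / b^2]; so [w w_pp = - 2 t a] for every [t], and it remains to see that this Robin
    problem has only one solution. *)

(** * Calculus and a comparison principle *)

(** A classical solution is only [C^{2,1}], so the equation cannot be differentiated. Every maximum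
    principle therefore compares the flow with a translate of itself by [h]; the barriers carry a
    factor [h] and constants independent of [h], so that dividing by [h] and letting it tend to 0
    gives the statement about [ux] or [ut]. The same obstacle returns in the energy, where
    [n = w_pp] has no known time derivative: the symmetry of the Robin problem moves the derivative
    onto [w]. Half the integral of [w n] is the area between curve and wedge, and it shrinks at the
    constant rate [int a]. For the Robin problem itself a direct comparison fails: two solutions
    differ by some [D] with [D'' = - G D], which may oscillate. What is monotone is a first-order
    expression in the sum of the two solutions, and the first and the last zero of [D] would force
    signs on it in the wrong order. *)

Lemma is_derive_continuity_pt (f : R -> R) (x l : R) :
  is_derive f x l -> continuity_pt f x.
Proof.
  intro H. apply continuity_pt_filterlim. apply (ex_derive_continuous f x). now exists l.
Qed.

Lemma continuity_pt_cst (c x : R) : continuity_pt (fun _ => c) x.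
Proof. apply continuity_pt_const. now intros ? ?. Qed.

Lemma continuity_pt_id (x : R) : continuity_pt (fun y => y) x.
Proof. apply derivable_continuous_pt, derivable_pt_id. Qed.

Lemma locally_between (l r x : R) : l < x < r -> locally x (fun y => l < y < r).
Proof.
  intro Hx. assert (Hm : 0 < Rmin (x - l) (r - x)) by (apply Rmin_pos; lra).
  assert (M1 := Rmin_l (x - l) (r - x)). assert (M2 := Rmin_r (x - l) (r - x)).
  exists (mkposreal _ Hm). intros y Hy. change (Rabs (y - x) < Rmin (x - l) (r - x)) in Hy.
  apply Rabs_def2 in Hy. lra.
Qed.

Lemma locally_neg (t : R) : t < 0 -> locally t (fun s => s < 0).
Proof.
  intro Ht. generalize (locally_between (t - 1) 0 t ltac:(lra)).
  apply filter_imp. intros s Hs. lra.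
Qed.

Lemma mean_value (f df : R -> R) (a b : R) :
  a < b ->
  (forall x, a < x < b -> is_derive f x (df x)) ->
  (forall x, a <= x <= b -> continuity_pt f x) ->
  exists c, a < c < b /\ f b - f a = df c * (b - a).
Proof.
  intros Hab Hd Hc.
  assert (pr1 : forall c, a < c < b -> derivable_pt f c).
  { intros c Hcc. exists (df c). apply is_derive_Reals. now apply Hd. }
  assert (pr2 : forall c, a < c < b -> derivable_pt id c).
  { intros c _. apply derivable_pt_id. }
  destruct (MVT f id a b pr1 pr2 Hab Hc) as [c [P HP]].
  { intros c _. apply continuity_pt_id. }
  exists c. split; [exact P|].
  assert (E1 : derive_pt f c (pr1 c P) = df c).
  { apply derive_pt_eq_0. apply is_derive_Reals. now apply Hd. }
  assert (E2 : derive_pt id c (pr2 c P) = 1).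
  { apply derive_pt_eq_0. apply derivable_pt_lim_id. }
  rewrite E1, E2 in HP. unfold id in HP. lra.
Qed.

Lemma derivative_nonneg_le (f df : R -> R) (a b : R) :
  a <= b ->
  (forall x, a < x < b -> is_derive f x (df x)) ->
  (forall x, a <= x <= b -> continuity_pt f x) ->
  (forall x, a < x < b -> 0 <= df x) -> f a <= f b.
Proof.
  intros [Hab|<-] Hd Hc Hp; [|lra].
  destruct (mean_value f df a b Hab Hd Hc) as [c [Hcc E]].
  specialize (Hp c Hcc). nra.
Qed.

Lemma derivative_pos_lt (f df : R -> R) (a b : R) :
  a < b ->
  (forall x, a < x < b -> is_derive f x (df x)) ->
  (forall x, a <= x <= b -> continuity_pt f x) ->
  (forall x, a < x < b -> 0 < df x) -> f a < f b.
Proof.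
  intros Hab Hd Hc Hp.
  destruct (mean_value f df a b Hab Hd Hc) as [c [Hcc E]].
  specialize (Hp c Hcc). nra.
Qed.

Lemma derivative_zero_const (f df : R -> R) (a b : R) :
  a <= b ->
  (forall x, a < x < b -> is_derive f x (df x)) ->
  (forall x, a <= x <= b -> continuity_pt f x) ->
  (forall x, a < x < b -> df x = 0) -> f a = f b.
Proof.
  intros [Hab|<-] Hd Hc Hp; [|lra].
  destruct (mean_value f df a b Hab Hd Hc) as [c [Hcc E]].
  specialize (Hp c Hcc). rewrite Hp in E. lra.
Qed.

Lemma is_derive_sign_right (f : R -> R) (x l : R) :
  is_derive f x l -> 0 < l ->
  exists d, 0 < d /\ (forall y, x < y < x + d -> f x < f y) /\
    (forall y, x - d < y < x -> f y < f x).
Proof.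
  intros Hd Hl. apply is_derive_Reals in Hd.
  destruct (Hd (l / 2)) as [d Hd']; [lra|].
  exists d. split; [apply cond_pos|].
  assert (K : forall h, h <> 0 -> Rabs h < d -> l / 2 < (f (x + h) - f x) / h).
  { intros h Hh Hhd. specialize (Hd' h Hh Hhd). apply Rabs_def2 in Hd'. lra. }
  split; intros y Hy.
  - assert (H := K (y - x)). replace (x + (y - x)) with y in H by ring.
    assert (H1 : l / 2 < (f y - f x) / (y - x)).
    { apply H; [lra|]. rewrite Rabs_right; lra. }
    assert (f y - f x = (f y - f x) / (y - x) * (y - x)) by (field; lra). nra.
  - assert (H := K (y - x)). replace (x + (y - x)) with y in H by ring.
    assert (H1 : l / 2 < (f y - f x) / (y - x)).
    { apply H; [lra|]. rewrite Rabs_left; lra. }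
    assert (f y - f x = (f y - f x) / (y - x) * (y - x)) by (field; lra). nra.
Qed.

Lemma left_max_derive_nonneg (f : R -> R) (x l d : R) :
  is_derive f x l -> 0 < d -> (forall y, x - d < y < x -> f y <= f x) -> 0 <= l.
Proof.
  intros Hd Hd0 Hm. destruct (Rle_lt_dec 0 l) as [|Hl]; [assumption|exfalso].
  assert (Hd' : is_derive (fun y => - f y) x (- l)) by (now apply @is_derive_opp).
  destruct (is_derive_sign_right _ _ _ Hd') as [e [He [_ H]]]; [lra|].
  set (y := x - Rmin d e / 2).
  assert (0 < Rmin d e) by (apply Rmin_pos; assumption).
  assert (Rmin d e <= d) by apply Rmin_l. assert (Rmin d e <= e) by apply Rmin_r.
  assert (H3 : - f y < - f x) by (apply H; unfold y; lra).
  assert (f y <= f x) by (apply Hm; unfold y; lra). lra.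
Qed.

(** The second derivative is given at [x] alone, which is enough: if [f2] were positive, [f1] would
    be positive just to the right of its zero [x], and [f] would rise above its maximum there. *)
Lemma interior_max_derivatives (f f1 : R -> R) (f2 x d : R) :
  0 < d ->
  (forall y, Rabs (y - x) < d -> is_derive f y (f1 y)) ->
  is_derive f1 x f2 ->
  (forall y, Rabs (y - x) < d -> f y <= f x) ->
  f1 x = 0 /\ f2 <= 0.
Proof.
  intros Hd H1 H2 Hm.
  assert (Hx : is_derive f x (f1 x)).
  { apply H1. rewrite Rminus_diag, Rabs_R0. exact Hd. }
  assert (Z : f1 x = 0).
  { apply Rle_antisym.
    - destruct (Rle_lt_dec (f1 x) 0) as [|Hp]; [assumption|exfalso].
      destruct (is_derive_sign_right _ _ _ Hx Hp) as [e [He [H _]]].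
      set (y := x + Rmin d e / 2).
      assert (0 < Rmin d e) by (apply Rmin_pos; assumption).
      assert (Rmin d e <= d) by apply Rmin_l. assert (Rmin d e <= e) by apply Rmin_r.
      assert (f x < f y) by (apply H; unfold y; lra).
      assert (f y <= f x). { apply Hm. unfold y. rewrite Rabs_right; lra. } lra.
    - apply (left_max_derive_nonneg f x _ d Hx Hd). intros y Hy. apply Hm.
      rewrite Rabs_left; lra. }
  split; [exact Z|].
  destruct (Rle_lt_dec f2 0) as [|Hp]; [assumption|exfalso].
  destruct (is_derive_sign_right _ _ _ H2 Hp) as [e [He [H _]]].
  set (y := x + Rmin d e / 2).
  assert (0 < Rmin d e) by (apply Rmin_pos; assumption).
  assert (Rmin d e <= d) by apply Rmin_l. assert (Rmin d e <= e) by apply Rmin_r.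
  assert (f x < f y).
  { apply derivative_pos_lt with f1; [unfold y; lra| | |].
    - intros z Hz. apply H1. unfold y in Hz. rewrite Rabs_right; lra.
    - intros z Hz. apply is_derive_continuity_pt with (f1 z). apply H1.
      unfold y in Hz. rewrite Rabs_right; lra.
    - intros z Hz. rewrite <- Z. apply H. unfold y in Hz. lra. }
  assert (f y <= f x). { apply Hm. unfold y. rewrite Rabs_right; lra. } lra.
Qed.

Lemma continuity_2d_pt_section (f : R -> R -> R) (x t : R) :
  continuity_2d_pt f x t -> continuity_pt (fun y => f y t) x.
Proof.
  intros H. apply continuity_pt_filterlim. apply continuity_2d_pt_filterlim in H.
  apply (continuous_comp_2 (fun y : R => y) (fun _ => t) (fun a b => f a b) x).
  - apply continuous_id.
  - apply continuous_const.
  - exact H.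
Qed.

Lemma continuity_2d_pt_comp (f g h : R -> R -> R) (x t : R) :
  continuity_2d_pt f (g x t) (h x t) ->
  continuity_2d_pt g x t -> continuity_2d_pt h x t ->
  continuity_2d_pt (fun y s => f (g y s) (h y s)) x t.
Proof.
  intros Hf Hg Hh. apply continuity_2d_pt_filterlim in Hf, Hg, Hh.
  apply continuity_2d_pt_filterlim.
  apply (continuous_comp_2 (fun z : R * R => g (fst z) (snd z))
    (fun z => h (fst z) (snd z)) f (x, t)); assumption.
Qed.

Lemma continuity_2d_pt_fst (f : R -> R) (x t : R) :
  continuity_pt f x -> continuity_2d_pt (fun y _ => f y) x t.
Proof.
  intro H. apply (continuity_1d_2d_pt_comp f (fun y _ => y)); [exact H|].
  apply continuity_2d_pt_id1.
Qed.

Lemma continuity_2d_pt_snd (f : R -> R) (x t : R) :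
  continuity_pt f t -> continuity_2d_pt (fun _ s => f s) x t.
Proof.
  intro H. apply (continuity_1d_2d_pt_comp f (fun _ s => s)); [exact H|].
  apply continuity_2d_pt_id2.
Qed.

Lemma continuity_pt_comp_2d (f : R -> R -> R) (g h : R -> R) (x : R) :
  continuity_2d_pt f (g x) (h x) -> continuity_pt g x -> continuity_pt h x ->
  continuity_pt (fun y => f (g y) (h y)) x.
Proof.
  intros Hf Hg Hh.
  apply (continuity_2d_pt_section (fun y _ => f (g y) (h y)) x 0).
  apply continuity_2d_pt_comp with (g := fun y _ => g y) (h := fun y _ => h y).
  - exact Hf.
  - now apply continuity_2d_pt_fst.
  - now apply continuity_2d_pt_fst.
Qed.

(** Maximising in [x] for each [y] leaves the column maximum as a function of [y], continuous
    because [f] is uniformly continuous on the rectangle; a maximum in one variable then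
    finishes. *)
Lemma max_on_rectangle (f : R -> R -> R) (a b c d : R) :
  a <= b -> c <= d ->
  (forall x y, a <= x <= b -> c <= y <= d -> continuity_2d_pt f x y) ->
  exists x0 y0, a <= x0 <= b /\ c <= y0 <= d /\
    forall x y, a <= x <= b -> c <= y <= d -> f x y <= f x0 y0.
Proof.
  intros Hab Hcd Hf.
  assert (Hs : forall y, c <= y <= d ->
    exists x0, a <= x0 <= b /\ forall x, a <= x <= b -> f x y <= f x0 y).
  { intros y Hy. destruct (continuity_ab_maj (fun x => f x y) a b Hab) as [m [H1 H2]].
    - intros x Hx. apply continuity_2d_pt_section. now apply Hf.
    - exists m. split; assumption. }
  (* Clamping [y] lets the column maximum be continuous in the two-sided sense at [c] and [d]. *)
  set (cl := fun y => Rmax c (Rmin y d)).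
  assert (Hcl : forall y, c <= cl y <= d).
  { intro y. unfold cl. split; [apply Rmax_l|]. apply Rmax_lub; [lra|apply Rmin_r]. }
  assert (Hcl' : forall y, c <= y <= d -> cl y = y).
  { intros y Hy. unfold cl. rewrite Rmin_left, Rmax_right; lra. }
  (* The supremum defines the column maximum as a function without choosing maximisers. *)
  assert (HM : exists m : R -> R, forall y, c <= y <= d ->
    (exists x0, a <= x0 <= b /\ m y = f x0 y) /\ (forall x, a <= x <= b -> f x y <= m y)).
  { assert (B : forall y, bound (fun v => exists x, a <= x <= b /\ v = f x (cl y))).
    { intro y. destruct (Hs (cl y) (Hcl y)) as [x0 [H0 H1]].
      exists (f x0 (cl y)). intros v [x [Hx ->]]. now apply H1. }
    assert (N : forall y, exists v, exists x, a <= x <= b /\ v = f x (cl y)).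
    { intro y. exists (f a (cl y)), a. split; [lra|reflexivity]. }
    exists (fun y => proj1_sig (completeness _ (B y) (N y))).
    intros y Hy. destruct (completeness _ (B y) (N y)) as [m [Hu Hl]]. simpl.
    rewrite (Hcl' y Hy) in *.
    destruct (Hs y Hy) as [x0 [H0 H1]]. split.
    - exists x0. split; [exact H0|]. apply Rle_antisym.
      + apply Hl. intros v [x [Hx ->]]. now apply H1.
      + apply Hu. exists x0. now split.
    - intros x Hx. apply Hu. exists x. now split. }
  destruct HM as [m Hm].
  destruct (continuity_ab_maj (fun y => m (cl y)) c d Hcd) as [y0 [H1 H2]].
  { intros y Hy. apply continuity_pt_filterlim.
    intros P [eps HP].
    destruct (uniform_continuity_2d f a b c d Hf eps) as [del Hdel].
    assert (Hclc : forall y z, Rabs (cl z - cl y) <= Rabs (z - y)).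
    { intros u v. unfold cl, Rmax, Rmin, Rabs. repeat destruct Rcase_abs;
      repeat destruct Rle_dec; lra. }
    exists del. intros z Hz. apply HP.
    assert (Hyz : Rabs (cl z - cl y) < del).
    { apply Rle_lt_trans with (1 := Hclc y z). exact Hz. }
    destruct (Hm (cl y) (Hcl y)) as [[xy [Bxy Exy]] Uy].
    destruct (Hm (cl z) (Hcl z)) as [[xz [Bxz Exz]] Uz].
    assert (D1 := Hdel xy (cl y) xy (cl z) Bxy (Hcl y) Bxy (Hcl z)).
    assert (D2 := Hdel xz (cl y) xz (cl z) Bxz (Hcl y) Bxz (Hcl z)).
    rewrite !Rminus_diag, !Rabs_R0 in D1, D2.
    specialize (D1 (cond_pos del) Hyz). specialize (D2 (cond_pos del) Hyz).
    specialize (Uy xz Bxz). specialize (Uz xy Bxy).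
    apply Rabs_def2 in D1, D2.
    change (Rabs (m (cl z) - m (cl y)) < eps). apply Rabs_def1; lra. }
  destruct (Hm y0 H2) as [[x0 [B0 E0]] _].
  exists x0, y0. split; [exact B0|]. split; [exact H2|].
  intros x y Hx Hy. rewrite <- E0. specialize (H1 y Hy).
  cbv beta in H1. rewrite (Hcl' y Hy), (Hcl' y0 H2) in H1.
  apply Rle_trans with (2 := H1). now apply (Hm y Hy).
Qed.

(** At a positive maximum of [u2 - u1 - psi] over the strip the slopes satisfy [u2x = u1x + psix],
    the second derivatives are ordered and the time derivative is nonnegative; subtracting the two
    equations contradicts the strict inequality for [psi]. That inequality is requested only where
    the slopes match, so that the quasilinear term [u1xx (a u2x - a u1x)] can be bounded by a
    multiple of [psix]. *)
Lemma comparison_on_strip (a : R -> R) (u1 u1x u1xx u1t u2 u2x u2xx u2t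
    psi psix psixx psit : R -> R -> R) (l : R -> R) (rho t0 t1 : R) :
  0 < rho -> t0 <= t1 ->
  (forall t, t0 <= t <= t1 -> continuity_pt l t) ->
  (forall p, 0 < a p) ->
  (forall s t, 0 <= s <= rho -> t0 <= t <= t1 ->
     continuity_2d_pt (fun s t => u2 (l t + s) t - u1 (l t + s) t - psi (l t + s) t) s t) ->
  (forall x t, l t < x < l t + rho -> t0 < t <= t1 ->
     (is_derive (fun y => u1 y t) x (u1x x t) /\ is_derive (fun y => u1x y t) x (u1xx x t) /\
      is_derive (fun s => u1 x s) t (u1t x t) /\ u1t x t = a (u1x x t) * u1xx x t) /\
     (is_derive (fun y => u2 y t) x (u2x x t) /\ is_derive (fun y => u2x y t) x (u2xx x t) /\
      is_derive (fun s => u2 x s) t (u2t x t) /\ u2t x t = a (u2x x t) * u2xx x t) /\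
     (is_derive (fun y => psi y t) x (psix x t) /\ is_derive (fun y => psix y t) x (psixx x t) /\
      is_derive (fun s => psi x s) t (psit x t)) /\
     (u2x x t = u1x x t + psix x t ->
      a (u2x x t) * psixx x t + u1xx x t * (a (u2x x t) - a (u1x x t)) < psit x t)) ->
  (forall s, 0 <= s <= rho -> u2 (l t0 + s) t0 - u1 (l t0 + s) t0 <= psi (l t0 + s) t0) ->
  (forall t, t0 <= t <= t1 -> u2 (l t) t - u1 (l t) t <= psi (l t) t) ->
  (forall t, t0 <= t <= t1 ->
     u2 (l t + rho) t - u1 (l t + rho) t <= psi (l t + rho) t) ->
  forall s t, 0 <= s <= rho -> t0 <= t <= t1 ->
    u2 (l t + s) t - u1 (l t + s) t <= psi (l t + s) t.
Proof.
  intros Hrho Ht Hl Ha Hc Hint Hbot Hleft Hright s t Hs Ht'.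
  set (F := fun s t => u2 (l t + s) t - u1 (l t + s) t - psi (l t + s) t).
  destruct (max_on_rectangle F 0 rho t0 t1) as [s0 [ts [Bs [Bt Hmax]]]]; [lra|lra|exact Hc|].
  enough (F s0 ts <= 0) by (specialize (Hmax s t Hs Ht'); unfold F in *; lra).
  destruct (Rle_lt_dec (F s0 ts) 0) as [|Hpos]; [assumption|exfalso].
  assert (Nt : t0 < ts).
  { destruct Bt as [[|<-] _]; [assumption|]. specialize (Hbot s0 Bs). unfold F in Hpos. lra. }
  assert (Ns0 : 0 < s0).
  { destruct Bs as [[|<-] _]; [assumption|]. specialize (Hleft ts Bt). unfold F in Hpos.
    rewrite Rplus_0_r in Hpos. lra. }
  assert (Nsr : s0 < rho).
  { destruct Bs as [_ [|E]]; [assumption|]. specialize (Hright ts Bt). unfold F in Hpos.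
    rewrite E in Hpos. lra. }
  set (x := l ts + s0).
  set (G := fun y t => u2 y t - u1 y t - psi y t).
  assert (GF : forall y t, t0 <= t <= t1 -> l t <= y <= l t + rho -> G y t <= G x ts).
  { intros y tt H1 H2. specialize (Hmax (y - l tt) tt). unfold F in Hmax.
    replace (l tt + (y - l tt)) with y in Hmax by ring. apply Hmax; lra. }
  destruct (Hint x ts) as [[A1 [A2 [A3 A4]]] [[B1 [B2 [B3 B4]]] [[C1 [C2 C3]] D]]];
    [unfold x; lra|lra|].
  set (d := Rmin s0 (rho - s0)).
  assert (Hd : 0 < d) by (apply Rmin_pos; lra).
  assert (d <= s0) by apply Rmin_l. assert (d <= rho - s0) by apply Rmin_r.
  destruct (interior_max_derivatives (fun y => G y ts)
    (fun y => u2x y ts - u1x y ts - psix y ts) (u2xx x ts - u1xx x ts - psixx x ts) x d Hd)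
    as [E1 E2].
  - intros y Hy. apply Rabs_def2 in Hy. unfold x in Hy.
    destruct (Hint y ts) as [[P1 _] [[P2 _] [[P3 _] _]]]; [lra|lra|].
    apply @is_derive_minus; [apply @is_derive_minus|]; assumption.
  - apply @is_derive_minus; [apply @is_derive_minus|]; assumption.
  - intros y Hy. apply Rabs_def2 in Hy. unfold x in Hy. apply GF; lra.
  (* The strip moves with [l], so the vertical segment below the maximum point lies in it only for a
     short time, which continuity of [l] provides. Only earlier times are compared, since the
     maximum may sit at [t1]. *)
  - assert (E3 : 0 <= u2t x ts - u1t x ts - psit x ts).
    { destruct (proj1 (continuity_pt_locally l ts) (Hl ts Bt) (mkposreal d Hd)) as [e He]. simpl in He.
      apply left_max_derive_nonneg with (f := fun t => G x t) (x := ts)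
        (d := Rmin e (ts - t0)).
      - apply @is_derive_minus; [apply @is_derive_minus|]; assumption.
      - apply Rmin_pos; [apply cond_pos|lra].
      - intros tt Htt. assert (Rmin e (ts - t0) <= e) by apply Rmin_l.
        assert (Rmin e (ts - t0) <= ts - t0) by apply Rmin_r.
        assert (Q : Rabs (l tt - l ts) < d).
        { apply He. change (Rabs (tt - ts) < e). rewrite Rabs_left; lra. }
        apply Rabs_def2 in Q. apply GF; unfold x; lra. }
    assert (E4 : u2x x ts = u1x x ts + psix x ts) by lra.
    specialize (D E4). assert (Pa := Ha (u2x x ts)).
    rewrite A4, B4 in E3. nra.
Qed.

(** * Classical flows in a wedge *)

Definition clamp (lo hi x : R) : R := Rmax lo (Rmin hi x).

Lemma clamp_bounds (lo hi x : R) : lo <= hi -> lo <= clamp lo hi x <= hi.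
Proof.
  intro H. unfold clamp. split; [apply Rmax_l|]. apply Rmax_lub; [lra|apply Rmin_l].
Qed.

Lemma clamp_id (lo hi x : R) : lo <= x <= hi -> clamp lo hi x = x.
Proof. intro H. unfold clamp. rewrite Rmin_right, Rmax_right; lra. Qed.

Lemma clamp_lipschitz (l h x l' h' x' : R) :
  Rabs (clamp l h x - clamp l' h' x') <= Rabs (l - l') + Rabs (h - h') + Rabs (x - x').
Proof.
  unfold clamp, Rmax, Rmin, Rabs. repeat destruct Rcase_abs; repeat destruct Rle_dec; lra.
Qed.

Lemma clamp_continuity (lo hi x : R -> R) (t : R) :
  continuity_pt lo t -> continuity_pt hi t -> continuity_pt x t ->
  continuity_pt (fun s => clamp (lo s) (hi s) (x s)) t.
Proof.
  intros H1 H2 H3. apply continuity_pt_locally. intro eps.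
  assert (E : 0 < eps / 3) by (assert (He := cond_pos eps); lra).
  destruct (proj1 (continuity_pt_locally lo t) H1 (mkposreal _ E)) as [d1 D1].
  destruct (proj1 (continuity_pt_locally hi t) H2 (mkposreal _ E)) as [d2 D2].
  destruct (proj1 (continuity_pt_locally x t) H3 (mkposreal _ E)) as [d3 D3].
  simpl in *.
  assert (Hd : 0 < Rmin d1 (Rmin d2 d3)).
  { repeat apply Rmin_pos; apply cond_pos. }
  exists (mkposreal _ Hd). intros s Hs. change (Rabs (s - t) < Rmin d1 (Rmin d2 d3)) in Hs.
  assert (Rmin d1 (Rmin d2 d3) <= d1) by apply Rmin_l.
  assert (Rmin d1 (Rmin d2 d3) <= Rmin d2 d3) by apply Rmin_r.
  assert (Rmin d2 d3 <= d2) by apply Rmin_l. assert (Rmin d2 d3 <= d3) by apply Rmin_r.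
  apply Rle_lt_trans with (1 := clamp_lipschitz _ _ _ _ _ _).
  assert (Rabs (lo s - lo t) < eps / 3) by (apply D1; change (Rabs (s - t) < d1); lra).
  assert (Rabs (hi s - hi t) < eps / 3) by (apply D2; change (Rabs (s - t) < d2); lra).
  assert (Rabs (x s - x t) < eps / 3) by (apply D3; change (Rabs (s - t) < d3); lra).
  lra.
Qed.

Lemma clamp_continuity_2d (lo hi x : R -> R -> R) (y t : R) :
  continuity_2d_pt lo y t -> continuity_2d_pt hi y t -> continuity_2d_pt x y t ->
  continuity_2d_pt (fun z s => clamp (lo z s) (hi z s) (x z s)) y t.
Proof.
  intros H1 H2 H3 eps.
  assert (E : 0 < eps / 3) by (assert (He := cond_pos eps); lra).
  destruct (H1 (mkposreal _ E)) as [d1 D1].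
  destruct (H2 (mkposreal _ E)) as [d2 D2].
  destruct (H3 (mkposreal _ E)) as [d3 D3].
  simpl in *.
  assert (Hd : 0 < Rmin d1 (Rmin d2 d3)).
  { repeat apply Rmin_pos; apply cond_pos. }
  exists (mkposreal _ Hd). simpl. intros z s Hz Hs.
  assert (Rmin d1 (Rmin d2 d3) <= d1) by apply Rmin_l.
  assert (Rmin d1 (Rmin d2 d3) <= Rmin d2 d3) by apply Rmin_r.
  assert (Rmin d2 d3 <= d2) by apply Rmin_l. assert (Rmin d2 d3 <= d3) by apply Rmin_r.
  apply Rle_lt_trans with (1 := clamp_lipschitz _ _ _ _ _ _).
  specialize (D1 z s). specialize (D2 z s). specialize (D3 z s).
  assert (Rabs (lo z s - lo y t) < eps / 3) by (apply D1; lra).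
  assert (Rabs (hi z s - hi y t) < eps / 3) by (apply D2; lra).
  assert (Rabs (x z s - x y t) < eps / 3) by (apply D3; lra).
  lra.
Qed.

(* [ux], [uxx] and [ut] are extended continuously outside the closed region, so that
   continuity can be stated without reference to it. *)
Record wedge_flow (a : R -> R) (p0 p1 T b : R) (xi1 xi2 : R -> R)
    (u ux uxx ut : R -> R -> R) : Prop := {
  wf_b : 1 < b;
  wf_slopes : - T < p0 /\ p0 < p1 /\ p1 < T;
  wf_a_pos : forall p, 0 < a p;
  wf_a_lip : forall r, exists L, 0 <= L /\ forall p q, Rabs p <= r -> Rabs q <= r ->
    Rabs (a p - a q) <= L * Rabs (p - q);
  wf_xi1 : C1_neg xi1;
  wf_xi2 : C1_neg xi2;
  wf_xi_pos : forall t, t < 0 -> 0 < xi1 t /\ 0 < xi2 t;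
  wf_u_pos : forall x t, closed_region xi1 xi2 (x, t) -> 0 < u x t;
  wf_cu : forall x t, t < 0 -> continuity_2d_pt u x t;
  wf_cux : forall x t, t < 0 -> continuity_2d_pt ux x t;
  wf_cuxx : forall x t, t < 0 -> continuity_2d_pt uxx x t;
  wf_cut : forall x t, t < 0 -> continuity_2d_pt ut x t;
  wf_dx : forall x t, open_region xi1 xi2 (x, t) -> is_derive (fun y => u y t) x (ux x t);
  wf_dxx : forall x t, open_region xi1 xi2 (x, t) -> is_derive (fun y => ux y t) x (uxx x t);
  wf_dt : forall x t, open_region xi1 xi2 (x, t) -> is_derive (fun s => u x s) t (ut x t);
  wf_pde : forall x t, closed_region xi1 xi2 (x, t) -> ut x t = a (ux x t) * uxx x t;
  wf_left : forall t, t < 0 -> ux (- xi1 t) t = p1 /\ u (- xi1 t) t = T * xi1 t;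
  wf_right : forall t, t < 0 -> ux (xi2 t) t = p0 /\ u (xi2 t) t = T * xi2 t;
  wf_scale_xi : forall t, t < 0 -> xi1 t = b * xi1 (t / b ^ 2) /\ xi2 t = b * xi2 (t / b ^ 2);
  wf_scale_u : forall x t, closed_region xi1 xi2 (x, t) -> u x t = b * u (x / b) (t / b ^ 2);
  wf_scale_ux : forall x t, closed_region xi1 xi2 (x, t) -> ux x t = ux (x / b) (t / b ^ 2);
  wf_scale_uxx : forall x t, closed_region xi1 xi2 (x, t) ->
    b * uxx x t = uxx (x / b) (t / b ^ 2);
  wf_scale_ut : forall x t, closed_region xi1 xi2 (x, t) ->
    b * ut x t = ut (x / b) (t / b ^ 2) }.

Arguments wf_b {a p0 p1 T b xi1 xi2 u ux uxx ut} _.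
Arguments wf_slopes {a p0 p1 T b xi1 xi2 u ux uxx ut} _.
Arguments wf_a_pos {a p0 p1 T b xi1 xi2 u ux uxx ut} _.
Arguments wf_a_lip {a p0 p1 T b xi1 xi2 u ux uxx ut} _.
Arguments wf_xi1 {a p0 p1 T b xi1 xi2 u ux uxx ut} _.
Arguments wf_xi2 {a p0 p1 T b xi1 xi2 u ux uxx ut} _.
Arguments wf_xi_pos {a p0 p1 T b xi1 xi2 u ux uxx ut} _.
Arguments wf_u_pos {a p0 p1 T b xi1 xi2 u ux uxx ut} _.
Arguments wf_cu {a p0 p1 T b xi1 xi2 u ux uxx ut} _.
Arguments wf_cux {a p0 p1 T b xi1 xi2 u ux uxx ut} _.
Arguments wf_cuxx {a p0 p1 T b xi1 xi2 u ux uxx ut} _.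
Arguments wf_cut {a p0 p1 T b xi1 xi2 u ux uxx ut} _.
Arguments wf_dx {a p0 p1 T b xi1 xi2 u ux uxx ut} _.
Arguments wf_dxx {a p0 p1 T b xi1 xi2 u ux uxx ut} _.
Arguments wf_dt {a p0 p1 T b xi1 xi2 u ux uxx ut} _.
Arguments wf_pde {a p0 p1 T b xi1 xi2 u ux uxx ut} _.
Arguments wf_left {a p0 p1 T b xi1 xi2 u ux uxx ut} _.
Arguments wf_right {a p0 p1 T b xi1 xi2 u ux uxx ut} _.
Arguments wf_scale_xi {a p0 p1 T b xi1 xi2 u ux uxx ut} _.
Arguments wf_scale_u {a p0 p1 T b xi1 xi2 u ux uxx ut} _.
Arguments wf_scale_ux {a p0 p1 T b xi1 xi2 u ux uxx ut} _.
Arguments wf_scale_uxx {a p0 p1 T b xi1 xi2 u ux uxx ut} _.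
Arguments wf_scale_ut {a p0 p1 T b xi1 xi2 u ux uxx ut} _.

Lemma C1_neg_continuity (xi : R -> R) (t : R) : C1_neg xi -> t < 0 -> continuity_pt xi t.
Proof.
  intros H Ht. destruct (H t Ht) as [H1 _]. apply continuity_pt_filterlim.
  now apply (ex_derive_continuous xi t).
Qed.

Lemma C1_neg_Derive_continuity (xi : R -> R) (t : R) :
  C1_neg xi -> t < 0 -> continuity_pt (Derive xi) t.
Proof.
  intros H Ht. destruct (H t Ht) as [_ H1]. now apply continuity_pt_filterlim.
Qed.

Lemma nonpos_at_closure (f : R -> R) (l r : R) :
  l < r -> (forall x, l <= x <= r -> continuity_pt f x) ->
  (forall x, l < x < r -> f x <= 0) -> forall x, l <= x <= r -> f x <= 0.
Proof.
  intros Hlr Hc Hf x Hx. destruct (Rle_lt_dec (f x) 0) as [|Hp]; [assumption|exfalso].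
  destruct (proj1 (continuity_pt_locally f x) (Hc x Hx) (mkposreal _ Hp)) as [d Hd].
  simpl in Hd. assert (Pd := cond_pos d).
  destruct (Rle_lt_dec r x) as [Hr|Hr].
  - set (y := Rmax (x - d / 2) ((l + r) / 2)).
    assert (x - d / 2 <= y) by apply Rmax_l. assert ((l + r) / 2 <= y) by apply Rmax_r.
    assert (y < x) by (apply Rmax_lub_lt; lra).
    assert (Q : Rabs (f y - f x) < f x).
    { apply Hd. change (Rabs (y - x) < d). rewrite Rabs_left; lra. }
    apply Rabs_def2 in Q. specialize (Hf y). lra.
  - set (y := Rmin (x + d / 2) ((x + r) / 2)).
    assert (y <= x + d / 2) by apply Rmin_l. assert (y <= (x + r) / 2) by apply Rmin_r.
    assert (x < y) by (apply Rmin_glb_lt; lra).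
    assert (Q : Rabs (f y - f x) < f x).
    { apply Hd. change (Rabs (y - x) < d). rewrite Rabs_right; lra. }
    apply Rabs_def2 in Q. specialize (Hf y). lra.
Qed.

Lemma zero_at_closure (f : R -> R) (l r : R) :
  l < r -> (forall x, l <= x <= r -> continuity_pt f x) ->
  (forall x, l < x < r -> f x = 0) -> forall x, l <= x <= r -> f x = 0.
Proof.
  intros Hlr Hc Hf x Hx. apply Rle_antisym.
  - apply nonpos_at_closure with (l := l) (r := r); try assumption.
    intros y Hy. rewrite Hf; lra.
  - enough (- f x <= 0) by lra.
    apply (nonpos_at_closure (fun y => - f y)) with (l := l) (r := r); try assumption.
    + intros y Hy. apply continuity_pt_opp. now apply Hc.
    + intros y Hy. rewrite Hf; lra.
Qed.

Section Region.

Variables xi1 xi2 : R -> R.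
Hypothesis C1 : C1_neg xi1.
Hypothesis C2 : C1_neg xi2.
Hypothesis Hpos : forall t, t < 0 -> 0 < xi1 t /\ 0 < xi2 t.

Definition region_clamp (x t : R) : R := clamp (- xi1 t) (xi2 t) x.

Lemma region_clamp_closed (x t : R) : t < 0 -> closed_region xi1 xi2 (region_clamp x t, t).
Proof.
  intro Ht. split; [exact Ht|]. simpl. apply clamp_bounds. destruct (Hpos t Ht). lra.
Qed.

Lemma region_clamp_id (x t : R) : closed_region xi1 xi2 (x, t) -> region_clamp x t = x.
Proof. intros [_ H]. now apply clamp_id. Qed.

Lemma region_clamp_continuity (x t : R) :
  t < 0 -> continuity_2d_pt region_clamp x t.
Proof.
  intro Ht.
  apply (clamp_continuity_2d (fun _ s => - xi1 s) (fun _ s => xi2 s) (fun z _ => z)).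
  - apply continuity_2d_pt_snd, continuity_pt_opp. now apply C1_neg_continuity.
  - apply continuity_2d_pt_snd. now apply C1_neg_continuity.
  - apply continuity_2d_pt_id1.
Qed.

(** The map sending [(x, t)] to [(region_clamp x t, t)] is continuous and lands in the closed
    region, so relative continuity of [v] there becomes ordinary continuity of an extension that is
    constant in [x] beyond the lateral boundary. *)
Lemma clamp_extension_continuity (v : R -> R -> R) (x t : R) :
  continuous_on_region xi1 xi2 v -> t < 0 ->
  continuity_2d_pt (fun y s => v (region_clamp y s) s) x t.
Proof.
  intros Hv Ht. apply continuity_2d_pt_filterlim. simpl.
  assert (K := Hv (region_clamp x t, t) (region_clamp_closed x t Ht)). simpl in K.
  apply (filterlim_comp _ _ _ (fun z : R * R => (region_clamp (fst z) (snd z), snd z))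
    (fun q => v (fst q) (snd q)) (locally (x, t))
    (within (closed_region xi1 xi2) (locally (region_clamp x t, t)))); [|exact K].
  intros P HP. unfold within in HP. unfold filtermap.
  assert (K2 : filterlim (fun z : R * R => (region_clamp (fst z) (snd z), snd z))
     (locally (x, t)) (locally (region_clamp x t, t))).
  { intros Q [eps HQ].
    destruct (region_clamp_continuity x t Ht eps) as [d Hd].
    assert (Hm : 0 < Rmin d eps) by (apply Rmin_pos; apply cond_pos).
    assert (M1 := Rmin_l d eps). assert (M2 := Rmin_r d eps).
    exists (mkposreal _ Hm). intros z [Z1 Z2].
    change (Rabs (fst z - x) < Rmin d eps) in Z1. change (Rabs (snd z - t) < Rmin d eps) in Z2.
    apply HQ. split; simpl.
    - change (Rabs (region_clamp (fst z) (snd z) - region_clamp x t) < eps). apply Hd; lra.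
    - change (Rabs (snd z - t) < eps). lra. }
  specialize (K2 _ HP). unfold filtermap in K2.
  assert (K3 : locally (x, t) (fun z : R * R => snd z < 0)).
  { apply (locally_2d_locally (fun _ s => s < 0)).
    assert (Ht' : 0 < - t) by lra.
    exists (mkposreal _ Ht'). simpl. intros y s _ Hs. apply Rabs_def2 in Hs. lra. }
  generalize (filter_and _ _ K2 K3). apply filter_imp. intros z [Z1 Z2].
  apply Z1. now apply region_clamp_closed.
Qed.

Lemma open_region_in_x (x t : R) : open_region xi1 xi2 (x, t) ->
  locally x (fun y => open_region xi1 xi2 (y, t)).
Proof.
  intros [Ht Hx]. simpl in *.
  assert (Hd : 0 < Rmin (x + xi1 t) (xi2 t - x)) by (apply Rmin_pos; lra).
  exists (mkposreal _ Hd). intros y Hy. change (Rabs (y - x) < Rmin (x + xi1 t) (xi2 t - x)) in Hy.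
  assert (Rmin (x + xi1 t) (xi2 t - x) <= x + xi1 t) by apply Rmin_l.
  assert (Rmin (x + xi1 t) (xi2 t - x) <= xi2 t - x) by apply Rmin_r.
  apply Rabs_def2 in Hy. split; simpl; lra.
Qed.

Lemma open_region_box (l r t : R) : t < 0 -> - xi1 t < l -> r < xi2 t ->
  exists d, 0 < d /\ forall x s, l <= x <= r -> Rabs (s - t) <= d -> open_region xi1 xi2 (x, s).
Proof.
  intros Ht Hl Hr.
  assert (E1 : 0 < l + xi1 t) by lra. assert (E2 : 0 < xi2 t - r) by lra.
  destruct (proj1 (continuity_pt_locally xi1 t) (C1_neg_continuity _ _ C1 Ht) (mkposreal _ E1))
    as [d1 D1].
  destruct (proj1 (continuity_pt_locally xi2 t) (C1_neg_continuity _ _ C2 Ht) (mkposreal _ E2))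
    as [d2 D2].
  simpl in *. assert (P1 := cond_pos d1). assert (P2 := cond_pos d2).
  exists (Rmin (Rmin (d1 / 2) (d2 / 2)) (- t / 2)). split.
  { repeat apply Rmin_pos; lra. }
  intros x s Hx Hs.
  assert (M := Rmin_l (Rmin (d1 / 2) (d2 / 2)) (- t / 2)).
  assert (M2 := Rmin_r (Rmin (d1 / 2) (d2 / 2)) (- t / 2)).
  assert (M3 := Rmin_l (d1 / 2) (d2 / 2)). assert (M4 := Rmin_r (d1 / 2) (d2 / 2)).
  assert (Q1 : Rabs (xi1 s - xi1 t) < l + xi1 t) by (apply D1; change (Rabs (s - t) < d1); lra).
  assert (Q2 : Rabs (xi2 s - xi2 t) < xi2 t - r) by (apply D2; change (Rabs (s - t) < d2); lra).
  apply Rabs_def2 in Q1, Q2. assert (Q3 : s < 0).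
  { unfold Rabs in Hs. destruct Rcase_abs in Hs; lra. }
  split; simpl; lra.
Qed.

Lemma open_region_in_t (x t : R) : open_region xi1 xi2 (x, t) ->
  locally t (fun s => open_region xi1 xi2 (x, s)).
Proof.
  intros [Ht Hx]. simpl in *.
  destruct (open_region_box x x t Ht) as [d [Hd H]]; [lra|lra|].
  exists (mkposreal _ Hd). intros s Hs. change (Rabs (s - t) < d) in Hs. apply H; lra.
Qed.

Lemma open_closed (q : R * R) : open_region xi1 xi2 q -> closed_region xi1 xi2 q.
Proof. intros [H1 H2]. split; lra. Qed.

(** Between [t0] and [t1] the region fits into a rectangle. Composing with [region_clamp] carries
    [f] to that rectangle without adding values, and the maximum point is projected back. *)
Lemma max_on_closed_region (f : R -> R -> R) (t0 t1 : R) :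
  t0 <= t1 -> t1 < 0 ->
  (forall x t, t < 0 -> continuity_2d_pt f x t) ->
  exists x t, closed_region xi1 xi2 (x, t) /\ t0 <= t <= t1 /\
    forall y s, closed_region xi1 xi2 (y, s) -> t0 <= s <= t1 -> f y s <= f x t.
Proof.
  intros Ht Ht1 Hf.
  assert (BB : exists r, 0 <= r /\ forall t, t0 <= t <= t1 -> xi1 t <= r /\ xi2 t <= r).
  { destruct (continuity_ab_maj xi1 t0 t1 Ht) as [m1 [M1 I1]].
    { intros s Hs. apply C1_neg_continuity; [assumption|lra]. }
    destruct (continuity_ab_maj xi2 t0 t1 Ht) as [m2 [M2 I2]].
    { intros s Hs. apply C1_neg_continuity; [assumption|lra]. }
    exists (Rmax (xi1 m1) (xi2 m2)). split.
    - apply Rle_trans with (2 := Rmax_l _ _). destruct (Hpos m1); lra.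
    - intros s Hs. split.
      + apply Rle_trans with (2 := Rmax_l _ _). now apply M1.
      + apply Rle_trans with (2 := Rmax_r _ _). now apply M2. }
  destruct BB as [r [Hr B]].
  destruct (max_on_rectangle (fun x t => f (region_clamp x t) t) (- r) r t0 t1)
    as [x [t [Bx [Bt M]]]]; [lra|exact Ht| |].
  { intros x t Hx Hts. apply continuity_2d_pt_comp with (g := region_clamp) (h := fun _ s => s).
    - apply Hf. lra.
    - apply region_clamp_continuity. lra.
    - apply continuity_2d_pt_id2. }
  exists (region_clamp x t), t. split; [apply region_clamp_closed; lra|]. split; [exact Bt|].
  intros y s Hy Hs. specialize (M y s). rewrite (region_clamp_id y s Hy) in M. apply M; [|exact Hs].
  destruct Hy as [_ Hy]. simpl in Hy. destruct (B s Hs). lra.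
Qed.

Lemma bounded_on_closed_region (f : R -> R -> R) (t0 t1 : R) :
  t0 <= t1 -> t1 < 0 ->
  (forall x t, t < 0 -> continuity_2d_pt f x t) ->
  exists M, 0 < M /\ forall y s, closed_region xi1 xi2 (y, s) -> t0 <= s <= t1 -> Rabs (f y s) <= M.
Proof.
  intros Ht Ht1 Hf.
  destruct (max_on_closed_region f t0 t1 Ht Ht1 Hf) as [x [t [_ [_ M]]]].
  destruct (max_on_closed_region (fun x t => - f x t) t0 t1 Ht Ht1) as [x' [t' [_ [_ M']]]].
  { intros. apply continuity_2d_pt_opp. now apply Hf. }
  exists (Rabs (f x t) + Rabs (f x' t') + 1). split.
  { assert (H1 := Rabs_pos (f x t)). assert (H2 := Rabs_pos (f x' t')). lra. }
  intros y s Hy Hs. specialize (M y s Hy Hs). specialize (M' y s Hy Hs).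
  simpl in M'. unfold Rabs. repeat destruct Rcase_abs; lra.
Qed.

Lemma region_scale (b x t : R) : 1 < b ->
  (forall t, t < 0 -> xi1 t = b * xi1 (t / b ^ 2) /\ xi2 t = b * xi2 (t / b ^ 2)) ->
  (closed_region xi1 xi2 (x, t) -> closed_region xi1 xi2 (x / b, t / b ^ 2)) /\
  (open_region xi1 xi2 (x, t) -> open_region xi1 xi2 (x / b, t / b ^ 2)).
Proof.
  intros Hb Hs.
  assert (Hb2 : 0 < b ^ 2) by nra.
  assert (N : t < 0 -> t / b ^ 2 < 0).
  { intro Ht. unfold Rdiv. assert (0 < / b ^ 2) by now apply Rinv_0_lt_compat. nra. }
  assert (E : x = b * (x / b)) by (field; lra).
  set (c := b ^ 2) in *. clearbody c.
  split; intros [Ht Hx]; simpl fst in *; simpl snd in *; (split; simpl fst; simpl snd; [now apply N|]);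
  destruct (Hs t Ht) as [S1 S2]; rewrite S1, S2 in Hx; rewrite E in Hx;
  set (y := x / b) in *; set (z1 := xi1 (t / c)) in *; set (z2 := xi2 (t / c)) in *;
  destruct Hx as [X1 X2]; split;
  (apply Rmult_le_reg_l with b || apply Rmult_lt_reg_l with b); lra.
Qed.

End Region.

(** * Decay of differences of solutions along a slanted tube *)

Lemma continuity_2d_pt_shear (f : R -> R -> R) (l : R -> R) (s t : R) :
  continuity_2d_pt f (l t + s) t -> continuity_pt l t ->
  continuity_2d_pt (fun s t => f (l t + s) t) s t.
Proof.
  intros Hf Hl.
  apply (continuity_2d_pt_comp f (fun s t => l t + s) (fun _ t => t)).
  - exact Hf.
  - apply continuity_2d_pt_plus; [now apply (continuity_2d_pt_snd l)|apply continuity_2d_pt_id1].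
  - apply continuity_2d_pt_id2.
Qed.

Lemma continuity_2d_pt_exp (f : R -> R -> R) (x t : R) :
  continuity_2d_pt f x t -> continuity_2d_pt (fun x t => exp (f x t)) x t.
Proof.
  intro H. apply continuity_1d_2d_pt_comp; [|exact H].
  apply derivable_continuous_pt, derivable_pt_exp.
Qed.

Ltac continuity_2d :=
  repeat first
    [ apply continuity_2d_pt_minus | apply continuity_2d_pt_plus | apply continuity_2d_pt_mult
    | apply continuity_2d_pt_opp | apply continuity_2d_pt_const | apply continuity_2d_pt_id1
    | apply continuity_2d_pt_id2 | apply continuity_2d_pt_exp ].

(** Up to a positive factor this is the strict supersolution inequality for a barrier built on
    [(r^2 - xi^2)^2] and moving with speed [v]. With [tau = r ^ 2 - xi ^ 2], diffusion contributes
    at most [12 a1 tau - 8 a0 r^2], drift and motion together at most [4 (B + |v|) r tau]; what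
    remains to be positive is [N tau^2 - M tau + 8 a0 r^2], and [N] is chosen to make its
    discriminant equal to [- M^2]. *)
Lemma tube_barrier_ineq (a0 a1 B v r A xi N M : R) :
  0 < a0 -> 0 <= B -> 0 < r -> a0 <= A <= a1 -> r ^ 2 - xi ^ 2 > 0 ->
  M = 4 * (B + Rabs v) * r + 12 * a1 -> N = M ^ 2 / (16 * (a0 * r ^ 2)) ->
  A * (4 * r ^ 2 - 12 * xi ^ 2) + B * Rabs (4 * xi * (r ^ 2 - xi ^ 2)) <
  N * (r ^ 2 - xi ^ 2) ^ 2 - 4 * xi * (r ^ 2 - xi ^ 2) * v.
Proof.
  intros Ha0 HB Hr [HA0 HA1] Hxi EM EN.
  set (tau := r ^ 2 - xi ^ 2) in *.
  assert (Exi : xi ^ 2 = r ^ 2 - tau) by (unfold tau; ring).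
  assert (Axi : Rabs xi <= r).
  { apply Rabs_le. split; nra. }
  assert (Av := Rle_abs v). assert (Av' := Rle_abs (- v)). rewrite Rabs_Ropp in Av'.
  assert (Pv := Rabs_pos v). assert (Px := Rabs_pos xi).
  assert (E1 : Rabs (4 * xi * tau) = 4 * Rabs xi * tau).
  { rewrite !Rabs_mult. rewrite (Rabs_right 4), (Rabs_right tau); lra. }
  rewrite E1.
  assert (I1 : - (4 * Rabs xi * tau * Rabs v) <= - (4 * xi * tau * v)).
  { assert (xi * v <= Rabs xi * Rabs v). { rewrite <- Rabs_mult. apply Rle_abs. } nra. }
  assert (I2 : Rabs xi * tau <= r * tau) by nra.
  assert (I3 : B * (4 * Rabs xi * tau) <= 4 * B * r * tau) by nra.
  assert (I4 : 4 * Rabs xi * tau * Rabs v <= 4 * r * tau * Rabs v) by nra.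
  rewrite Exi.
  assert (I5 : A * (4 * r ^ 2 - 12 * (r ^ 2 - tau)) <= 12 * a1 * tau - 8 * a0 * r ^ 2).
  { assert (H2 : 0 < r ^ 2) by (apply pow_lt; lra).
    assert (0 <= (a1 - A) * tau) by (apply Rmult_le_pos; lra).
    assert (0 <= (A - a0) * r ^ 2) by (apply Rmult_le_pos; lra). lra. }
  assert (Hq : 0 < a0 * r ^ 2) by (apply Rmult_lt_0_compat; nra).
  assert (I6 : 0 < N * tau ^ 2 - M * tau + 8 * (a0 * r ^ 2)).
  { rewrite EN. set (q := a0 * r ^ 2) in *.
    replace (M ^ 2 / (16 * q) * tau ^ 2 - M * tau + 8 * q)
      with (((M * tau - 8 * q) ^ 2 + 64 * q ^ 2) / (16 * q)) by (field; lra).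
    assert (0 < q ^ 2) by (apply pow_lt; lra).
    assert (H3 := pow2_ge_0 (M * tau - 8 * q)). apply Rdiv_lt_0_compat; lra. }
  rewrite EM in I6. nra.
Qed.

(* The barrier is [h (K - kappa exp (- N (t - t0)) (r^2 - (x - c t)^2)^2)], where
   [c] is the axis of the tube; it is a strict supersolution once [N] is large. *)
Lemma decay_along_tube (a : R -> R) (a0 a1 B x0 xs r t0 t1 e : R) :
  (forall p, 0 < a p) -> 0 < a0 -> 0 <= B -> 0 < r -> t0 < t1 -> 0 < e ->
  exists e', 0 < e' /\
    forall (u1 u1x u1xx u1t u2 u2x u2xx u2t : R -> R -> R) (K h : R),
    0 < h ->
    (forall x t, Rabs (x - (x0 + (xs - x0) * ((t - t0) / (t1 - t0)))) <= r -> t0 <= t <= t1 ->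
      continuity_2d_pt u1 x t /\ continuity_2d_pt u2 x t /\ u2 x t - u1 x t <= h * K /\
      (is_derive (fun y => u1 y t) x (u1x x t) /\ is_derive (fun y => u1x y t) x (u1xx x t) /\
       is_derive (fun s => u1 x s) t (u1t x t) /\ u1t x t = a (u1x x t) * u1xx x t) /\
      (is_derive (fun y => u2 y t) x (u2x x t) /\ is_derive (fun y => u2x y t) x (u2xx x t) /\
       is_derive (fun s => u2 x s) t (u2t x t) /\ u2t x t = a (u2x x t) * u2xx x t) /\
      a0 <= a (u2x x t) <= a1 /\
      Rabs (u1xx x t * (a (u2x x t) - a (u1x x t))) <= B * Rabs (u2x x t - u1x x t)) ->
    (forall x, Rabs (x - x0) <= r -> u2 x t0 - u1 x t0 <= h * (K - e)) ->
    u2 xs t1 - u1 xs t1 <= h * (K - e').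
Proof.
  intros Ha Ha0 HB Hr Ht He.
  set (v := (xs - x0) / (t1 - t0)).
  set (c := fun t => x0 + v * (t - t0)).
  assert (Ec : forall t, x0 + (xs - x0) * ((t - t0) / (t1 - t0)) = c t).
  { intro t. unfold c, v. field. lra. }
  set (M := 4 * (B + Rabs v) * r + 12 * a1).
  set (N := M ^ 2 / (16 * (a0 * r ^ 2))).
  set (k := e / r ^ 4).
  assert (Hk : 0 < k). { unfold k. apply Rdiv_lt_0_compat; [assumption|]. now apply pow_lt. }
  (* On the axis [g = r ^ 2], so this is the gain [k E r ^ 4] of the barrier at [(xs, t1)]. It
     depends neither on [h] nor on the two solutions. *)
  exists (e * exp (- N * (t1 - t0))). split.
  { apply Rmult_lt_0_compat; [assumption|apply exp_pos]. }
  intros u1 u1x u1xx u1t u2 u2x u2xx u2t K h Hh Hin Hbot.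
  set (E := fun t => exp (- N * (t - t0))).
  set (g := fun x t => r ^ 2 - (x - c t) ^ 2).
  set (psi := fun x t => h * (K - k * E t * g x t ^ 2)).
  set (psix := fun x t => h * k * E t * (4 * (x - c t) * g x t)).
  set (psixx := fun x t => h * k * E t * (4 * r ^ 2 - 12 * (x - c t) ^ 2)).
  set (psit := fun x t => h * k * E t * (N * g x t ^ 2 - 4 * (x - c t) * g x t * v)).
  assert (Tube : forall x t, c t - r <= x <= c t - r + 2 * r -> Rabs (x - c t) <= r).
  { intros x t H. apply Rabs_le. lra. }
  assert (Cc : forall t, continuity_pt c t).
  { intro t. unfold c. apply derivable_continuous_pt. reg. }
  assert (Q : u2 (c t1 - r + r) t1 - u1 (c t1 - r + r) t1 <= psi (c t1 - r + r) t1).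
  { apply (comparison_on_strip a u1 u1x u1xx u1t u2 u2x u2xx u2t psi psix psixx psit
      (fun t => c t - r) (2 * r) t0 t1); try lra.
    - intros t _. apply continuity_pt_minus; [apply Cc|]. apply continuity_pt_cst.
    - exact Ha.
    - intros s t Hs Htt.
      assert (Hx : Rabs (c t - r + s - c t) <= r) by (apply Tube; lra).
      rewrite <- Ec in Hx. specialize (Hin _ _ Hx Htt). rewrite Ec in Hin.
      destruct Hin as [C1 [C2 _]].
      assert (Cl : continuity_pt (fun t => c t - r) t).
      { apply continuity_pt_minus; [apply Cc|]. apply continuity_pt_cst. }
      apply continuity_2d_pt_minus; [apply continuity_2d_pt_minus|].
      + now apply (continuity_2d_pt_shear u2 (fun t => c t - r)).
      + now apply (continuity_2d_pt_shear u1 (fun t => c t - r)).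
      + apply (continuity_2d_pt_shear psi (fun t => c t - r)); [|exact Cl].
        unfold psi, E, g, c. simpl. continuity_2d.
    - intros x t Hx Htt.
      assert (Hx' : Rabs (x - c t) <= r) by (apply Tube; lra).
      assert (Hx2 := Hx'). rewrite <- Ec in Hx2. destruct (Hin x t Hx2) as [_ [_ [_ [D1 [D2 [HA HL]]]]]];
        [lra|].
      split; [exact D1|]. split; [exact D2|]. split; [split; [|split]|].
      + unfold psi, psix, g. auto_derive; [trivial|]. ring.
      + unfold psix, psixx, g. auto_derive; [trivial|]. ring.
      + unfold psi, psit, g, E, c. auto_derive; [trivial|]. unfold Rminus. ring.
      + intro Eq.
        assert (T := tube_barrier_ineq a0 a1 B v r (a (u2x x t)) (x - c t) N M Ha0 HB Hr HA).
        fold (g x t) in T.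
        assert (Pg : g x t > 0). { unfold g. nra. }
        specialize (T Pg eq_refl eq_refl).
        assert (Pw : 0 < h * k * E t).
        { apply Rmult_lt_0_compat; [now apply Rmult_lt_0_compat|apply exp_pos]. }
        replace (u2x x t - u1x x t) with (psix x t) in HL by lra.
        unfold psix in HL. rewrite (Rabs_mult (h * k * E t)), (Rabs_right (h * k * E t)) in HL by lra.
        assert (HL2 := Rle_trans _ _ _ (Rle_abs _) HL).
        unfold psixx, psit.
        apply Rmult_lt_compat_l with (1 := Pw) in T. lra.
    - intros s Hs.
      assert (E0 : c t0 = x0) by (unfold c; ring).
      apply Rle_trans with (h * (K - e)).
      + apply Hbot. rewrite E0. apply Rabs_le. lra.
      + unfold psi. apply Rmult_le_compat_l; [lra|].
        assert (EE : E t0 = 1). { unfold E. rewrite Rminus_diag, Rmult_0_r. apply exp_0. }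
        rewrite EE.
        assert (G2 : g (c t0 - r + s) t0 ^ 2 <= r ^ 4).
        { assert (G0 : 0 <= g (c t0 - r + s) t0 <= r ^ 2).
          { unfold g. replace (c t0 - r + s - c t0) with (s - r) by ring.
            assert (H3 := pow2_ge_0 (s - r)).
            assert (H4 : 0 <= s * (2 * r - s)) by (apply Rmult_le_pos; lra). split; lra. }
          replace (r ^ 4) with ((r ^ 2) ^ 2) by ring. apply pow_incr. exact G0. }
        assert (k * r ^ 4 = e). { unfold k. field. lra. }
        apply Rmult_le_compat_l with (r := k) in G2; lra.
    - intros t Htt.
      assert (Hx : Rabs (c t - r - c t) <= r) by (apply Tube; lra).
      rewrite <- Ec in Hx. destruct (Hin _ _ Hx Htt) as [_ [_ [H _]]]. rewrite Ec in H.
      unfold psi, g. replace (c t - r - c t) with (- r) by ring.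
      replace ((r ^ 2 - (- r) ^ 2) ^ 2) with 0 by ring. rewrite Rmult_0_r, Rminus_0_r. exact H.
    - intros t Htt.
      assert (Hx : Rabs (c t - r + 2 * r - c t) <= r) by (apply Tube; lra).
      rewrite <- Ec in Hx. destruct (Hin _ _ Hx Htt) as [_ [_ [H _]]]. rewrite Ec in H.
      unfold psi, g. replace (c t - r + 2 * r - c t) with r by ring.
      replace ((r ^ 2 - r ^ 2) ^ 2) with 0 by ring. rewrite Rmult_0_r, Rminus_0_r. exact H. }
  replace (c t1 - r + r) with xs in Q by (unfold c, v; field; lra).
  apply Rle_trans with (1 := Q). unfold psi. apply Req_le. f_equal.
  replace (g xs t1) with (r ^ 2) by (unfold g, c, v; field; lra).
  unfold E, k. field. lra.
Qed.

(** * Strong maximum principle *)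

Lemma is_derive_shift (f : R -> R) (c x l : R) :
  is_derive f (x + c) l -> is_derive (fun y => f (y + c)) x l.
Proof.
  intro H. replace l with (scal 1 l) by (unfold scal; simpl; unfold mult; simpl; ring).
  apply (is_derive_comp f (fun y => y + c)); [exact H|].
  auto_derive; [trivial|ring].
Qed.

Lemma is_derive_le_of_left_increments (f : R -> R) (x l C r : R) :
  is_derive f x l -> 0 < r -> (forall h, 0 < h < r -> f x - f (x - h) <= h * C) -> l <= C.
Proof.
  intros Hd Hr H.
  enough (0 <= C - l) by lra.
  apply (left_max_derive_nonneg (fun y => C * y - f y) x (C - l) r).
  - apply @is_derive_minus; [|exact Hd]. auto_derive; [trivial|ring].
  - exact Hr.
  - intros y Hy. specialize (H (x - y)). replace (x - (x - y)) with y in H by ring. lra.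
Qed.

Lemma continuity_2d_pt_shift (f : R -> R -> R) (c d x t : R) :
  continuity_2d_pt f (x + c) (t + d) ->
  continuity_2d_pt (fun y s => f (y + c) (s + d)) x t.
Proof.
  intro H. apply (continuity_2d_pt_comp f (fun y _ => y + c) (fun _ s => s + d)).
  - exact H.
  - continuity_2d.
  - continuity_2d.
Qed.

Section Flow.

Variables (a : R -> R) (p0 p1 T b : R) (xi1 xi2 : R -> R) (u ux uxx ut : R -> R -> R).
Hypothesis W : wedge_flow a p0 p1 T b xi1 xi2 u ux uxx ut.

Let C1 := wf_xi1 W.
Let C2 := wf_xi2 W.
Let Hpos := wf_xi_pos W.

Lemma a_continuity (p : R) : continuity_pt a p.
Proof.
  destruct (wf_a_lip W (Rabs p + 1)) as [L [HL H]].
  apply continuity_pt_locally. intro eps.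
  assert (Hd : 0 < Rmin 1 (eps / (L + 1))).
  { apply Rmin_pos; [lra|]. apply Rdiv_lt_0_compat; [apply cond_pos|lra]. }
  exists (mkposreal _ Hd). intros q Hq. change (Rabs (q - p) < Rmin 1 (eps / (L + 1))) in Hq.
  assert (H1 := Rmin_l 1 (eps / (L + 1))). assert (H2 := Rmin_r 1 (eps / (L + 1))).
  assert (Rabs q <= Rabs p + 1).
  { replace q with (p + (q - p)) by ring. apply Rle_trans with (1 := Rabs_triang _ _). lra. }
  apply Rle_lt_trans with (L * Rabs (q - p)). { apply H; lra. }
  apply Rle_lt_trans with ((L + 1) * Rabs (q - p)).
  { assert (Q := Rabs_pos (q - p)). nra. }
  apply Rlt_le_trans with ((L + 1) * (eps / (L + 1))).
  { apply Rmult_lt_compat_l; lra. }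
  apply Req_le. field. lra.
Qed.

Lemma a_bounds (r : R) : 0 <= r ->
  exists a0 a1, 0 < a0 /\ forall p, Rabs p <= r -> a0 <= a p <= a1.
Proof.
  intro Hr.
  destruct (continuity_ab_min a (- r) r) as [m [Hm _]]; [lra|intros; apply a_continuity|].
  destruct (continuity_ab_maj a (- r) r) as [m' [Hm' _]]; [lra|intros; apply a_continuity|].
  exists (a m), (a m'). split; [apply (wf_a_pos W)|].
  intros p Hp. assert (- r <= p <= r) by (apply Rabs_le_between; exact Hp).
  split; [now apply Hm|now apply Hm'].
Qed.

(** In the equation for a difference of two solutions, [uxx (a q - a p)] acts as a drift: it is at
    most [B |q - p|] because [uxx] is bounded on a compact time interval and [a] is Lipschitz on the
    range of [ux]. *)
Lemma pde_coefficient_bounds (t0 t1 : R) : t0 <= t1 -> t1 < 0 ->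
  exists a0 a1 B, 0 < a0 /\ 0 <= B /\
    forall x s y t, closed_region xi1 xi2 (x, s) -> closed_region xi1 xi2 (y, t) ->
      t0 <= s <= t1 -> t0 <= t <= t1 ->
      a0 <= a (ux x s) <= a1 /\
      Rabs (uxx x s * (a (ux y t) - a (ux x s))) <= B * Rabs (ux y t - ux x s).
Proof.
  intros Ht Ht1.
  destruct (bounded_on_closed_region xi1 xi2 C1 C2 Hpos ux t0 t1 Ht Ht1
    (wf_cux W)) as [M [PM HM]].
  destruct (bounded_on_closed_region xi1 xi2 C1 C2 Hpos uxx t0 t1 Ht Ht1
    (wf_cuxx W)) as [M2 [PM2 HM2]].
  destruct (wf_a_lip W M) as [L [HL Lip]].
  destruct (a_bounds M) as [a0 [a1 [Ha0 Hab]]]; [lra|].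
  exists a0, a1, (M2 * L). split; [exact Ha0|]. split; [nra|].
  intros x s y t Hx Hy Hs Htt. split; [apply Hab; now apply HM|].
  rewrite Rabs_mult, Rmult_assoc. apply Rmult_le_compat; try apply Rabs_pos.
  - now apply HM2.
  - apply Lip; now apply HM.
Qed.

Lemma flow_shift_derivatives (c d x t : R) : open_region xi1 xi2 (x + c, t + d) ->
  is_derive (fun y => u (y + c) (t + d)) x (ux (x + c) (t + d)) /\
  is_derive (fun y => ux (y + c) (t + d)) x (uxx (x + c) (t + d)) /\
  is_derive (fun s => u (x + c) (s + d)) t (ut (x + c) (t + d)) /\
  ut (x + c) (t + d) = a (ux (x + c) (t + d)) * uxx (x + c) (t + d).
Proof.
  intro H. split; [|split; [|split]].
  - apply (is_derive_shift (fun y => u y (t + d))). now apply (wf_dx W).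
  - apply (is_derive_shift (fun y => ux y (t + d))). now apply (wf_dxx W).
  - apply (is_derive_shift (fun s => u (x + c) s)). now apply (wf_dt W).
  - apply (wf_pde W). now apply open_closed.
Qed.

(* [sx = 1, st = 0] gives the principle for [ux], and [sx = 0, st = 1] for [ut]: the
   difference quotients of [u] in [x] and in [t] solve the same kind of linear equation. *)
Lemma strong_maximum_principle (sx st K t1 d0 x0 xs : R) :
  (sx = 1 /\ st = 0) \/ (sx = 0 /\ st = 1) ->
  t1 < 0 -> 0 < d0 ->
  - xi1 t1 < x0 < xi2 t1 -> - xi1 t1 < xs < xi2 t1 ->
  (forall x t, open_region xi1 xi2 (x, t) -> t1 - d0 <= t <= t1 ->
     sx * ux x t + st * ut x t <= K) ->
  sx * ux x0 t1 + st * ut x0 t1 < K -> sx * ux xs t1 + st * ut xs t1 < K.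
Proof.
  intros Hdir Ht1 Hd0 Hx0 Hxs HK Hlt.
  set (g := fun x t => sx * ux x t + st * ut x t).
  (* Half of the gap at [(x0, t1)]: by continuity it survives on a neighbourhood, in particular at
     the slightly earlier time [t1 - dd] at which the tube starts. *)
  set (e := (K - g x0 t1) / 2).
  assert (He : 0 < e) by (unfold e, g; lra).
  assert (Cg : continuity_2d_pt g x0 t1).
  { unfold g. continuity_2d; [apply (wf_cux W)|
      apply (wf_cut W)]; assumption. }
  destruct (Cg (mkposreal e He)) as [del Hdel]. simpl in Hdel.
  assert (Pdel := cond_pos del).
  set (lo := Rmin x0 xs). set (hi := Rmax x0 xs).
  assert (Hlo : - xi1 t1 < lo) by (apply Rmin_glb_lt; lra).
  assert (Hhi : hi < xi2 t1) by (apply Rmax_lub_lt; lra).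
  assert (L1 : lo <= x0) by apply Rmin_l. assert (L2 : lo <= xs) by apply Rmin_r.
  assert (U1 : x0 <= hi) by apply Rmax_l. assert (U2 : xs <= hi) by apply Rmax_r.
  set (r := Rmin (Rmin ((lo + xi1 t1) / 3) ((xi2 t1 - hi) / 3)) (del / 3)).
  assert (Hr : 0 < r) by (repeat apply Rmin_pos; lra).
  assert (R1 : r <= (lo + xi1 t1) / 3).
  { apply Rle_trans with (2 := Rmin_l _ ((xi2 t1 - hi) / 3)). apply Rmin_l. }
  assert (R2 : r <= (xi2 t1 - hi) / 3).
  { apply Rle_trans with (2 := Rmin_r ((lo + xi1 t1) / 3) _). apply Rmin_l. }
  assert (R3 : r <= del / 3) by apply Rmin_r.
  destruct (open_region_box xi1 xi2 C1 C2 (lo - 2 * r) (hi + 2 * r) t1 Ht1) as [d [Hd Hbox]];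
    [lra|lra|].
  set (dd := Rmin (Rmin d d0) del / 3).
  assert (Hdd : 0 < dd).
  { assert (0 < Rmin (Rmin d d0) del) by (repeat apply Rmin_pos; assumption). unfold dd. lra. }
  assert (D0 : 3 * dd <= Rmin d d0).
  { assert (M := Rmin_l (Rmin d d0) del). unfold dd. lra. }
  assert (D1 : 3 * dd <= d) by (apply Rle_trans with (1 := D0); apply Rmin_l).
  assert (D2 : 3 * dd <= d0) by (apply Rle_trans with (1 := D0); apply Rmin_r).
  assert (D3 : 3 * dd <= del).
  { assert (M := Rmin_r (Rmin d d0) del). unfold dd. lra. }
  assert (Box : forall x t, lo - 2 * r <= x <= hi + 2 * r -> t1 - 2 * dd <= t <= t1 ->
    open_region xi1 xi2 (x, t)).
  { intros x t Hx Ht. apply Hbox; [exact Hx|]. apply Rabs_le. lra. }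
  destruct (pde_coefficient_bounds (t1 - 2 * dd) t1) as [a0 [a1 [B [Ha0 [HB Hcoef]]]]];
    [lra|exact Ht1|].
  (* The short time [dd] is enough to travel from [x0] to [xs]. This infinite speed of propagation
     is why the conclusion holds on the slice [t1] itself. *)
  destruct (decay_along_tube a a0 a1 B x0 xs r (t1 - dd) t1 e
    (wf_a_pos W) Ha0 HB Hr) as [e' [He' Hdec]]; [lra|exact He|].
  set (hm := Rmin r dd).
  assert (Hhm : 0 < hm) by (apply Rmin_pos; assumption).
  assert (Hm1 : hm <= r) by apply Rmin_l. assert (Hm2 : hm <= dd) by apply Rmin_r.
  (* The mean value theorem turns a bound on the directional derivative [g] into a bound on the
     increment over a backward step of length [h]. *)
  assert (Inc : forall C x t h, 0 < h < hm -> lo - r <= x <= hi + r -> t1 - dd <= t <= t1 ->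
    (forall y s, x - h <= y <= x -> t - h <= s <= t -> g y s <= C) ->
    u x t - u (x + - (h * sx)) (t + - (h * st)) <= h * C).
  { intros C x t h Hh Hx Ht HC. destruct Hdir as [[-> ->]|[-> ->]].
    - replace (t + - (h * 0)) with t by ring. rewrite Rmult_1_r.
      destruct (mean_value (fun y => u y t) (fun y => ux y t) (x + - h) x) as [y [Hy Ey]]; [lra| | |].
      + intros y Hy. apply (wf_dx W). apply Box; lra.
      + intros y Hy. apply continuity_2d_pt_section, (wf_cu W). lra.
      + simpl in Ey. rewrite Ey. specialize (HC y t). unfold g in HC.
        replace (x - (x + - h)) with h by ring. rewrite Rmult_comm.
        apply Rmult_le_compat_l; lra.
    - replace (x + - (h * 0)) with x by ring. rewrite Rmult_1_r.
      destruct (mean_value (fun s => u x s) (fun s => ut x s) (t + - h) t) as [s [Hs Es]]; [lra| | |].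
      + intros s Hs. apply (wf_dt W). apply Box; lra.
      + intros s Hs. apply is_derive_continuity_pt with (ut x s).
        apply (wf_dt W). apply Box; lra.
      + simpl in Es. rewrite Es. specialize (HC x s). unfold g in HC.
        replace (t - (t + - h)) with h by ring. rewrite Rmult_comm.
        apply Rmult_le_compat_l; lra. }
  assert (Sh : forall h, 0 < h < hm -> 0 <= h * sx <= h /\ 0 <= h * st <= h).
  { intros h Hh. destruct Hdir as [[-> ->]|[-> ->]]; lra. }
  assert (Fin : forall h, 0 < h < hm ->
    u xs t1 - u (xs + - (h * sx)) (t1 + - (h * st)) <= h * (K - e')).
  { intros h Hh. destruct (Sh h Hh) as [Shx Sht].
    apply (Hdec (fun x t => u (x + - (h * sx)) (t + - (h * st)))
      (fun x t => ux (x + - (h * sx)) (t + - (h * st)))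
      (fun x t => uxx (x + - (h * sx)) (t + - (h * st)))
      (fun x t => ut (x + - (h * sx)) (t + - (h * st))) u ux uxx ut K h); [lra| |].
    - intros x t Hx Ht.
      assert (Bx : lo - r <= x <= hi + r).
      { apply Rabs_le_between in Hx.
        set (w := (t - (t1 - dd)) / (t1 - (t1 - dd))) in Hx.
        assert (Hw : 0 <= w <= 1).
        { unfold w. replace (t1 - (t1 - dd)) with dd by ring. split.
          - apply Rdiv_le_0_compat; lra.
          - apply Rmult_le_reg_r with dd; [lra|]. unfold Rdiv.
            rewrite Rmult_assoc, Rinv_l; lra. }
        assert (lo <= x0 + (xs - x0) * w <= hi).
        { replace (x0 + (xs - x0) * w) with ((1 - w) * x0 + w * xs) by ring.
          assert (0 <= (1 - w) * (x0 - lo)) by (apply Rmult_le_pos; lra).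
          assert (0 <= w * (xs - lo)) by (apply Rmult_le_pos; lra).
          assert (0 <= (1 - w) * (hi - x0)) by (apply Rmult_le_pos; lra).
          assert (0 <= w * (hi - xs)) by (apply Rmult_le_pos; lra). lra. }
        lra. }
      assert (O1 : open_region xi1 xi2 (x, t)) by (apply Box; lra).
      assert (O2 : open_region xi1 xi2 (x + - (h * sx), t + - (h * st))) by (apply Box; lra).
      split; [|split; [|split; [|split; [|split]]]].
      + apply continuity_2d_pt_shift. apply (wf_cu W). lra.
      + apply (wf_cu W). lra.
      + apply Inc; try assumption. intros y s Hy Hs. apply HK; [apply Box|]; lra.
      + now apply flow_shift_derivatives.
      + assert (F := flow_shift_derivatives 0 0 x t). rewrite !Rplus_0_r in F.
        destruct (F O1) as [_ [_ [_ F4]]].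
        split; [|split; [|split]]; [now apply (wf_dx W)|
          now apply (wf_dxx W)|
          now apply (wf_dt W)|exact F4].
      + split.
        * apply (Hcoef x t x t); try (now apply open_closed); lra.
        * apply (Hcoef (x + - (h * sx)) (t + - (h * st)) x t); try (now apply open_closed); lra.
    - intros x Hx. apply Rabs_le_between in Hx. apply Inc; [exact Hh|lra|lra|].
      intros y s Hy Hs.
      assert (Q : Rabs (g y s - g x0 t1) < e). { apply Hdel; apply Rabs_def1; lra. }
      apply Rabs_def2 in Q. unfold e in Q |- *. lra. }
  (* Since [e'] was fixed before [h], the bound on increments survives division by [h] and the
     limit. *)
  apply Rle_lt_trans with (K - e'); [|lra].
  assert (Oxs : open_region xi1 xi2 (xs, t1)) by (apply Box; lra).
  destruct Hdir as [[-> ->]|[-> ->]].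
  - rewrite Rmult_1_l, Rmult_0_l, Rplus_0_r.
    apply (is_derive_le_of_left_increments (fun y => u y t1) xs _ _ hm).
    + now apply (wf_dx W).
    + exact Hhm.
    + intros h Hh. specialize (Fin h Hh). rewrite Rmult_0_r, Ropp_0, Rplus_0_r, Rmult_1_r in Fin.
      exact Fin.
  - rewrite Rmult_1_l, Rmult_0_l, Rplus_0_l.
    apply (is_derive_le_of_left_increments (fun s => u xs s) t1 _ _ hm).
    + now apply (wf_dt W).
    + exact Hhm.
    + intros h Hh. specialize (Fin h Hh). rewrite Rmult_0_r, Ropp_0, Rplus_0_r, Rmult_1_r in Fin.
      exact Fin.
Qed.

End Flow.

Arguments a_continuity {a p0 p1 T b xi1 xi2 u ux uxx ut} _.
Arguments a_bounds {a p0 p1 T b xi1 xi2 u ux uxx ut} _.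
Arguments pde_coefficient_bounds {a p0 p1 T b xi1 xi2 u ux uxx ut} _.
Arguments flow_shift_derivatives {a p0 p1 T b xi1 xi2 u ux uxx ut} _.

Lemma lt_near_right (f : R -> R) (l r K : R) :
  continuity_pt f l -> l < r -> f l < K -> exists x, l < x < r /\ f x < K.
Proof.
  intros Hc Hlr HK. assert (He : 0 < K - f l) by lra.
  destruct (proj1 (continuity_pt_locally f l) Hc (mkposreal _ He)) as [d Hd]. simpl in Hd.
  assert (Pd := cond_pos d).
  assert (M1 := Rmin_l (d / 2) ((r - l) / 2)). assert (M2 := Rmin_r (d / 2) ((r - l) / 2)).
  assert (Pm : 0 < Rmin (d / 2) ((r - l) / 2)) by (apply Rmin_pos; lra).
  set (x := l + Rmin (d / 2) ((r - l) / 2)).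
  exists x. split; [unfold x; lra|].
  assert (Q : Rabs (f x - f l) < K - f l).
  { apply Hd. change (Rabs (x - l) < d). unfold x. rewrite Rabs_right; lra. }
  apply Rabs_def2 in Q. lra.
Qed.

Lemma continuity_2d_pt_reflect (f : R -> R -> R) (x t : R) :
  continuity_2d_pt f (- x) t -> continuity_2d_pt (fun y s => f (- y) s) x t.
Proof.
  intro H. apply (continuity_2d_pt_comp f (fun y _ => - y) (fun _ s => s)).
  - exact H.
  - continuity_2d.
  - continuity_2d.
Qed.

Lemma is_derive_reflect (f : R -> R) (x l : R) :
  is_derive f (- x) l -> is_derive (fun y => f (- y)) x (- l).
Proof.
  intro H. replace (- l) with (scal (-1) l) by (unfold scal; simpl; unfold mult; simpl; ring).
  apply (is_derive_comp f (fun y => - y)); [exact H|].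
  auto_derive; [trivial|ring].
Qed.

Lemma closed_region_reflect (xi1 xi2 : R -> R) (x t : R) :
  closed_region xi2 xi1 (x, t) -> closed_region xi1 xi2 (- x, t).
Proof. intros [H1 H2]. simpl in *. split; simpl; lra. Qed.

Lemma open_region_reflect (xi1 xi2 : R -> R) (x t : R) :
  open_region xi2 xi1 (x, t) -> open_region xi1 xi2 (- x, t).
Proof. intros [H1 H2]. simpl in *. split; simpl; lra. Qed.

(** The reflection [x -> - x] exchanges the two free boundaries and reverses slopes, whence
    [a (- p)] and the interval from [- p1] to [- p0]. Facts proved at the left end transfer to the
    right end through it. *)
Lemma wedge_flow_reflect (a : R -> R) (p0 p1 T b : R) (xi1 xi2 : R -> R)
    (u ux uxx ut : R -> R -> R) :
  wedge_flow a p0 p1 T b xi1 xi2 u ux uxx ut ->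
  wedge_flow (fun p => a (- p)) (- p1) (- p0) T b xi2 xi1 (fun x t => u (- x) t)
    (fun x t => - ux (- x) t) (fun x t => uxx (- x) t) (fun x t => ut (- x) t).
Proof.
  intro W.
  assert (Div : forall x, - x / b = - (x / b)) by (intro; unfold Rdiv; ring).
  constructor.
  - exact (wf_b W).
  - destruct (wf_slopes W). lra.
  - intro p. apply (wf_a_pos W).
  - intro r. destruct (wf_a_lip W r) as [L [HL H]].
    exists L. split; [exact HL|]. intros p q Hp Hq.
    replace (p - q) with (- (- p - - q)) by ring. rewrite Rabs_Ropp.
    apply H; now rewrite Rabs_Ropp.
  - exact (wf_xi2 W).
  - exact (wf_xi1 W).
  - intros t Ht. destruct (wf_xi_pos W t Ht). now split.
  - intros x t H. now apply (wf_u_pos W), closed_region_reflect.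
  - intros x t H. now apply continuity_2d_pt_reflect, (wf_cu W).
  - intros x t H. apply continuity_2d_pt_opp.
    now apply continuity_2d_pt_reflect, (wf_cux W).
  - intros x t H. now apply continuity_2d_pt_reflect, (wf_cuxx W).
  - intros x t H. now apply continuity_2d_pt_reflect, (wf_cut W).
  - intros x t H. apply (is_derive_reflect (fun y => u y t)).
    now apply (wf_dx W), open_region_reflect.
  - intros x t H. replace (uxx (- x) t) with (opp (- uxx (- x) t))
      by (unfold opp; simpl; ring).
    apply @is_derive_opp. apply (is_derive_reflect (fun y => ux y t)).
    now apply (wf_dxx W), open_region_reflect.
  - intros x t H. now apply (wf_dt W), open_region_reflect.
  - intros x t H. rewrite Ropp_involutive.
    now apply (wf_pde W), closed_region_reflect.
  - intros t Ht. rewrite Ropp_involutive.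
    destruct (wf_right W t Ht) as [-> ->]. now split.
  - intros t Ht. destruct (wf_left W t Ht) as [-> ->]. now split.
  - intros t Ht. destruct (wf_scale_xi W t Ht). now split.
  - intros x t H. rewrite <- Div.
    now apply (wf_scale_u W), closed_region_reflect.
  - intros x t H. rewrite <- Div. f_equal.
    now apply (wf_scale_ux W), closed_region_reflect.
  - intros x t H. rewrite <- Div.
    now apply (wf_scale_uxx W), closed_region_reflect.
  - intros x t H. rewrite <- Div.
    now apply (wf_scale_ut W), closed_region_reflect.
Qed.

Arguments wedge_flow_reflect {a p0 p1 T b xi1 xi2 u ux uxx ut} _.

(** * Slope bounds and concavity of the flow *)

Section Flow.

Variables (a : R -> R) (p0 p1 T b : R) (xi1 xi2 : R -> R) (u ux uxx ut : R -> R -> R).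
Hypothesis W : wedge_flow a p0 p1 T b xi1 xi2 u ux uxx ut.

Let C1 := wf_xi1 W.
Let C2 := wf_xi2 W.
Let Hpos := wf_xi_pos W.
Let Hb := wf_b W.

(* A scale invariant function attains its supremum over all [t < 0] on one period; its
   maximum point may be taken off the initial time, so that the past is available. *)
Lemma max_over_period (f : R -> R -> R) (t : R) : t < 0 ->
  (forall x t, t < 0 -> continuity_2d_pt f x t) ->
  (forall x t, closed_region xi1 xi2 (x, t) -> f x t = f (x / b) (t / b ^ 2)) ->
  exists y s, closed_region xi1 xi2 (y, s) /\ b ^ 2 * t < s <= t /\
    forall z r, closed_region xi1 xi2 (z, r) -> b ^ 2 * t <= r <= t -> f z r <= f y s.
Proof.
  intros Ht Hf Hs.
  assert (B2 : 1 < b ^ 2) by nra.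
  destruct (max_on_closed_region xi1 xi2 C1 C2 Hpos f (b ^ 2 * t) t) as [y [s [Hy [Bs M]]]];
    [nra|exact Ht|exact Hf|].
  destruct (Rle_lt_or_eq_dec _ _ (proj1 Bs)) as [Hlt|Heq].
  - exists y, s. split; [exact Hy|]. split; [lra|exact M].
  - exists (y / b), t.
    assert (E : s / b ^ 2 = t) by (rewrite <- Heq; field; lra).
    assert (Q := Hs y s Hy). rewrite E in Q.
    split; [|split].
    + rewrite <- E. apply region_scale; try assumption.
      apply (wf_scale_xi W).
    + split; [nra|lra].
    + rewrite <- Q. exact M.
Qed.

(** If the maximum of [ux] over a period exceeded [p1], it would lie off the lateral boundary, where
    [ux] is [p1] or [p0]. The strong maximum principle, started from a point near the left end where
    [ux] is smaller, would then make this maximum smaller than itself. *)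
Lemma ux_le_left_slope (x t : R) : closed_region xi1 xi2 (x, t) -> ux x t <= p1.
Proof.
  intros Hx. assert (Ht := proj1 Hx). simpl in Ht.
  destruct (max_over_period ux t Ht (wf_cux W)
    (wf_scale_ux W)) as [y [s [Hy [Bs M]]]].
  apply Rle_trans with (ux y s). { apply M; [exact Hx|nra]. }
  destruct (Rle_lt_dec (ux y s) p1) as [|Hgt]; [assumption|exfalso].
  destruct Hy as [Hs Hy]. simpl in Hs, Hy.
  destruct (wf_left W s Hs) as [El _].
  destruct (wf_right W s Hs) as [Er _].
  destruct (wf_slopes W) as [_ [Sl _]].
  assert (Yl : - xi1 s < y).
  { destruct (Rle_lt_or_eq_dec _ _ (proj1 Hy)) as [|E]; [assumption|]. rewrite <- E, El in Hgt. lra. }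
  assert (Yr : y < xi2 s).
  { destruct (Rle_lt_or_eq_dec _ _ (proj2 Hy)) as [|E]; [assumption|]. rewrite E, Er in Hgt. lra. }
  destruct (lt_near_right (fun z => ux z s) (- xi1 s) (xi2 s) (ux y s)) as [x0 [Hx0 L0]].
  - apply continuity_2d_pt_section. now apply (wf_cux W).
  - lra.
  - simpl. lra.
  - assert (Q := strong_maximum_principle a p0 p1 T b xi1 xi2 u ux uxx ut W 1 0 (ux y s) s
      (s - b ^ 2 * t) x0 y (or_introl (conj eq_refl eq_refl)) Hs).
    rewrite !Rmult_1_l, !Rmult_0_l, !Rplus_0_r in Q.
    enough (ux y s < ux y s) by lra. apply Q; try lra.
    intros z r Hz Hr. rewrite Rmult_1_l, Rmult_0_l, Rplus_0_r.
    apply M; [now apply open_closed|lra].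
Qed.

(** At the left end [ux] already equals its upper bound [p1], so it cannot increase from there, as a
    positive [uxx] would force. *)
Lemma uxx_left_nonpos (t : R) : t < 0 -> uxx (- xi1 t) t <= 0.
Proof.
  intro Ht. destruct (Rle_lt_dec (uxx (- xi1 t) t) 0) as [|Hp]; [assumption|exfalso].
  destruct (Hpos t Ht) as [P1 P2].
  assert (Cc : continuity_pt (fun y => uxx y t) (- xi1 t)).
  { apply continuity_2d_pt_section. now apply (wf_cuxx W). }
  destruct (proj1 (continuity_pt_locally _ _) Cc (mkposreal _ Hp)) as [d Hd]. simpl in Hd.
  assert (Pd := cond_pos d).
  assert (M1 := Rmin_l (d / 2) (xi2 t)). assert (M2 := Rmin_r (d / 2) (xi2 t)).
  assert (Pm : 0 < Rmin (d / 2) (xi2 t)) by (apply Rmin_pos; lra).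
  set (x := - xi1 t + Rmin (d / 2) (xi2 t)).
  assert (ux (- xi1 t) t < ux x t).
  { apply (derivative_pos_lt (fun y => ux y t) (fun y => uxx y t)).
    - unfold x. lra.
    - intros y Hy. apply (wf_dxx W). split; simpl; unfold x in Hy; lra.
    - intros y Hy. apply continuity_2d_pt_section. now apply (wf_cux W).
    - intros y Hy. unfold x in Hy.
      assert (Q : Rabs (uxx y t - uxx (- xi1 t) t) < uxx (- xi1 t) t).
      { apply Hd. change (Rabs (y - - xi1 t) < d). rewrite Rabs_right; lra. }
      apply Rabs_def2 in Q. lra. }
  destruct (wf_left W t Ht) as [El _].
  assert (ux x t <= p1). { apply ux_le_left_slope. split; simpl; unfold x; lra. }
  lra.
Qed.

End Flow.

Arguments max_over_period {a p0 p1 T b xi1 xi2 u ux uxx ut} _.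
Arguments ux_le_left_slope {a p0 p1 T b xi1 xi2 u ux uxx ut} _.
Arguments uxx_left_nonpos {a p0 p1 T b xi1 xi2 u ux uxx ut} _.

Section Flow2.

Variables (a : R -> R) (p0 p1 T b : R) (xi1 xi2 : R -> R) (u ux uxx ut : R -> R -> R).
Hypothesis W : wedge_flow a p0 p1 T b xi1 xi2 u ux uxx ut.

Let C1 := wf_xi1 W.
Let C2 := wf_xi2 W.
Let Hpos := wf_xi_pos W.
Let Hb := wf_b W.

Lemma ux_ge_right_slope (x t : R) : closed_region xi1 xi2 (x, t) -> p0 <= ux x t.
Proof.
  intro H. assert (Q := ux_le_left_slope (wedge_flow_reflect W) (- x) t).
  simpl in Q. rewrite Ropp_involutive in Q.
  enough (- ux x t <= - p0) by lra. apply Q. now apply closed_region_reflect.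
Qed.

Lemma uxx_right_nonpos (t : R) : t < 0 -> uxx (xi2 t) t <= 0.
Proof.
  intro H. assert (Q := uxx_left_nonpos (wedge_flow_reflect W) t H).
  simpl in Q. now rewrite Ropp_involutive in Q.
Qed.

Lemma ut_sign (x t : R) : closed_region xi1 xi2 (x, t) ->
  (uxx x t <= 0 -> ut x t <= 0) /\ (ut x t < 0 -> uxx x t < 0) /\ (uxx x t < 0 -> ut x t < 0).
Proof.
  intro H. rewrite (wf_pde W x t H).
  assert (P := wf_a_pos W (ux x t)). repeat split; nra.
Qed.

(* [sqrt (- t) * ut] is scale invariant, and [1 / sqrt (- t)] increases with time. *)
Lemma ut_nonpos (x t : R) : closed_region xi1 xi2 (x, t) -> ut x t <= 0.
Proof.
  intros Hx. assert (Ht := proj1 Hx). simpl in Ht.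
  set (f := fun y s => sqrt (- s) * ut y s).
  destruct (max_over_period W f t Ht) as [y [s [Hy [Bs M]]]].
  - intros y s Hs. unfold f. apply continuity_2d_pt_mult.
    + apply (continuity_2d_pt_snd (fun s => sqrt (- s))).
      apply continuity_pt_comp with (f1 := fun s => - s).
      * apply continuity_pt_opp, derivable_continuous_pt, derivable_pt_id.
      * apply continuity_pt_sqrt. lra.
    + now apply (wf_cut W).
  - intros y s Hy. unfold f. rewrite <- (wf_scale_ut W y s Hy).
    destruct Hy as [Hs _]. simpl in Hs.
    replace (- (s / b ^ 2)) with (- s / b ^ 2) by (unfold Rdiv; ring).
    rewrite sqrt_div_alt by nra. rewrite sqrt_pow2 by lra. field. lra.
  - assert (S0 : 0 < sqrt (- t)) by (apply sqrt_lt_R0; lra).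
    destruct (Rle_lt_dec (f y s) 0) as [Hle|Hgt].
    { assert (Q := M x t Hx). unfold f in Q at 1.
      destruct (Rle_lt_dec (ut x t) 0) as [|Hp]; [assumption|exfalso].
      assert (0 < sqrt (- t) * ut x t) by (apply Rmult_lt_0_compat; assumption).
      assert (b ^ 2 * t <= t) by nra. assert (sqrt (- t) * ut x t <= f y s) by (apply Q; lra). lra. }
    exfalso. assert (Hs := proj1 Hy). simpl in Hs.
    assert (S1 : 0 < sqrt (- s)) by (apply sqrt_lt_R0; lra).
    assert (Up : 0 < ut y s).
    { unfold f in Hgt. destruct (Rle_lt_dec (ut y s) 0); [nra|assumption]. }
    (* The sign of [uxx] at the two ends excludes a positive [ut] there, so the maximum point is
       interior. *)
    assert (Yl : - xi1 s < y).
    { destruct Hy as [_ Hy]. simpl in Hy.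
      destruct (Rle_lt_or_eq_dec _ _ (proj1 Hy)) as [|E]; [assumption|].
      assert (Q := uxx_left_nonpos W s Hs). rewrite E in Q.
      assert (ut y s <= 0) by (apply ut_sign; [split; simpl; lra|exact Q]). lra. }
    assert (Yr : y < xi2 s).
    { destruct Hy as [_ Hy]. simpl in Hy.
      destruct (Rle_lt_or_eq_dec _ _ (proj2 Hy)) as [|E]; [assumption|].
      assert (Q := uxx_right_nonpos s Hs). rewrite <- E in Q.
      assert (ut y s <= 0) by (apply ut_sign; [split; simpl; lra|exact Q]). lra. }
    destruct (lt_near_right (fun z => ut z s) (- xi1 s) (xi2 s) (ut y s)) as [x0 [Hx0 L0]].
    + apply continuity_2d_pt_section. now apply (wf_cut W).
    + lra.
    + simpl. assert (ut (- xi1 s) s <= 0); [|lra].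
      apply ut_sign; [split; simpl; lra|]. now apply (uxx_left_nonpos W).
    + assert (Q := strong_maximum_principle a p0 p1 T b xi1 xi2 u ux uxx ut W 0 1 (ut y s) s
        (s - b ^ 2 * t) x0 y (or_intror (conj eq_refl eq_refl)) Hs).
      rewrite !Rmult_1_l, !Rmult_0_l, !Rplus_0_l in Q.
      enough (ut y s < ut y s) by lra. apply Q; try lra.
      intros z r Hz Hr. rewrite Rmult_1_l, Rmult_0_l, Rplus_0_l.
      assert (Z := M z r (open_closed _ _ _ Hz)). unfold f in Z.
      assert (Z' : sqrt (- r) * ut z r <= sqrt (- s) * ut y s) by (apply Z; lra).
      assert (S2 : sqrt (- s) <= sqrt (- r)) by (apply sqrt_le_1_alt; lra).
      destruct (Rle_lt_dec (ut z r) (ut y s)) as [|Hlt]; [assumption|exfalso]. nra.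
Qed.

(** The slope drops from [p1] to [p0] across each slice, so [uxx], hence [ut], is negative somewhere
    on it; the strong maximum principle with [K = 0] spreads the strict sign over the whole
    slice. *)
Lemma uxx_neg_interior (x t : R) : open_region xi1 xi2 (x, t) -> uxx x t < 0.
Proof.
  intros Hx. assert (Ht := proj1 Hx). simpl in Ht. apply ut_sign; [now apply open_closed|].
  destruct (Hpos t Ht) as [P1 P2].
  destruct (mean_value (fun y => ux y t) (fun y => uxx y t) (- xi1 t) (xi2 t)) as [x0 [Hx0 E]].
  - lra.
  - intros y Hy. apply (wf_dxx W). split; simpl; lra.
  - intros y Hy. apply continuity_2d_pt_section. now apply (wf_cux W).
  - simpl in E. destruct (wf_left W t Ht) as [El _].
    destruct (wf_right W t Ht) as [Er _].
    destruct (wf_slopes W) as [_ [Sl _]].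
    rewrite El, Er in E.
    assert (N : ut x0 t < 0).
    { apply ut_sign; [split; simpl; lra|].
      destruct (Rle_lt_dec 0 (uxx x0 t)) as [|]; [nra|assumption]. }
    assert (Q := strong_maximum_principle a p0 p1 T b xi1 xi2 u ux uxx ut W 0 1 0 t
        1 x0 x (or_intror (conj eq_refl eq_refl)) Ht).
    rewrite !Rmult_1_l, !Rmult_0_l, !Rplus_0_l in Q.
    apply Q; try lra.
    + exact (proj2 Hx).
    + intros z r Hz Hr. rewrite Rmult_1_l, Rmult_0_l, Rplus_0_l.
      apply ut_nonpos. now apply open_closed.
Qed.

Lemma ux_strictly_decreasing (x y t : R) : t < 0 -> - xi1 t <= x -> x < y -> y <= xi2 t ->
  ux y t < ux x t.
Proof.
  intros Ht Hx Hxy Hy. enough (- ux x t < - ux y t) by lra.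
  apply (derivative_pos_lt (fun y => - ux y t) (fun y => - uxx y t)); [assumption| | |].
  - intros z Hz. apply @is_derive_opp. apply (wf_dxx W). split; simpl; lra.
  - intros z Hz. apply continuity_pt_opp, continuity_2d_pt_section.
    now apply (wf_cux W).
  - intros z Hz. assert (uxx z t < 0); [|lra]. apply uxx_neg_interior. split; simpl; lra.
Qed.

End Flow2.

Arguments ux_ge_right_slope {a p0 p1 T b xi1 xi2 u ux uxx ut} _.
Arguments uxx_right_nonpos {a p0 p1 T b xi1 xi2 u ux uxx ut} _.
Arguments ut_sign {a p0 p1 T b xi1 xi2 u ux uxx ut} _.
Arguments ut_nonpos {a p0 p1 T b xi1 xi2 u ux uxx ut} _.
Arguments uxx_neg_interior {a p0 p1 T b xi1 xi2 u ux uxx ut} _.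
Arguments ux_strictly_decreasing {a p0 p1 T b xi1 xi2 u ux uxx ut} _.

(** * Hopf's lemma *)

Lemma is_derive_le_of_right_increments (f : R -> R) (x l C r : R) :
  is_derive f x l -> 0 < r -> (forall h, 0 < h < r -> f (x + h) - f x <= h * C) -> l <= C.
Proof.
  intros Hd Hr H. rewrite <- (Ropp_involutive x) in Hd. apply is_derive_reflect in Hd.
  enough (- C <= - l) by lra. apply Ropp_le_contravar.
  apply (is_derive_le_of_left_increments (fun y => - f (- y)) (- x) l C r).
  - rewrite <- (Ropp_involutive l). now apply @is_derive_opp.
  - exact Hr.
  - intros h Hh. specialize (H h Hh). rewrite Ropp_involutive.
    replace (- (- x - h)) with (x + h) by ring. lra.
Qed.

(** Hopf's lemma for the increments [u (x + h) t - u x t], in coordinates attached to the moving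
    boundary. The slope is at most [p1] and lies below it by a fixed amount at some distance inside,
    so a barrier growing linearly from the boundary gives [ux <= p1 - e s] at distance [s] and time
    [t1]; this bounds [uxx] at the boundary by [- e]. *)
Lemma uxx_neg_at_left (a : R -> R) (p0 p1 T b : R) (xi1 xi2 : R -> R)
    (u ux uxx ut : R -> R -> R) (t1 : R) :
  wedge_flow a p0 p1 T b xi1 xi2 u ux uxx ut -> t1 < 0 -> uxx (- xi1 t1) t1 < 0.
Proof.
  intros W Ht1.
  assert (C1 := wf_xi1 W).
  assert (C2 := wf_xi2 W).
  assert (Hpos := wf_xi_pos W).
  set (t0 := 2 * t1).
  destruct (pde_coefficient_bounds W t0 t1) as [a0 [a1 [B [Ha0 [HB Hcoef]]]]];
    [unfold t0; lra|exact Ht1|].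
  assert (HC : exists C, 0 <= C /\ forall t, t0 <= t <= t1 -> Rabs (Derive xi1 t) <= C).
  { destruct (continuity_ab_maj (fun t => Rabs (Derive xi1 t)) t0 t1) as [m [Hm _]].
    - unfold t0. lra.
    - intros t Ht. apply continuity_pt_comp with (f2 := Rabs).
      + apply C1_neg_Derive_continuity; [exact C1|lra].
      + apply Rcontinuity_abs.
    - exists (Rabs (Derive xi1 m)). split; [apply Rabs_pos|exact Hm]. }
  destruct HC as [C [HC0 HC]].
  (* The second derivative of the barrier must beat the drift [B], the boundary speed [C] and the
     unit rate at which the barrier descends in time. The first two get multiplied by [1 + 2 k s],
     which is at most 2, against a diffusion term of at least [2 a0 k]. *)
  set (k := (B + C + 1) / a0).
  assert (Hk : 0 < k) by (unfold k; apply Rdiv_lt_0_compat; lra).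
  assert (Eka : a0 * k = B + C + 1) by (unfold k; field; lra).
  destruct (continuity_ab_min xi2 t0 t1) as [m2 [Hm2 Im2]]; [unfold t0; lra| |].
  { intros t Ht. apply C1_neg_continuity; [exact C2|lra]. }
  assert (Pm2 : 0 < xi2 m2) by (apply Hpos; lra).
  (* The three bounds keep [1 + 2 k s <= 2] on the strip, make [q <= t1 - t0] there, and keep the
     strip inside the region even after a translation by [h < rho]. *)
  set (rho := Rmin (Rmin (1 / (2 * k)) (- t1 / 2)) (xi2 m2 / 2)).
  assert (Q0 : 0 < 1 / (2 * k)) by (apply Rdiv_lt_0_compat; lra).
  assert (Hrho : 0 < rho) by (repeat apply Rmin_pos; lra).
  assert (R0 : rho <= Rmin (1 / (2 * k)) (- t1 / 2)) by apply Rmin_l.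
  assert (R1 : rho <= 1 / (2 * k)) by (apply Rle_trans with (1 := R0), Rmin_l).
  assert (R2 : rho <= - t1 / 2) by (apply Rle_trans with (1 := R0), Rmin_r).
  assert (R3 : rho <= xi2 m2 / 2) by apply Rmin_r.
  assert (R4 : 2 * k * rho <= 1).
  { apply Rmult_le_compat_l with (r := 2 * k) in R1; [|lra].
    replace (2 * k * (1 / (2 * k))) with 1 in R1 by (field; lra). exact R1. }
  assert (Reg : forall s t, t0 <= t <= t1 -> 0 < s < 2 * rho -> open_region xi1 xi2 (- xi1 t + s, t)).
  { intros s t Ht Hs. specialize (Hm2 t Ht). destruct (Hpos t); [lra|]. split; simpl; lra. }
  assert (HE : exists e0, 0 < e0 /\ forall s t, t0 <= t <= t1 -> rho <= s < 2 * rho ->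
    ux (- xi1 t + s) t <= p1 - e0).
  { destruct (continuity_ab_maj (fun t => ux (- xi1 t + rho) t) t0 t1) as [m [Hm Im]].
    - unfold t0. lra.
    - intros t Ht. apply (continuity_pt_comp_2d ux (fun t => - xi1 t + rho) (fun t => t)).
      + apply (wf_cux W). lra.
      + apply continuity_pt_plus; [apply continuity_pt_opp; apply C1_neg_continuity;
          [exact C1|lra]|apply continuity_pt_cst].
      + apply continuity_pt_id.
    - exists (p1 - ux (- xi1 m + rho) m). split.
      + destruct (wf_left W m) as [El _]; [lra|].
        assert (O := Reg rho m Im). destruct O as [O1 O2]; [lra|]. simpl in O1, O2.
        assert (ux (- xi1 m + rho) m < ux (- xi1 m) m).
        { apply (ux_strictly_decreasing W); lra. }
        lra.
      + intros s t Ht Hs. specialize (Hm t Ht). simpl in Hm.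
        destruct Hs as [[Hs1|<-] Hs2]; [|lra].
        assert (O := Reg s t Ht). destruct O as [O1 O2]; [lra|]. simpl in O1, O2.
        assert (ux (- xi1 t + s) t < ux (- xi1 t + rho) t).
        { apply (ux_strictly_decreasing W); lra. }
        lra. }
  destruct HE as [e0 [He0 HE]].
  set (e := e0 / (2 * rho)).
  assert (He : 0 < e) by (apply Rdiv_lt_0_compat; lra).
  assert (Ee : e * (2 * rho) = e0) by (unfold e; field; lra).
  assert (Key : forall h, 0 < h < rho -> forall s, 0 <= s <= rho ->
    u (- xi1 t1 + s + h) (t1 + 0) - u (- xi1 t1 + s) t1 <= h * (p1 - e * s)).
  { intros h Hh s Hs.
    (* At [t0] the term [t1 - t] dominates [q], so the barrier is at least [h p1]; the same holds at
       [s = 0], and at [s = rho] it is at least [h (p1 - e0)] because [e (2 rho) = e0]. At [t1] that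
       term is gone and [h (p1 - e q)] remains. *)
    set (q := fun s => s + k * s ^ 2).
    set (psi := fun x t => h * (p1 - e * (q (x + xi1 t) - (t1 - t)))).
    set (psix := fun x t => - (h * e) * (1 + 2 * k * (x + xi1 t))).
    set (psixx := fun (x t : R) => - (h * e) * (2 * k)).
    set (psit := fun x t => - (h * e) * ((1 + 2 * k * (x + xi1 t)) * Derive xi1 t + 1)).
    assert (Phe : 0 < h * e) by (apply Rmult_lt_0_compat; lra).
    assert (Cl : forall t, t0 <= t <= t1 -> continuity_pt (fun t => - xi1 t) t).
    { intros t Ht. apply continuity_pt_opp, C1_neg_continuity; [exact C1|lra]. }
    assert (Inc : forall C s t, t0 <= t <= t1 -> 0 <= s <= rho ->
      (forall z, s < z < s + h -> ux (- xi1 t + z) t <= C) ->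
      u (- xi1 t + s + h) (t + 0) - u (- xi1 t + s) t <= h * C).
    { intros C' s' t Ht Hs' HC'. rewrite Rplus_0_r.
      destruct (mean_value (fun y => u y t) (fun y => ux y t) (- xi1 t + s') (- xi1 t + s' + h))
        as [y [Hy Ey]].
      - lra.
      - intros y Hy. apply (wf_dx W).
        replace y with (- xi1 t + (y + xi1 t)) by ring. apply Reg; lra.
      - intros y Hy. apply continuity_2d_pt_section, (wf_cu W). lra.
      - simpl in Ey. rewrite Ey. specialize (HC' (y + xi1 t)).
        replace (- xi1 t + (y + xi1 t)) with y in HC' by ring.
        replace (- xi1 t + s' + h - (- xi1 t + s')) with h by ring.
        rewrite Rmult_comm. apply Rmult_le_compat_l; lra. }
    assert (Le1 : forall z t, t0 <= t <= t1 -> 0 < z < 2 * rho -> ux (- xi1 t + z) t <= p1).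
    { intros z t Ht Hz. apply (ux_le_left_slope W).
      apply open_closed. now apply Reg. }
    apply Rle_trans with (psi (- xi1 t1 + s) t1).
    - apply (comparison_on_strip a u ux uxx ut (fun x t => u (x + h) (t + 0))
        (fun x t => ux (x + h) (t + 0)) (fun x t => uxx (x + h) (t + 0))
        (fun x t => ut (x + h) (t + 0)) psi psix psixx psit (fun t => - xi1 t) rho t0 t1);
        try (unfold t0; lra).
      + exact Cl.
      + apply (wf_a_pos W).
      + intros s' t Hs' Ht. apply continuity_2d_pt_minus; [apply continuity_2d_pt_minus|].
        * apply (continuity_2d_pt_shear (fun x t => u (x + h) (t + 0)) (fun t => - xi1 t));
            [|now apply Cl].
          apply continuity_2d_pt_shift, (wf_cu W). lra.
        * apply (continuity_2d_pt_shear u (fun t => - xi1 t)); [|now apply Cl].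
          apply (wf_cu W). lra.
        * apply (continuity_2d_pt_shear psi (fun t => - xi1 t)); [|now apply Cl].
          unfold psi, q. simpl.
          assert (continuity_2d_pt (fun _ t => xi1 t) (- xi1 t + s') t).
          { apply continuity_2d_pt_snd, C1_neg_continuity; [exact C1|lra]. }
          continuity_2d; assumption.
      + intros x t Hx Ht.
        assert (O1 : open_region xi1 xi2 (x, t)).
        { replace x with (- xi1 t + (x + xi1 t)) by ring. apply Reg; lra. }
        assert (O2 : open_region xi1 xi2 (x + h, t + 0)).
        { rewrite Rplus_0_r. replace (x + h) with (- xi1 t + (x + h + xi1 t)) by ring.
          apply Reg; lra. }
        assert (Dxi : is_derive xi1 t (Derive xi1 t)).
        { apply Derive_correct. apply C1. lra. }
        split; [|split; [|split; [split; [|split]|]]].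
        * assert (F := flow_shift_derivatives W 0 0 x t).
          rewrite !Rplus_0_r in F.
          destruct (F O1) as [_ [_ [_ F4]]].
          split; [|split; [|split]]; [now apply (wf_dx W)|
            now apply (wf_dxx W)|
            now apply (wf_dt W)|exact F4].
        * now apply (flow_shift_derivatives W).
        * unfold psi, psix, q. auto_derive; [trivial|]. ring.
        * unfold psix, psixx. auto_derive; [trivial|]. ring.
        * unfold psi, psit, q. auto_derive.
          -- split; [now exists (Derive xi1 t)|]. split; [now exists (Derive xi1 t)|trivial].
          -- change (Derive (fun x => xi1 x) t) with (Derive xi1 t). ring.
        * intro Eq.
          destruct (Hcoef (x + h) (t + 0) x t) as [HA _]; try (now apply open_closed); try lra.
          destruct (Hcoef x t (x + h) (t + 0)) as [_ HL]; try (now apply open_closed); try lra.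
          replace (ux (x + h) (t + 0) - ux x t) with (psix x t) in HL by lra.
          assert (HL2 := Rle_trans _ _ _ (Rle_abs _) HL).
          set (sg := x + xi1 t) in *.
          assert (Bq : 1 <= 1 + 2 * k * sg <= 2).
          { assert (0 <= 2 * k * sg) by (apply Rmult_le_pos; unfold sg; lra).
            assert (2 * k * sg <= 2 * k * rho) by (apply Rmult_le_compat_l; unfold sg; lra). lra. }
          unfold psix in HL2. fold sg in HL2.
          rewrite Rabs_mult, Rabs_Ropp, (Rabs_right (h * e)), (Rabs_right (1 + _)) in HL2 by lra.
          unfold psixx, psit. fold sg.
          set (A := a (ux (x + h) (t + 0))) in *.
          assert (HD : Rabs (Derive xi1 t) <= C) by (apply HC; lra).
          apply Rabs_le_between in HD.
          set (Q := 1 + 2 * k * sg) in *. set (D := Derive xi1 t) in *.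
          assert (Z1 : 2 * (B + C + 1) <= A * (2 * k)).
          { replace (2 * (B + C + 1)) with (a0 * (2 * k)) by lra.
            apply Rmult_le_compat_r; lra. }
          assert (Z2 : Q * D <= 2 * C).
          { apply Rle_trans with (Q * C); [apply Rmult_le_compat_l; lra|].
            apply Rmult_le_compat_r; lra. }
          assert (Z3 : B * Q <= B * 2) by (apply Rmult_le_compat_l; lra).
          assert (Z : 0 < h * e * (A * (2 * k) - B * Q - (Q * D + 1))).
          { apply Rmult_lt_0_compat; lra. }
          lra.
      + intros s' Hs'.
        apply Rle_trans with (h * p1).
        * apply Inc; [unfold t0; lra|exact Hs'|]. intros z Hz. apply Le1; unfold t0; lra.
        * unfold psi. apply Rmult_le_compat_l; [lra|].
          replace (- xi1 t0 + s' + xi1 t0) with s' by ring.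
          assert (Bq : q s' <= t1 - t0).
          { unfold q, t0.
            assert (k * s' <= k * rho) by (apply Rmult_le_compat_l; lra).
            assert (s' * (k * s') <= s' * 1) by (apply Rmult_le_compat_l; lra). lra. }
          assert (0 <= e * (t1 - t0 - q s')) by (apply Rmult_le_pos; lra). lra.
      + intros t Ht. apply Rle_trans with (h * p1).
        * rewrite <- (Rplus_0_r (- xi1 t)). apply Inc; [exact Ht|lra|].
          intros z Hz. apply Le1; lra.
        * unfold psi, q. apply Rmult_le_compat_l; [lra|].
          replace (- xi1 t + xi1 t) with 0 by ring.
          assert (0 <= e * (t1 - t)) by (apply Rmult_le_pos; lra). lra.
      + intros t Ht. apply Rle_trans with (h * (p1 - e0)).
        * apply Inc; [exact Ht|lra|]. intros z Hz. apply HE; lra.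
        * unfold psi, q. apply Rmult_le_compat_l; [lra|].
          replace (- xi1 t + rho + xi1 t) with rho by ring.
          assert (0 <= e * (t1 - t)) by (apply Rmult_le_pos; lra).
          assert (rho * (2 * k * rho) <= rho * 1) by (apply Rmult_le_compat_l; lra).
          assert (e * (rho + k * rho ^ 2) <= e * (2 * rho)) by (apply Rmult_le_compat_l; lra). lra.
    - unfold psi, q. apply Rmult_le_compat_l; [lra|].
      replace (- xi1 t1 + s + xi1 t1) with s by ring.
      assert (0 <= k * s ^ 2) by (apply Rmult_le_pos; [lra|apply pow2_ge_0]).
      assert (0 <= e * (k * s ^ 2)) by (apply Rmult_le_pos; lra). lra. }
  assert (It1 : t0 <= t1 <= t1) by (unfold t0; lra).
  assert (Lin : forall s, 0 < s <= rho -> ux (- xi1 t1 + s) t1 <= p1 - e * s).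
  { intros s Hs.
    apply (is_derive_le_of_right_increments (fun y => u y t1) (- xi1 t1 + s) _ _ rho).
    - apply (wf_dx W). apply Reg; [exact It1|lra].
    - exact Hrho.
    - intros h Hh. assert (Q := Key h Hh s). rewrite Rplus_0_r in Q. apply Q. lra. }
  apply Rle_lt_trans with (- e); [|lra].
  (* Were [uxx] above [- e] at the boundary, it would be so nearby as well, and [ux] would decrease
     too slowly for [Lin]. *)
  destruct (Rle_lt_dec (uxx (- xi1 t1) t1) (- e)) as [|Hgt]; [assumption|exfalso].
  assert (Cc : continuity_pt (fun y => uxx y t1) (- xi1 t1)).
  { apply continuity_2d_pt_section. now apply (wf_cuxx W). }
  assert (Hg : 0 < uxx (- xi1 t1) t1 + e) by lra.
  destruct (proj1 (continuity_pt_locally _ _) Cc (mkposreal _ Hg)) as [d Hd]. simpl in Hd.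
  assert (Pd := cond_pos d).
  assert (M1 := Rmin_l (d / 2) rho). assert (M2 := Rmin_r (d / 2) rho).
  assert (Pm : 0 < Rmin (d / 2) rho) by (apply Rmin_pos; lra).
  set (s := Rmin (d / 2) rho) in *.
  destruct (mean_value (fun y => ux y t1) (fun y => uxx y t1) (- xi1 t1) (- xi1 t1 + s))
    as [y [Hy Ey]].
  - lra.
  - intros y Hy. apply (wf_dxx W).
    replace y with (- xi1 t1 + (y + xi1 t1)) by ring. apply Reg; [exact It1|lra].
  - intros y Hy. apply continuity_2d_pt_section. now apply (wf_cux W).
  - simpl in Ey.
    assert (Q : Rabs (uxx y t1 - uxx (- xi1 t1) t1) < uxx (- xi1 t1) t1 + e).
    { apply Hd. change (Rabs (y - - xi1 t1) < d). rewrite Rabs_right; lra. }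
    apply Rabs_def2 in Q.
    destruct (wf_left W t1 Ht1) as [El _].
    assert (L := Lin s). rewrite El in Ey.
    assert (uxx y t1 * s > - e * s) by (apply Rmult_gt_compat_r; lra).
    replace (- xi1 t1 + s - - xi1 t1) with s in Ey by ring. lra.
Qed.

Lemma uxx_neg (a : R -> R) (p0 p1 T b : R) (xi1 xi2 : R -> R)
    (u ux uxx ut : R -> R -> R) (x t : R) :
  wedge_flow a p0 p1 T b xi1 xi2 u ux uxx ut -> closed_region xi1 xi2 (x, t) -> uxx x t < 0.
Proof.
  intros W [Ht [Hx1 Hx2]]. simpl in *.
  destruct (Rle_lt_or_eq_dec _ _ Hx1) as [Hl| <-].
  - destruct (Rle_lt_or_eq_dec _ _ Hx2) as [Hr| ->].
    + apply (uxx_neg_interior W). split; simpl; lra.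
    + assert (Q := uxx_neg_at_left _ _ _ _ _ _ _ _ _ _ _ t
        (wedge_flow_reflect W) Ht).
      simpl in Q. now rewrite Ropp_involutive in Q.
  - now apply (uxx_neg_at_left _ _ _ _ _ _ _ _ _ _ _ t W).
Qed.

(** * Legendre transform *)

(** Completed by the value [l] at 0, the difference quotient of [f] at [g x] is continuous at 0. The
    difference quotient of [g] is the reciprocal of that function evaluated at [g (x + h) - g x],
    which tends to 0. *)
Lemma is_derive_inverse (f g : R -> R) (x l d : R) :
  is_derive f (g x) l -> l <> 0 -> continuity_pt g x -> 0 < d ->
  (forall y, Rabs (y - x) < d -> f (g y) = y) -> is_derive g x (/ l).
Proof.
  intros Hf Hl Hg Hd Hinv. apply is_derive_Reals. apply is_derive_Reals in Hf.
  assert (Hx : f (g x) = x). { apply Hinv. rewrite Rminus_diag, Rabs_R0. exact Hd. }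
  set (phi := fun k => if Req_EM_T k 0 then l else (f (g x + k) - f (g x)) / k).
  assert (P0 : phi 0 = l). { unfold phi. destruct (Req_EM_T 0 0); [reflexivity|lra]. }
  assert (Cphi : continuity_pt phi 0).
  { apply continuity_pt_locally. intro eps. destruct (Hf eps (cond_pos eps)) as [e He].
    exists e. intros k Hk. change (Rabs (k - 0) < e) in Hk. rewrite Rminus_0_r in Hk.
    rewrite P0. unfold phi. destruct (Req_EM_T k 0) as [_|N].
    - rewrite Rminus_diag, Rabs_R0. apply cond_pos.
    - now apply He. }
  set (psi := fun h => / phi (g (x + h) - g x)).
  assert (Cpsi : continuity_pt psi 0).
  { unfold psi. apply (continuity_pt_inv (fun h => phi (g (x + h) - g x))).
    - apply (continuity_pt_comp (fun h => g (x + h) - g x) phi).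
      + apply continuity_pt_minus.
        * apply (continuity_pt_comp (fun h => x + h) g).
          -- apply continuity_pt_plus; [apply continuity_pt_cst|].
             apply continuity_pt_id.
          -- now rewrite Rplus_0_r.
        * apply continuity_pt_cst.
      + now rewrite Rplus_0_r, Rminus_diag.
    - now rewrite Rplus_0_r, Rminus_diag, P0. }
  intros eps Heps.
  destruct (proj1 (continuity_pt_locally _ _) Cpsi (mkposreal eps Heps)) as [e He]. simpl in He.
  assert (Hm : 0 < Rmin d e) by (apply Rmin_pos; [exact Hd|apply cond_pos]).
  exists (mkposreal _ Hm). intros h Hh0 Hh. simpl in Hh.
  assert (M1 := Rmin_l d e). assert (M2 := Rmin_r d e).
  assert (Q := He h). unfold psi in Q at 2. rewrite Rplus_0_r, Rminus_diag, P0 in Q.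
  assert (Ef : f (g (x + h)) = x + h).
  { apply Hinv. replace (x + h - x) with h by ring. lra. }
  replace ((g (x + h) - g x) / h) with (psi h).
  - apply Q. change (Rabs (h - 0) < e). rewrite Rminus_0_r. lra.
  - unfold psi, phi. destruct (Req_EM_T (g (x + h) - g x) 0) as [E|N].
    + exfalso. assert (E' : g (x + h) = g x) by lra. rewrite E', Hx in Ef. lra.
    + replace (g x + (g (x + h) - g x)) with (g (x + h)) by ring. rewrite Ef, Hx.
      field. repeat split; lra.
Qed.

(** The mean value theorem in time bounds the difference quotients at interior [q], uniformly for
    [q] near [p]; the bound is a closed condition in [q] and so passes to the end points. This
    supplies the time derivatives at the two extreme slopes. *)
Lemma is_derive_at_closure (F m : R -> R -> R) (l r : R) :
  l < r ->
  (forall p t, t < 0 -> continuity_2d_pt F p t) ->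
  (forall p t, t < 0 -> continuity_2d_pt m p t) ->
  (forall p t, l < p < r -> t < 0 -> is_derive (fun s => F p s) t (m p t)) ->
  forall p t, l <= p <= r -> t < 0 -> is_derive (fun s => F p s) t (m p t).
Proof.
  intros Hlr CF Cm Hd p t Hp Ht. apply is_derive_Reals. intros eps Heps.
  assert (He2 : 0 < eps / 2) by lra.
  destruct (Cm p t Ht (mkposreal _ He2)) as [d Hdel]. simpl in Hdel.
  assert (Pd := cond_pos d).
  assert (Hm : 0 < Rmin d (- t)) by (apply Rmin_pos; lra).
  exists (mkposreal _ Hm). intros h Hh0 Hh. simpl in Hh.
  assert (M1 := Rmin_l d (- t)). assert (M2 := Rmin_r d (- t)).
  assert (Hth : t + h < 0).
  { unfold Rabs in Hh. destruct Rcase_abs in Hh; lra. }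
  assert (Key : forall q, l < q < r -> Rabs (q - p) < d ->
    Rabs (F q (t + h) - F q t - m p t * h) <= eps / 2 * Rabs h).
  { intros q Hq Hqp.
    assert (MV : exists s, Rabs (s - t) < d /\ F q (t + h) - F q t = m q s * h).
    { destruct (Rtotal_order h 0) as [Hn|[|Hn]]; [|lra|].
      - rewrite (Rabs_left h) in Hh by lra.
        destruct (mean_value (fun s => F q s) (fun s => m q s) (t + h) t) as [s [Hs E]]; [lra| | |].
        + intros s Hs. apply Hd; [exact Hq|lra].
        + intros s Hs. apply is_derive_continuity_pt with (m q s). apply Hd; [exact Hq|lra].
        + exists s. split; [rewrite Rabs_left; lra|]. simpl in E. lra.
      - rewrite (Rabs_right h) in Hh by lra.
        destruct (mean_value (fun s => F q s) (fun s => m q s) t (t + h)) as [s [Hs E]]; [lra| | |].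
        + intros s Hs. apply Hd; [exact Hq|lra].
        + intros s Hs. apply is_derive_continuity_pt with (m q s). apply Hd; [exact Hq|lra].
        + exists s. split; [rewrite Rabs_right; lra|]. simpl in E. lra. }
    destruct MV as [s [Hs ->]].
    replace (m q s * h - m p t * h) with ((m q s - m p t) * h) by ring.
    rewrite Rabs_mult. apply Rmult_le_compat_r; [apply Rabs_pos|].
    apply Rlt_le. now apply Hdel. }
  assert (Fin : Rabs (F p (t + h) - F p t - m p t * h) <= eps / 2 * Rabs h).
  { set (l' := Rmax l (p - d / 2)). set (r' := Rmin r (p + d / 2)).
    assert (A1 : l <= l') by apply Rmax_l. assert (A2 : p - d / 2 <= l') by apply Rmax_r.
    assert (A3 : r' <= r) by apply Rmin_l. assert (A4 : r' <= p + d / 2) by apply Rmin_r.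
    assert (A5 : l' <= p) by (apply Rmax_lub; lra).
    assert (A6 : p <= r') by (apply Rmin_glb; lra).
    assert (A7 : l' < r').
    { unfold l', r'. apply Rmax_lub_lt; apply Rmin_glb_lt; lra. }
    enough (Rabs (F p (t + h) - F p t - m p t * h) - eps / 2 * Rabs h <= 0) by lra.
    apply (nonpos_at_closure
      (fun q => Rabs (F q (t + h) - F q t - m p t * h) - eps / 2 * Rabs h) l' r' A7).
    - intros q Hq. apply continuity_pt_minus; [|apply continuity_pt_cst].
      apply continuity_pt_comp with (f2 := Rabs); [|apply Rcontinuity_abs].
      apply continuity_pt_minus; [|apply continuity_pt_cst].
      apply continuity_pt_minus; apply continuity_2d_pt_section; apply CF; lra.
    - intros q Hq. assert (K := Key q). simpl.
      enough (Rabs (F q (t + h) - F q t - m p t * h) <= eps / 2 * Rabs h) by lra.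
      apply K; [lra|]. apply Rabs_def1; lra.
    - lra. }
  replace ((F p (t + h) - F p t) / h - m p t) with ((F p (t + h) - F p t - m p t * h) / h)
    by (field; exact Hh0).
  unfold Rdiv. rewrite Rabs_mult, Rabs_inv.
  assert (Ph : 0 < Rabs h) by (now apply Rabs_pos_lt).
  apply Rmult_lt_reg_r with (Rabs h); [exact Ph|].
  rewrite Rmult_assoc, Rinv_l, Rmult_1_r by lra.
  apply Rle_lt_trans with (1 := Fin). nra.
Qed.

(* [w] is the Legendre transform [u - p x] of the concave function [u], as a function of the
   slope [p] and of time; [n = - 1 / uxx]. *)
Record legendre_flow (a : R -> R) (p0 p1 T b : R) (w x n : R -> R -> R) : Prop := {
  lf_b : 1 < b;
  lf_slopes : - T < p0 /\ p0 < p1 /\ p1 < T;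
  lf_a_pos : forall p, 0 < a p;
  lf_ca : forall p, continuity_pt a p;
  lf_cw : forall p t, t < 0 -> continuity_2d_pt w p t;
  lf_cx : forall p t, t < 0 -> continuity_2d_pt x p t;
  lf_cn : forall p t, t < 0 -> continuity_2d_pt n p t;
  lf_w_pos : forall p t, p0 <= p <= p1 -> t < 0 -> 0 < w p t;
  lf_n_pos : forall p t, t < 0 -> 0 < n p t;
  lf_dw : forall p t, p0 < p < p1 -> t < 0 -> is_derive (fun q => w q t) p (- x p t);
  lf_dx : forall p t, p0 < p < p1 -> t < 0 -> is_derive (fun q => x q t) p (- n p t);
  lf_dt : forall p t, p0 <= p <= p1 -> t < 0 -> is_derive (fun s => w p s) t (- a p / n p t);
  lf_right : forall t, t < 0 -> w p0 t = (T - p0) * x p0 t;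
  lf_left : forall t, t < 0 -> w p1 t = - (T + p1) * x p1 t;
  lf_scale_w : forall p t, p0 <= p <= p1 -> t < 0 -> w p t = b * w p (t / b ^ 2);
  lf_scale_n : forall p t, p0 <= p <= p1 -> t < 0 -> n p t = b * n p (t / b ^ 2) }.

Arguments lf_b {a p0 p1 T b w x n} _.
Arguments lf_slopes {a p0 p1 T b w x n} _.
Arguments lf_a_pos {a p0 p1 T b w x n} _.
Arguments lf_ca {a p0 p1 T b w x n} _.
Arguments lf_cw {a p0 p1 T b w x n} _.
Arguments lf_cx {a p0 p1 T b w x n} _.
Arguments lf_cn {a p0 p1 T b w x n} _.
Arguments lf_w_pos {a p0 p1 T b w x n} _.
Arguments lf_n_pos {a p0 p1 T b w x n} _.
Arguments lf_dw {a p0 p1 T b w x n} _.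
Arguments lf_dx {a p0 p1 T b w x n} _.
Arguments lf_dt {a p0 p1 T b w x n} _.
Arguments lf_right {a p0 p1 T b w x n} _.
Arguments lf_left {a p0 p1 T b w x n} _.
Arguments lf_scale_w {a p0 p1 T b w x n} _.
Arguments lf_scale_n {a p0 p1 T b w x n} _.

Section Legendre.

Variables (a : R -> R) (p0 p1 T b : R) (xi1 xi2 : R -> R) (u ux uxx ut : R -> R -> R).
Hypothesis W : wedge_flow a p0 p1 T b xi1 xi2 u ux uxx ut.

Let C1 := wf_xi1 W.
Let C2 := wf_xi2 W.
Let Hpos := wf_xi_pos W.

Let rc := region_clamp xi1 xi2.

(** Outside the region [ux] is continued with slope [-1]. Each slice becomes a strictly decreasing
    map of the line onto itself, so the inverse function exists for every [p] and is continuous in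
    the ordinary sense at [p0] and [p1]. *)
Definition slope_extension (x t : R) : R := ux (rc x t) t - (x - rc x t).

Lemma slope_extension_continuity (x t : R) : t < 0 -> continuity_2d_pt slope_extension x t.
Proof.
  intro Ht. assert (Crc := region_clamp_continuity xi1 xi2 C1 C2 x t Ht).
  apply continuity_2d_pt_minus.
  - apply (continuity_2d_pt_comp ux rc (fun _ s => s)); [|exact Crc|apply continuity_2d_pt_id2].
    now apply (wf_cux W).
  - apply continuity_2d_pt_minus; [apply continuity_2d_pt_id1|exact Crc].
Qed.

Lemma slope_extension_decreasing (x y t : R) : t < 0 -> x < y ->
  slope_extension y t < slope_extension x t.
Proof.
  intros Ht Hxy. unfold slope_extension.
  assert (Bx := region_clamp_closed xi1 xi2 Hpos x t Ht).
  assert (By := region_clamp_closed xi1 xi2 Hpos y t Ht).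
  fold rc in Bx, By. destruct Bx as [_ Bx], By as [_ By]. simpl in Bx, By.
  assert (M : rc x t <= rc y t /\ x - rc x t <= y - rc y t).
  { unfold rc, region_clamp, clamp, Rmax, Rmin. destruct (Hpos t Ht).
    repeat destruct Rle_dec; lra. }
  destruct M as [[M1|M1] M2].
  - assert (ux (rc y t) t < ux (rc x t) t); [|lra].
    apply (ux_strictly_decreasing W); lra.
  - rewrite M1. lra.
Qed.

Lemma slope_extension_closed (x t : R) : closed_region xi1 xi2 (x, t) ->
  slope_extension x t = ux x t.
Proof.
  intro H. unfold slope_extension, rc. rewrite region_clamp_id by assumption. ring.
Qed.

(** Moving out of the region by [|p - p1|] on the left and [|p - p0|] on the right brackets the
    value [p]. The informative type lets the inverse be defined by projection; for [t >= 0] the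
    witness is the dummy value 0. *)
Lemma slope_attained (p t : R) : {x : R | t < 0 -> slope_extension x t = p}.
Proof.
  destruct (Rlt_dec t 0) as [Ht|N]; [|exists 0; intro; contradiction].
  destruct (Hpos t Ht) as [P1 P2].
  destruct (wf_left W t Ht) as [El _].
  destruct (wf_right W t Ht) as [Er _].
  assert (Q0 := Rabs_pos (p - p0)). assert (Q1 := Rabs_pos (p - p1)).
  assert (E1 : slope_extension (- xi1 t - Rabs (p - p1)) t = p1 + Rabs (p - p1)).
  { unfold slope_extension. replace (rc (- xi1 t - Rabs (p - p1)) t) with (- xi1 t).
    - rewrite El. ring.
    - unfold rc, region_clamp, clamp. rewrite Rmin_right, Rmax_left; lra. }
  assert (E2 : slope_extension (xi2 t + Rabs (p - p0)) t = p0 - Rabs (p - p0)).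
  { unfold slope_extension. replace (rc (xi2 t + Rabs (p - p0)) t) with (xi2 t).
    - rewrite Er. ring.
    - unfold rc, region_clamp, clamp. rewrite Rmin_left, Rmax_right; lra. }
  destruct (IVT_gen (fun x => slope_extension x t) (- xi1 t - Rabs (p - p1))
    (xi2 t + Rabs (p - p0)) p) as [x [_ Hx]].
  - intro x. apply continuity_2d_pt_section. now apply slope_extension_continuity.
  - simpl. rewrite E1, E2.
    assert (A1 := Rle_abs (p - p1)). assert (A2 := Rle_abs (- (p - p0))).
    rewrite Rabs_Ropp in A2. rewrite Rmin_right, Rmax_left; lra.
  - now exists x.
Qed.

Let X (p t : R) : R := proj1_sig (slope_attained p t).

Lemma X_spec (p t : R) : t < 0 -> slope_extension (X p t) t = p.
Proof. exact (proj2_sig (slope_attained p t)). Qed.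

Lemma X_unique (x p t : R) : t < 0 -> slope_extension x t = p -> X p t = x.
Proof.
  intros Ht H. assert (Q := X_spec p t Ht).
  destruct (Rtotal_order (X p t) x) as [L|[E|G]]; [|exact E|].
  - assert (D := slope_extension_decreasing _ _ t Ht L). lra.
  - assert (D := slope_extension_decreasing _ _ t Ht G). lra.
Qed.

(** At [X p t - eps] and [X p t + eps] the extended slope is strictly above and strictly below [p].
    Both inequalities persist for nearby [(q, s)], and monotonicity traps [X q s] between the two
    points. *)
Lemma X_continuity (p t : R) : t < 0 -> continuity_2d_pt X p t.
Proof.
  intros Ht eps. assert (Pe := cond_pos eps).
  assert (Q := X_spec p t Ht).
  assert (L1 : 0 < slope_extension (X p t - eps) t - p).
  { assert (D := slope_extension_decreasing (X p t - eps) (X p t) t Ht). lra. }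
  assert (L2 : 0 < p - slope_extension (X p t + eps) t).
  { assert (D := slope_extension_decreasing (X p t) (X p t + eps) t Ht). lra. }
  assert (K : forall y, continuity_2d_pt (fun q s => slope_extension y s - q) p t).
  { intro y. apply continuity_2d_pt_minus; [|apply continuity_2d_pt_id1].
    apply (continuity_2d_pt_comp slope_extension (fun _ _ => y) (fun _ s => s)).
    - now apply slope_extension_continuity.
    - apply continuity_2d_pt_const.
    - apply continuity_2d_pt_id2. }
  destruct (K (X p t - eps) (mkposreal _ L1)) as [d1 D1].
  destruct (K (X p t + eps) (mkposreal _ L2)) as [d2 D2]. simpl in D1, D2.
  assert (Pd1 := cond_pos d1). assert (Pd2 := cond_pos d2).
  assert (Pd : 0 < Rmin (Rmin d1 d2) (- t)) by (repeat apply Rmin_pos; lra).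
  assert (M1 := Rmin_l (Rmin d1 d2) (- t)). assert (M2 := Rmin_r (Rmin d1 d2) (- t)).
  assert (M3 := Rmin_l d1 d2). assert (M4 := Rmin_r d1 d2).
  exists (mkposreal _ Pd). simpl. intros q s Hq Hs.
  specialize (D1 q s). specialize (D2 q s).
  assert (D1' : Rabs (slope_extension (X p t - eps) s - q - (slope_extension (X p t - eps) t - p))
    < slope_extension (X p t - eps) t - p) by (apply D1; lra).
  assert (D2' : Rabs (slope_extension (X p t + eps) s - q - (slope_extension (X p t + eps) t - p))
    < p - slope_extension (X p t + eps) t) by (apply D2; lra).
  apply Rabs_def2 in D1', D2'.
  assert (Hs0 : s < 0). { unfold Rabs in Hs. destruct Rcase_abs in Hs; lra. }
  assert (Qs := X_spec q s Hs0).
  apply Rabs_def1.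
  - destruct (Rlt_le_dec (X q s) (X p t + eps)) as [|G]; [lra|exfalso].
    destruct G as [G|G].
    + assert (D := slope_extension_decreasing _ _ s Hs0 G). lra.
    + rewrite <- G in Qs. lra.
  - destruct (Rlt_le_dec (X p t - eps) (X q s)) as [|G]; [lra|exfalso].
    destruct G as [G|G].
    + assert (D := slope_extension_decreasing _ _ s Hs0 G). lra.
    + rewrite G in Qs. lra.
Qed.

Let Hsl := wf_slopes W.

Lemma X_right (t : R) : t < 0 -> X p0 t = xi2 t.
Proof.
  intro Ht. destruct (Hpos t Ht). apply X_unique; [exact Ht|].
  rewrite slope_extension_closed by (split; simpl; lra).
  now apply (wf_right W).
Qed.

Lemma X_left (t : R) : t < 0 -> X p1 t = - xi1 t.
Proof.
  intro Ht. destruct (Hpos t Ht). apply X_unique; [exact Ht|].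
  rewrite slope_extension_closed by (split; simpl; lra).
  now apply (wf_left W).
Qed.

Lemma X_decreasing (p q t : R) : t < 0 -> p < q -> X q t < X p t.
Proof.
  intros Ht Hpq. assert (Qp := X_spec p t Ht). assert (Qq := X_spec q t Ht).
  destruct (Rlt_le_dec (X q t) (X p t)) as [|G]; [assumption|exfalso].
  destruct G as [G|G].
  - assert (D := slope_extension_decreasing _ _ t Ht G). lra.
  - rewrite G in Qp. lra.
Qed.

Lemma X_closed (p t : R) : p0 <= p <= p1 -> t < 0 -> closed_region xi1 xi2 (X p t, t).
Proof.
  intros Hp Ht. split; [exact Ht|]. simpl. rewrite <- (X_left t Ht), <- (X_right t Ht). split.
  - destruct Hp as [_ [Hp| ->]]; [|lra]. assert (D := X_decreasing p p1 t Ht Hp). lra.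
  - destruct Hp as [[Hp|<-] _]; [|lra]. assert (D := X_decreasing p0 p t Ht Hp). lra.
Qed.

Lemma X_open (p t : R) : p0 < p < p1 -> t < 0 -> open_region xi1 xi2 (X p t, t).
Proof.
  intros Hp Ht. split; [exact Ht|]. simpl. rewrite <- (X_left t Ht), <- (X_right t Ht).
  split; apply X_decreasing; lra.
Qed.

Lemma ux_X (p t : R) : p0 <= p <= p1 -> t < 0 -> ux (X p t) t = p.
Proof.
  intros Hp Ht. rewrite <- slope_extension_closed by (now apply X_closed). now apply X_spec.
Qed.

Lemma X_surjective (x t : R) : closed_region xi1 xi2 (x, t) ->
  p0 <= ux x t <= p1 /\ X (ux x t) t = x.
Proof.
  intro H. split; [split|].
  - now apply (ux_ge_right_slope W).
  - now apply (ux_le_left_slope W).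
  - apply X_unique; [exact (proj1 H)|]. now apply slope_extension_closed.
Qed.

Lemma X_derive (p t : R) : p0 < p < p1 -> t < 0 ->
  is_derive (fun q => X q t) p (/ uxx (X p t) t).
Proof.
  intros Hp Ht. assert (O := X_open p t Hp Ht).
  apply (is_derive_inverse (fun y => ux y t) (fun q => X q t) p _ (Rmin (p - p0) (p1 - p))).
  - now apply (wf_dxx W).
  - apply Rlt_not_eq. apply (uxx_neg _ _ _ _ _ _ _ _ _ _ _ _ _ W). now apply open_closed.
  - apply continuity_2d_pt_section. now apply X_continuity.
  - apply Rmin_pos; lra.
  - intros q Hq. assert (M1 := Rmin_l (p - p0) (p1 - p)). assert (M2 := Rmin_r (p - p0) (p1 - p)).
    apply Rabs_def2 in Hq. apply ux_X; [lra|exact Ht].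
Qed.

(** The derivative [ux - p] of [u - p y] changes sign from plus to minus at [X p t]. The transform
    is thus a maximum over the slice, which makes the envelope argument possible. *)
Lemma legendre_maximal (p y t : R) : p0 <= p <= p1 -> closed_region xi1 xi2 (y, t) ->
  u y t - p * y <= u (X p t) t - p * X p t.
Proof.
  intros Hp Hy. assert (Ht := proj1 Hy). simpl in Ht.
  assert (Hx := X_closed p t Hp Ht). assert (Ex := ux_X p t Hp Ht).
  set (x := X p t) in *. destruct Hy as [_ Hy], Hx as [_ Hx]. simpl in Hy, Hx.
  assert (Cc : forall z, continuity_pt (fun z => u z t - p * z) z).
  { intro z. apply continuity_pt_minus.
    - apply continuity_2d_pt_section. now apply (wf_cu W).
    - apply derivable_continuous_pt. reg. }
  assert (Dd : forall z, - xi1 t < z < xi2 t ->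
    is_derive (fun z => u z t - p * z) z (ux z t - p)).
  { intros z Hz. apply @is_derive_minus.
    - apply (wf_dx W). split; simpl; lra.
    - auto_derive; [trivial|ring]. }
  destruct (Rle_lt_dec y x) as [H|H].
  - apply (derivative_nonneg_le (fun z => u z t - p * z) (fun z => ux z t - p)); try assumption.
    + intros z Hz. apply Dd. lra.
    + intros z _. apply Cc.
    + intros z Hz. assert (ux x t < ux z t); [|lra].
      apply (ux_strictly_decreasing W); lra.
  - enough (- (u x t - p * x) <= - (u y t - p * y)) by lra.
    apply (derivative_nonneg_le (fun z => - (u z t - p * z)) (fun z => - (ux z t - p))).
    + lra.
    + intros z Hz. apply @is_derive_opp. apply Dd. lra.
    + intros z _. apply continuity_pt_opp. apply Cc.
    + intros z Hz. assert (ux z t < ux x t); [|lra].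
      apply (ux_strictly_decreasing W); lra.
Qed.

(** Envelope theorem. [X] is only known to be continuous in time, so the increment is sandwiched:
    testing the maximum at time [t + h] with the old point and the one at time [t] with the new
    point bounds it by time increments of [u] at two fixed points, and both difference quotients are
    close to [ut]. *)
Lemma legendre_dt (p t : R) : p0 < p < p1 -> t < 0 ->
  is_derive (fun s => u (X p s) s - p * X p s) t (ut (X p t) t).
Proof.
  intros Hp Ht. assert (O := X_open p t Hp Ht).
  assert (Hp' : p0 <= p <= p1) by lra.
  apply is_derive_Reals. intros eps Heps.
  assert (He2 : 0 < eps / 2) by lra.
  destruct (wf_cut W (X p t) t Ht (mkposreal _ He2)) as [d Hd].
  simpl in Hd. assert (Pd := cond_pos d).
  set (x := X p t) in *. destruct O as [_ O]. simpl in O.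
  set (r := Rmin (d / 2) (Rmin ((x + xi1 t) / 2) ((xi2 t - x) / 2))).
  assert (Hr : 0 < r) by (repeat apply Rmin_pos; lra).
  assert (R1 : r <= d / 2) by apply Rmin_l.
  assert (R2 : r <= Rmin ((x + xi1 t) / 2) ((xi2 t - x) / 2)) by apply Rmin_r.
  assert (R3 := Rmin_l ((x + xi1 t) / 2) ((xi2 t - x) / 2)).
  assert (R4 := Rmin_r ((x + xi1 t) / 2) ((xi2 t - x) / 2)).
  destruct (open_region_box xi1 xi2 C1 C2 (x - r) (x + r) t Ht) as [d2 [Hd2 Box]]; [lra|lra|].
  destruct (X_continuity p t Ht (mkposreal r Hr)) as [d3 Hd3]. simpl in Hd3.
  assert (Pd3 := cond_pos d3).
  assert (Hm : 0 < Rmin (Rmin d d2) d3) by (repeat apply Rmin_pos; lra).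
  assert (M1 := Rmin_l (Rmin d d2) d3). assert (M2 := Rmin_r (Rmin d d2) d3).
  assert (M3 := Rmin_l d d2). assert (M4 := Rmin_r d d2).
  exists (mkposreal _ Hm). intros h Hh0 Hh. simpl in Hh.
  assert (Inc : forall y, Rabs (y - x) <= r ->
    exists m, Rabs (m - ut x t) < eps / 2 /\ u y (t + h) - u y t = m * h).
  { intros y Hy. assert (Hyr : x - r <= y <= x + r) by (apply Rabs_le_between in Hy; lra).
    assert (Dy : forall s, Rabs (s - t) <= d2 -> is_derive (fun s => u y s) s (ut y s)).
    { intros s Hs. apply (wf_dt W). now apply Box. }
    destruct (Rtotal_order h 0) as [Hn|[|Hn]]; [|lra|].
    - rewrite (Rabs_left h) in Hh by lra.
      destruct (mean_value (fun s => u y s) (fun s => ut y s) (t + h) t) as [s [Hs E]]; [lra| | |].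
      + intros s Hs. apply Dy. rewrite Rabs_left; lra.
      + intros s Hs. apply is_derive_continuity_pt with (ut y s). apply Dy. apply Rabs_le; lra.
      + exists (ut y s). split; [|simpl in E; lra]. apply Hd; [lra|]. rewrite Rabs_left; lra.
    - rewrite (Rabs_right h) in Hh by lra.
      destruct (mean_value (fun s => u y s) (fun s => ut y s) t (t + h)) as [s [Hs E]]; [lra| | |].
      + intros s Hs. apply Dy. rewrite Rabs_right; lra.
      + intros s Hs. apply is_derive_continuity_pt with (ut y s). apply Dy. apply Rabs_le; lra.
      + exists (ut y s). split; [|simpl in E; lra]. apply Hd; [lra|]. rewrite Rabs_right; lra. }
  set (x' := X p (t + h)).
  assert (Hx' : Rabs (x' - x) < r).
  { apply Hd3; [rewrite Rminus_diag, Rabs_R0; exact Pd3|].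
    replace (t + h - t) with h by ring. lra. }
  assert (Oh : closed_region xi1 xi2 (x, t + h)).
  { apply open_closed, Box; [lra|]. replace (t + h - t) with h by ring. lra. }
  assert (Ot : closed_region xi1 xi2 (x', t)).
  { apply open_closed, Box.
    - apply Rabs_def2 in Hx'. lra.
    - rewrite Rminus_diag, Rabs_R0. lra. }
  assert (L1 := legendre_maximal p x (t + h) Hp' Oh).
  assert (L2 := legendre_maximal p x' t Hp' Ot). fold x in L2. fold x' in L1.
  destruct (Inc x) as [m1 [Hm1 E1]]; [rewrite Rminus_diag, Rabs_R0; lra|].
  destruct (Inc x') as [m2 [Hm2 E2]]; [lra|].
  set (D := u x' (t + h) - p * x' - (u x t - p * x)).
  assert (S1 : m1 * h <= D) by (unfold D; lra). assert (S2 : D <= m2 * h) by (unfold D; lra).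
  apply Rabs_def2 in Hm1, Hm2.
  assert (ED : D = D / h * h) by (field; exact Hh0).
  rewrite ED in S1, S2.
  set (z := D / h) in *.
  assert (Z : m1 <= z <= m2 \/ m2 <= z <= m1).
  { destruct (Rtotal_order h 0) as [Hn|[|Hn]]; [right|lra|left]; split; nra. }
  change (Rabs (z - ut x t) < eps). apply Rabs_def1; lra.
Qed.

Lemma wedge_flow_legendre :
  exists w x n, legendre_flow a p0 p1 T b w x n /\
    (forall t, t < 0 -> x p0 t = xi2 t /\ x p1 t = - xi1 t) /\
    (forall p t, p0 <= p <= p1 -> t < 0 -> w p t = u (x p t) t - p * x p t) /\
    (forall y t, closed_region xi1 xi2 (y, t) -> exists p, p0 <= p <= p1 /\ x p t = y).
Proof.
  set (pc := clamp p0 p1).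
  assert (Bpc : forall p, p0 <= pc p <= p1) by (intro p; apply clamp_bounds; lra).
  assert (Ipc : forall p, p0 <= p <= p1 -> pc p = p) by (intros p Hp; now apply clamp_id).
  assert (Cpc : forall p t, continuity_2d_pt (fun q _ => pc q) p t).
  { intros p t. apply (clamp_continuity_2d (fun _ _ => p0) (fun _ _ => p1) (fun q _ => q));
      [apply continuity_2d_pt_const|apply continuity_2d_pt_const|apply continuity_2d_pt_id1]. }
  set (x := fun p t => X (pc p) t).
  set (w := fun p t => u (x p t) t - pc p * x p t).
  set (n := fun p t => - / uxx (x p t) t).
  assert (Cx : forall p t, t < 0 -> continuity_2d_pt x p t).
  { intros p t Ht. apply (continuity_2d_pt_comp X (fun q _ => pc q) (fun _ s => s)).
    - now apply X_continuity.
    - apply Cpc.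
    - apply continuity_2d_pt_id2. }
  assert (Kx : forall p t, t < 0 -> closed_region xi1 xi2 (x p t, t)).
  { intros p t Ht. unfold x. now apply X_closed. }
  assert (Cf : forall f : R -> R -> R, (forall x t, t < 0 -> continuity_2d_pt f x t) ->
    forall p t, t < 0 -> continuity_2d_pt (fun p t => f (x p t) t) p t).
  { intros f Hf p t Ht. apply (continuity_2d_pt_comp f x (fun _ s => s)).
    - now apply Hf.
    - now apply Cx.
    - apply continuity_2d_pt_id2. }
  assert (Nneg : forall p t, t < 0 -> uxx (x p t) t < 0).
  { intros p t Ht. apply (uxx_neg _ _ _ _ _ _ _ _ _ _ _ _ _ W). now apply Kx. }
  assert (Ew : forall p t, p0 <= p <= p1 -> w p t = u (X p t) t - p * X p t).
  { intros p t Hp. unfold w, x. now rewrite (Ipc p Hp). }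
  assert (Cw : forall p t, t < 0 -> continuity_2d_pt w p t).
  { intros p t Ht. unfold w. apply continuity_2d_pt_minus.
    - apply Cf; [apply (wf_cu W)|exact Ht].
    - apply continuity_2d_pt_mult; [apply Cpc|now apply Cx]. }
  assert (Em : forall p t, p0 <= p <= p1 -> t < 0 -> ut (x p t) t = - a p / n p t).
  { intros p t Hp Ht. rewrite (wf_pde W) by (now apply Kx).
    assert (N := Nneg p t Ht). unfold n.
    replace (ux (x p t) t) with p.
    - field. lra.
    - unfold x. rewrite (Ipc p Hp). symmetry. now apply ux_X. }
  (* [ux] is invariant under the scaling, so the point of slope [p] at time [t / b ^ 2] is the
     rescaled point of slope [p] at time [t]. *)
  assert (Sx : forall p t, p0 <= p <= p1 -> t < 0 -> x p (t / b ^ 2) = x p t / b).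
  { intros p t Hp Ht. unfold x. rewrite (Ipc p Hp).
    assert (K := X_closed p t Hp Ht).
    assert (K' := proj1 (region_scale xi1 xi2 b (X p t) t (wf_b W)
      (wf_scale_xi W)) K).
    apply X_unique; [exact (proj1 K')|].
    rewrite slope_extension_closed by exact K'.
    rewrite <- (wf_scale_ux W) by exact K. now apply ux_X. }
  exists w, x, n. split; [|split; [|split]].
  - constructor.
    + exact (wf_b W).
    + exact Hsl.
    + exact (wf_a_pos W).
    + intro p. now apply (a_continuity W).
    + exact Cw.
    + exact Cx.
    + intros p t Ht. unfold n. apply continuity_2d_pt_opp, continuity_2d_pt_inv.
      * apply Cf; [apply (wf_cuxx W)|exact Ht].
      * apply Rlt_not_eq. now apply Nneg.
    (* Testing the maximum at [y = 0], which lies in every slice, gives [w >= u 0 t > 0]. *)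
    + intros p t Hp Ht. rewrite (Ew p t Hp). destruct (Hpos t Ht).
      assert (K0 : closed_region xi1 xi2 (0, t)) by (split; simpl; lra).
      assert (Q := legendre_maximal p 0 t Hp K0).
      assert (Q' := wf_u_pos W 0 t K0). lra.
    + intros p t Ht. unfold n. assert (N := Nneg p t Ht).
      assert (/ uxx (x p t) t < 0) by (now apply Rinv_lt_0_compat). lra.
    + intros p t Hp Ht.
      apply is_derive_ext_loc with (fun q => u (X q t) t - q * X q t).
      { generalize (locally_between p0 p1 p Hp). apply filter_imp. intros q Hq.
        symmetry. apply Ew. lra. }
      assert (DX := X_derive p t Hp Ht).
      assert (Du : is_derive (fun q => u (X q t) t) p (/ uxx (X p t) t * p)).
      { replace p with (ux (X p t) t) at 3 by (apply ux_X; [lra|exact Ht]).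
        apply (is_derive_comp (fun y => u y t) (fun q => X q t)); [|exact DX].
        apply (wf_dx W). now apply X_open. }
      assert (Dq : is_derive (fun q => q * X q t) p (1 * X p t + p * / uxx (X p t) t)).
      { apply (is_derive_mult (fun q => q) (fun q => X q t)); [|exact DX|].
        - apply @is_derive_id.
        - intros c d. apply Rmult_comm. }
      unfold x. rewrite (Ipc p) by lra.
      replace (- X p t) with (/ uxx (X p t) t * p - (1 * X p t + p * / uxx (X p t) t)) by ring.
      now apply @is_derive_minus.
    + intros p t Hp Ht.
      apply is_derive_ext_loc with (fun q => X q t).
      { generalize (locally_between p0 p1 p Hp). apply filter_imp. intros q Hq.
        unfold x. rewrite Ipc; [reflexivity|lra]. }
      unfold n, x. rewrite (Ipc p), Ropp_involutive by lra. now apply X_derive.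
    + intros p t Hp Ht. rewrite <- (Em p t Hp Ht).
      apply (is_derive_at_closure w (fun p t => ut (x p t) t) p0 p1); try lra.
      * exact Cw.
      * apply Cf. apply (wf_cut W).
      * intros q s Hq Hs.
        apply is_derive_ext with (fun s => u (X q s) s - q * X q s).
        { intro s'. symmetry. apply Ew. lra. }
        unfold x. rewrite (Ipc q) by lra. now apply legendre_dt.
    + intros t Ht. rewrite Ew by lra. unfold x. rewrite Ipc by lra. rewrite X_right by exact Ht.
      destruct (wf_right W t Ht) as [_ ->]. ring.
    + intros t Ht. rewrite Ew by lra. unfold x. rewrite Ipc by lra. rewrite X_left by exact Ht.
      destruct (wf_left W t Ht) as [_ ->]. ring.
    + intros p t Hp Ht. unfold w. rewrite (Sx p t Hp Ht).
      rewrite (wf_scale_u W (x p t) t) by (now apply Kx).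
      assert (B := wf_b W).
      field. lra.
    + intros p t Hp Ht. unfold n. rewrite (Sx p t Hp Ht).
      rewrite <- (wf_scale_uxx W (x p t) t) by (now apply Kx).
      assert (B := wf_b W). assert (N := Nneg p t Ht).
      field. lra.
  - intros t Ht. unfold x. rewrite !Ipc by lra. split; [now apply X_right|now apply X_left].
  - intros p t Hp Ht. rewrite (Ew p t Hp). unfold x. now rewrite (Ipc p Hp).
  - intros y t Hy. destruct (X_surjective y t Hy) as [B E].
    exists (ux y t). split; [exact B|]. unfold x. now rewrite (Ipc _ B).
Qed.

End Legendre.

Arguments wedge_flow_legendre {a p0 p1 T b xi1 xi2 u ux uxx ut} _.

(** * Energy *)

(* [RInt] equations live in the carrier of a normed module, where [ring] does not see [R]. *)
Ltac real_eq := match goal with |- @eq _ ?x ?y => change (@eq R x y) end.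

Lemma continuity_pt_continuous (f : R -> R) (x : R) : continuity_pt f x -> continuous f x.
Proof. intro H. now apply continuity_pt_filterlim. Qed.

Lemma continuity_pt_ex_RInt (f : R -> R) (l r : R) :
  l <= r -> (forall x, l <= x <= r -> continuity_pt f x) -> ex_RInt f l r.
Proof.
  intros Hlr H. apply (ex_RInt_continuous f). intros z Hz.
  rewrite Rmin_left, Rmax_right in Hz by assumption. apply continuity_pt_continuous. now apply H.
Qed.

Lemma RInt_eq (f g : R -> R) (l r : R) : (forall x, f x = g x) -> RInt f l r = RInt g l r.
Proof. intro H. apply RInt_ext. intros x _. apply H. Qed.

Lemma is_RInt_RInt (f : R -> R) (l r : R) : ex_RInt f l r -> is_RInt f l r (RInt f l r).
Proof. intro H. now apply (RInt_correct f). Qed.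

(** [F] is differentiable only inside the interval, so it is compared with the primitive of the
    continuous [f]: their difference is continuous on the closed interval and has zero derivative
    inside. *)
Lemma RInt_of_interior_derivative (F f : R -> R) (l r : R) :
  l <= r ->
  (forall x, continuity_pt f x) ->
  (forall x, l <= x <= r -> continuity_pt F x) ->
  (forall x, l < x < r -> is_derive F x (f x)) ->
  RInt f l r = F r - F l.
Proof.
  intros Hlr Cf CF HF.
  assert (Ex : forall x, ex_RInt f l x).
  { intro x. apply (ex_RInt_continuous f). intros z _. now apply continuity_pt_continuous. }
  assert (D : forall x, is_derive (fun y => RInt f l y) x (f x)).
  { intro x. apply is_derive_RInt with l.
    - apply filter_forall. intro y. apply is_RInt_RInt. apply Ex.
    - now apply continuity_pt_continuous. }
  assert (Q : RInt f l l - F l = RInt f l r - F r).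
  { apply (derivative_zero_const (fun x => RInt f l x - F x) (fun x => f x - f x)).
    - exact Hlr.
    - intros x Hx. apply @is_derive_minus; [apply D|now apply HF].
    - intros x Hx. apply continuity_pt_minus; [|now apply CF].
      apply is_derive_continuity_pt with (f x). apply D.
    - intros x _. ring. }
  rewrite RInt_point in Q. unfold zero in Q. simpl in Q. lra.
Qed.

(** The partial integrals from [l] lie between 0 and the full integral, hence vanish, and [f] is the
    derivative of the zero function. *)
Lemma RInt_zero_nonneg (f : R -> R) (l r : R) :
  l < r -> (forall x, continuity_pt f x) -> (forall x, l <= x <= r -> 0 <= f x) ->
  RInt f l r = 0 -> forall x, l < x < r -> f x = 0.
Proof.
  intros Hlr Cf Hf Hz x Hx.
  assert (Ex : forall u v, ex_RInt f u v).
  { intros u v. apply (ex_RInt_continuous f). intros z _. now apply continuity_pt_continuous. }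
  assert (Z : forall y, l < y < r -> RInt f l y = 0).
  { intros y Hy. assert (C := RInt_Chasles f l y r (Ex l y) (Ex y r)).
    unfold plus in C. simpl in C. rewrite Hz in C.
    assert (0 <= RInt f l y). { apply RInt_ge_0; [lra|apply Ex|]. intros z Hzz. apply Hf. lra. }
    assert (0 <= RInt f y r). { apply RInt_ge_0; [lra|apply Ex|]. intros z Hzz. apply Hf. lra. }
    lra. }
  assert (D : is_derive (fun y => RInt f l y) x (f x)).
  { apply is_derive_RInt with l.
    - apply filter_forall. intro y. apply is_RInt_RInt. apply Ex.
    - now apply continuity_pt_continuous. }
  assert (D0 : is_derive (fun y => RInt f l y) x 0).
  { apply is_derive_ext_loc with (fun _ => 0).
    - generalize (locally_between l r x Hx). apply filter_imp. intros y Hy. symmetry. now apply Z.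
    - apply @is_derive_const. }
  rewrite <- (is_derive_unique _ _ _ D), <- (is_derive_unique _ _ _ D0). reflexivity.
Qed.

Lemma continuity_2d_pt_swap (f : R -> R -> R) (x y : R) :
  continuity_2d_pt f y x -> continuity_2d_pt (fun u v => f v u) x y.
Proof.
  intros H eps. destruct (H eps) as [d Hd]. exists d. intros u v Hu Hv. now apply Hd.
Qed.

Lemma is_derive_RInt_time (f f' : R -> R -> R) (l r t : R) :
  l <= r -> t < 0 ->
  (forall p s, s < 0 -> continuity_2d_pt f p s) ->
  (forall p s, s < 0 -> continuity_2d_pt f' p s) ->
  (forall p s, s < 0 -> is_derive (fun z => f p z) s (f' p s)) ->
  is_derive (fun s => RInt (fun p => f p s) l r) t (RInt (fun p => f' p t) l r).
Proof.
  intros Hlr Ht Cf Cf' Hd.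
  assert (Neg := locally_neg t Ht).
  replace (RInt (fun p => f' p t) l r)
    with (RInt (fun p => Derive (fun s => f p s) t) l r).
  2:{ apply RInt_eq. intros p. apply is_derive_unique. now apply Hd. }
  apply (is_derive_RInt_param (fun s p => f p s) l r t).
  - generalize Neg. apply filter_imp. intros s Hs p _. exists (f' p s). now apply Hd.
  - intros p _.
    apply continuity_2d_pt_ext_loc with (fun s p => f' p s).
    + destruct Neg as [e He]. exists e. intros s q Hs _. symmetry.
      apply is_derive_unique. apply Hd. now apply He.
    + apply continuity_2d_pt_swap. now apply Cf'.
  - generalize Neg. apply filter_imp. intros s Hs. apply continuity_pt_ex_RInt; [exact Hlr|].
    intros p _. apply continuity_2d_pt_section. now apply Cf.
Qed.

Section Energy.

Variables (a : R -> R) (p0 p1 T b : R) (w x n : R -> R -> R).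
Hypothesis L : legendre_flow a p0 p1 T b w x n.

Let Hsl := lf_slopes L.
Let Hb := lf_b L.

(* Constant extensions outside [p0, p1], so that two-sided derivatives and continuity in [p]
   never matter at the end points. *)
Let pc := clamp p0 p1.
Let ac (p : R) : R := a (pc p).
Let wc (p t : R) : R := w (pc p) t.
Let nc (p t : R) : R := n (pc p) t.
Let xc (p t : R) : R := x (pc p) t.

Lemma pc_bounds (p : R) : p0 <= pc p <= p1.
Proof. apply clamp_bounds. lra. Qed.

Lemma pc_id (p : R) : p0 <= p <= p1 -> pc p = p.
Proof. intro H. now apply clamp_id. Qed.

Lemma pc_continuity (p : R) : continuity_pt pc p.
Proof.
  apply (clamp_continuity (fun _ => p0) (fun _ => p1) (fun q => q)).
  - apply continuity_pt_cst.
  - apply continuity_pt_cst.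
  - apply continuity_pt_id.
Qed.

Lemma pc_continuity_2d (f : R -> R -> R) (p t : R) : t < 0 ->
  (forall p t, t < 0 -> continuity_2d_pt f p t) -> continuity_2d_pt (fun p t => f (pc p) t) p t.
Proof.
  intros Ht Hf. apply (continuity_2d_pt_comp f (fun q _ => pc q) (fun _ s => s)).
  - now apply Hf.
  - apply continuity_2d_pt_fst, pc_continuity.
  - apply continuity_2d_pt_id2.
Qed.

Lemma ac_continuity (p : R) : continuity_pt ac p.
Proof.
  apply (continuity_pt_comp pc a); [apply pc_continuity|].
  apply (lf_ca L).
Qed.

Lemma ac_continuity_2d (p t : R) : continuity_2d_pt (fun p _ => ac p) p t.
Proof. apply continuity_2d_pt_fst, ac_continuity. Qed.

Lemma wc_continuity (p t : R) : t < 0 -> continuity_2d_pt wc p t.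
Proof. intro Ht. apply pc_continuity_2d; [exact Ht|apply (lf_cw L)]. Qed.

Lemma nc_continuity (p t : R) : t < 0 -> continuity_2d_pt nc p t.
Proof. intro Ht. apply pc_continuity_2d; [exact Ht|apply (lf_cn L)]. Qed.

Lemma xc_continuity (p t : R) : t < 0 -> continuity_2d_pt xc p t.
Proof. intro Ht. apply pc_continuity_2d; [exact Ht|apply (lf_cx L)]. Qed.

Lemma wc_pos (p t : R) : t < 0 -> 0 < wc p t.
Proof. intro Ht. apply (lf_w_pos L); [apply pc_bounds|exact Ht]. Qed.

Lemma nc_pos (p t : R) : t < 0 -> 0 < nc p t.
Proof. intro Ht. now apply (lf_n_pos L). Qed.

Lemma wc_dt (p t : R) : t < 0 -> is_derive (fun s => wc p s) t (- ac p / nc p t).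
Proof. intro Ht. apply (lf_dt L); [apply pc_bounds|exact Ht]. Qed.

Lemma speed_continuity (p t : R) : t < 0 -> continuity_2d_pt (fun p t => - ac p / nc p t) p t.
Proof.
  intro Ht. apply continuity_2d_pt_mult.
  - apply continuity_2d_pt_opp, ac_continuity_2d.
  - apply continuity_2d_pt_inv; [now apply nc_continuity|].
    apply Rgt_not_eq. now apply nc_pos.
Qed.

Lemma wc_dp (p t : R) : p0 < p < p1 -> t < 0 -> is_derive (fun q => wc q t) p (- xc p t).
Proof.
  intros Hp Ht. unfold xc. rewrite pc_id by lra.
  apply is_derive_ext_loc with (fun q => w q t).
  - generalize (locally_between p0 p1 p Hp). apply filter_imp. intros q Hq. unfold wc.
    now rewrite pc_id by lra.
  - now apply (lf_dw L).
Qed.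

Lemma xc_dp (p t : R) : p0 < p < p1 -> t < 0 -> is_derive (fun q => xc q t) p (- nc p t).
Proof.
  intros Hp Ht. unfold nc. rewrite pc_id by lra.
  apply is_derive_ext_loc with (fun q => x q t).
  - generalize (locally_between p0 p1 p Hp). apply filter_imp. intros q Hq. unfold xc.
    now rewrite pc_id by lra.
  - now apply (lf_dx L).
Qed.

(* Green's formula: the boundary terms vanish because of the Robin conditions. *)
Lemma robin_reciprocity (s t : R) : s < 0 -> t < 0 ->
  RInt (fun p => wc p s * nc p t - wc p t * nc p s) p0 p1 = 0.
Proof.
  intros Hs Ht.
  rewrite (RInt_of_interior_derivative (fun p => wc p t * xc p s - wc p s * xc p t)).
  - unfold wc, xc. rewrite !pc_id by lra.
    rewrite (lf_right L s Hs), (lf_right L t Ht),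
      (lf_left L s Hs), (lf_left L t Ht). real_eq. ring.
  - lra.
  - intro p. apply continuity_pt_minus; apply continuity_pt_mult;
      (apply (continuity_2d_pt_section wc) || apply (continuity_2d_pt_section nc));
      (now apply wc_continuity) || now apply nc_continuity.
  - intros p _. apply continuity_pt_minus; apply continuity_pt_mult;
      (apply (continuity_2d_pt_section wc) || apply (continuity_2d_pt_section xc));
      (now apply wc_continuity) || now apply xc_continuity.
  - intros p Hp.
    replace (wc p s * nc p t - wc p t * nc p s) with
      (- xc p t * xc p s + wc p t * - nc p s - (- xc p s * xc p t + wc p s * - nc p t)) by ring.
    apply @is_derive_minus.
    + apply (is_derive_mult (fun p => wc p t) (fun p => xc p s)).
      * now apply wc_dp.
      * now apply xc_dp.
      * intros c d. apply Rmult_comm.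
    + apply (is_derive_mult (fun p => wc p s) (fun p => xc p t)).
      * now apply wc_dp.
      * now apply xc_dp.
      * intros c d. apply Rmult_comm.
Qed.

(** Half the integral of [(u - x ux) dx] along the curve, that is, the area enclosed by the curve
    and the two sides of the wedge. *)
Let area (t : R) : R := RInt (fun p => wc p t * nc p t) p0 p1 / 2.

(** Reciprocity trades the integral of [w(t) n(s)] for that of [w(s) n(t)]. The first-order part
    then involves only the increment of [w], whose time derivative is known, and the increment of
    [n] enters only in a product of two increments. *)
Lemma area_increment (s t : R) : s < 0 -> t < 0 ->
  area s - area t = RInt (fun p => (wc p s - wc p t) * nc p t) p0 p1 +
    RInt (fun p => (wc p s - wc p t) * (nc p s - nc p t)) p0 p1 / 2.
Proof.
  intros Hs Ht. assert (G := robin_reciprocity s t Hs Ht).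
  assert (E : forall q r, q < 0 -> r < 0 -> ex_RInt (fun p => wc p q * nc p r) p0 p1).
  { intros q r Hq Hr. apply continuity_pt_ex_RInt; [lra|]. intros p _.
    apply continuity_pt_mult.
    - apply (continuity_2d_pt_section wc). now apply wc_continuity.
    - apply (continuity_2d_pt_section nc). now apply nc_continuity. }
  assert (Mi : forall f g : R -> R, ex_RInt f p0 p1 -> ex_RInt g p0 p1 ->
    RInt (fun p => f p - g p) p0 p1 = RInt f p0 p1 - RInt g p0 p1 /\
    ex_RInt (fun p => f p - g p) p0 p1).
  { intros f g Hf Hg. split; [now apply (RInt_minus f g)|now apply @ex_RInt_minus]. }
  assert (Ess := E s s Hs Hs). assert (Est := E s t Hs Ht).
  assert (Ets := E t s Ht Hs). assert (Ett := E t t Ht Ht).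
  rewrite (proj1 (Mi _ _ Est Ets)) in G.
  assert (R1 : RInt (fun p => (wc p s - wc p t) * nc p t) p0 p1 =
    RInt (fun p => wc p s * nc p t) p0 p1 - RInt (fun p => wc p t * nc p t) p0 p1).
  { rewrite <- (proj1 (Mi _ _ Est Ett)). apply RInt_eq. intros p. simpl. ring. }
  assert (R2 : RInt (fun p => (wc p s - wc p t) * (nc p s - nc p t)) p0 p1 =
    (RInt (fun p => wc p s * nc p s) p0 p1 - RInt (fun p => wc p s * nc p t) p0 p1) -
    (RInt (fun p => wc p t * nc p s) p0 p1 - RInt (fun p => wc p t * nc p t) p0 p1)).
  { destruct (Mi _ _ Ess Est) as [<- X1]. destruct (Mi _ _ Ets Ett) as [<- X2].
    rewrite <- (proj1 (Mi _ _ X1 X2)). apply RInt_eq. intros p. simpl. ring. }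
  unfold area. rewrite R1, R2. lra.
Qed.

(** The increment of [w] is at most [M |h|] by the mean value theorem, while that of [n] tends to 0
    uniformly on the interval of slopes; the product is [o(h)]. *)
Lemma second_order_increment (t : R) : t < 0 ->
  is_derive (fun s => RInt (fun p => (wc p s - wc p t) * (nc p s - nc p t)) p0 p1) t 0.
Proof.
  intro Ht.
  destruct (max_on_rectangle (fun p s => Rabs (- ac p / nc p s)) p0 p1 (2 * t) (t / 2))
    as [pm [tm [_ [_ HM]]]]; [lra|lra| |].
  { intros p s _ Hs. apply continuity_1d_2d_pt_comp; [apply Rcontinuity_abs|].
    apply speed_continuity. lra. }
  set (M := Rabs (- ac pm / nc pm tm)) in *.
  assert (PM : 0 <= M) by apply Rabs_pos.
  apply is_derive_Reals. intros eps Heps.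
  set (K := (p1 - p0) * (M + 1)).
  assert (PK : 0 < K) by (apply Rmult_lt_0_compat; lra).
  assert (He : 0 < eps / (2 * K)) by (apply Rdiv_lt_0_compat; lra).
  destruct (uniform_continuity_2d_1d nc p0 p1 t) with (eps := mkposreal _ He) as [d Hd].
  { intros p _. now apply nc_continuity. }
  simpl in Hd. assert (Pd := cond_pos d).
  assert (Hm : 0 < Rmin d (- t / 2)) by (apply Rmin_pos; lra).
  assert (M1 := Rmin_l d (- t / 2)). assert (M2 := Rmin_r d (- t / 2)).
  exists (mkposreal _ Hm). intros h Hh0 Hh. simpl in Hh.
  assert (Bh := Rabs_def2 _ _ Hh).
  assert (Ph : 0 < Rabs h) by (now apply Rabs_pos_lt).
  replace (RInt (fun p => (wc p t - wc p t) * (nc p t - nc p t)) p0 p1) with 0.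
  2:{ transitivity (RInt (fun _ => 0) p0 p1).
      - rewrite RInt_const. unfold scal; simpl; unfold mult; simpl. ring.
      - apply RInt_eq. intros p. ring. }
  rewrite !Rminus_0_r. unfold Rdiv. rewrite Rabs_mult, Rabs_inv.
  apply Rmult_lt_reg_r with (Rabs h); [exact Ph|]. rewrite Rmult_assoc, Rinv_l, Rmult_1_r by lra.
  apply Rle_lt_trans with ((p1 - p0) * (M * Rabs h * (eps / (2 * K)))).
  - apply abs_RInt_le_const; [lra| |].
    + apply continuity_pt_ex_RInt; [lra|]. intros p _. apply continuity_pt_mult;
        apply continuity_pt_minus;
        (apply (continuity_2d_pt_section wc) || apply (continuity_2d_pt_section nc));
        (apply wc_continuity || apply nc_continuity); lra.
    + intros p Hp. rewrite Rabs_mult. apply Rmult_le_compat; try apply Rabs_pos.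
      * assert (Dw : forall s, 2 * t <= s <= t / 2 -> is_derive (fun s => wc p s) s (- ac p / nc p s)).
        { intros s Hs. apply wc_dt. lra. }
        assert (MV : exists s, 2 * t <= s <= t / 2 /\ wc p (t + h) - wc p t = (- ac p / nc p s) * h).
        { destruct (Rtotal_order h 0) as [Hn|[|Hn]]; [|lra|].
          - destruct (mean_value (fun s => wc p s) (fun s => - ac p / nc p s) (t + h) t)
              as [s [Hs E]]; [lra| | |].
            + intros s Hs. apply Dw. lra.
            + intros s Hs. apply is_derive_continuity_pt with (- ac p / nc p s). apply Dw. lra.
            + exists s. split; [lra|]. cbv beta in E. lra.
          - destruct (mean_value (fun s => wc p s) (fun s => - ac p / nc p s) t (t + h))
              as [s [Hs E]]; [lra| | |].
            + intros s Hs. apply Dw. lra.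
            + intros s Hs. apply is_derive_continuity_pt with (- ac p / nc p s). apply Dw. lra.
            + exists s. split; [lra|]. cbv beta in E. lra. }
        destruct MV as [s [Hs ->]]. rewrite Rabs_mult. apply Rmult_le_compat_r; [apply Rabs_pos|].
        now apply HM.
      * apply Rlt_le. apply Hd; try lra. rewrite Rminus_diag, Rabs_R0. exact Pd.
  - assert (E : (p1 - p0) * (M * Rabs h * (eps / (2 * K))) =
      (p1 - p0) * M / K * (eps / 2) * Rabs h) by (field; lra).
    rewrite E. apply Rmult_lt_compat_r; [exact Ph|].
    assert (Q : (p1 - p0) * M / K <= 1).
    { apply Rmult_le_reg_r with K; [exact PK|]. unfold Rdiv.
      rewrite Rmult_assoc, Rinv_l by lra. unfold K. lra. }
    assert ((p1 - p0) * M / K * (eps / 2) <= 1 * (eps / 2)) by (apply Rmult_le_compat_r; lra). lra.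
Qed.

Let c := RInt ac p0 p1.

Lemma ex_RInt_ac : ex_RInt ac p0 p1.
Proof. apply continuity_pt_ex_RInt; [lra|]. intros p _. apply ac_continuity. Qed.

(** Only the integral of [w_t n] survives in the increment, and [w_t n = - a]. *)
Lemma area_derive (t : R) : t < 0 -> is_derive area t (- c).
Proof.
  intro Ht.
  assert (Neg := locally_neg t Ht).
  apply is_derive_ext_loc with (fun s => area t +
    (RInt (fun p => (wc p s - wc p t) * nc p t) p0 p1 +
     / 2 * RInt (fun p => (wc p s - wc p t) * (nc p s - nc p t)) p0 p1)).
  { generalize Neg. apply filter_imp. intros s Hs. assert (Q := area_increment s t Hs Ht).
    change (RInt (fun p => (wc p s - wc p t) * (nc p s - nc p t)) p0 p1 / 2) with
      (RInt (fun p => (wc p s - wc p t) * (nc p s - nc p t)) p0 p1 * / 2) in Q. lra. }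
  replace (- c) with (0 + (RInt (fun p => (- ac p / nc p t) * nc p t) p0 p1 + / 2 * 0)).
  - apply @is_derive_plus; [apply @is_derive_const|].
    apply @is_derive_plus.
    + apply (is_derive_RInt_time (fun p s => (wc p s - wc p t) * nc p t)
        (fun p s => (- ac p / nc p s) * nc p t)); [lra|exact Ht| | |].
      * intros p s Hs. apply continuity_2d_pt_mult.
        -- apply continuity_2d_pt_minus; [now apply wc_continuity|].
           apply (continuity_2d_pt_fst (fun p => wc p t)), continuity_2d_pt_section.
           now apply wc_continuity.
        -- apply (continuity_2d_pt_fst (fun p => nc p t)), continuity_2d_pt_section.
           now apply nc_continuity.
      * intros p s Hs. apply continuity_2d_pt_mult; [now apply speed_continuity|].
        apply (continuity_2d_pt_fst (fun p => nc p t)), continuity_2d_pt_section.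
        now apply nc_continuity.
      * intros p s Hs.
        replace (- ac p / nc p s * nc p t) with (nc p t * (- ac p / nc p s - 0)) by ring.
        apply is_derive_ext with (fun z => nc p t * (wc p z - wc p t)).
        { intro z. apply Rmult_comm. }
        apply @is_derive_scal. apply @is_derive_minus; [now apply wc_dt|apply @is_derive_const].
    + apply @is_derive_scal. now apply second_order_increment.
  - rewrite Rmult_0_r, Rplus_0_r, Rplus_0_l.
    transitivity (RInt (fun p => opp (ac p)) p0 p1).
    + apply RInt_eq. intros p. assert (N := nc_pos p t Ht). unfold opp; simpl. field. lra.
    + rewrite (RInt_opp ac) by apply ex_RInt_ac. reflexivity.
Qed.

Let entropy (t : R) : R := RInt (fun p => ac p * ln (wc p t)) p0 p1.

Lemma entropy_derive (t : R) : t < 0 ->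
  is_derive entropy t (RInt (fun p => ac p * ((- ac p / nc p t) * / wc p t)) p0 p1).
Proof.
  intro Ht.
  apply (is_derive_RInt_time (fun p s => ac p * ln (wc p s))
    (fun p s => ac p * ((- ac p / nc p s) * / wc p s))); [lra|exact Ht| | |].
  - intros p s Hs. apply continuity_2d_pt_mult; [apply ac_continuity_2d|].
    apply continuity_1d_2d_pt_comp; [|now apply wc_continuity].
    apply is_derive_continuity_pt with (/ wc p s). apply is_derive_ln. now apply wc_pos.
  - intros p s Hs. apply continuity_2d_pt_mult; [apply ac_continuity_2d|].
    apply continuity_2d_pt_mult; [now apply speed_continuity|].
    apply continuity_2d_pt_inv; [now apply wc_continuity|]. apply Rgt_not_eq. now apply wc_pos.
  - intros p s Hs. apply @is_derive_scal.
    apply (is_derive_comp ln (fun z => wc p z)); [|now apply wc_dt].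
    apply is_derive_ln. now apply wc_pos.
Qed.

Let energy (t : R) : R := entropy t - c / 2 * ln (- t) + area t / (2 * t).

Let dissipation (p t : R) : R := (ac p + wc p t * nc p t / (2 * t)) ^ 2 / (nc p t * wc p t).

Lemma dissipation_continuity (p t : R) : t < 0 -> continuity_pt (fun q => dissipation q t) p.
Proof.
  intro Ht. assert (N := nc_pos p t Ht). assert (P := wc_pos p t Ht).
  assert (Cw : continuity_pt (fun q => wc q t) p).
  { apply (continuity_2d_pt_section wc). now apply wc_continuity. }
  assert (Cn : continuity_pt (fun q => nc q t) p).
  { apply (continuity_2d_pt_section nc). now apply nc_continuity. }
  assert (Cs : continuity_pt (fun q => ac q + wc q t * nc q t / (2 * t)) p).
  { apply continuity_pt_plus; [apply ac_continuity|]. unfold Rdiv.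
    apply continuity_pt_mult; [now apply continuity_pt_mult|].
    apply continuity_pt_cst. }
  unfold dissipation. simpl. apply continuity_pt_div.
  - apply continuity_pt_mult; [exact Cs|]. apply continuity_pt_mult; [exact Cs|].
    apply continuity_pt_cst.
  - now apply continuity_pt_mult.
  - apply Rgt_not_eq. now apply Rmult_lt_0_compat.
Qed.

(** Two equal terms [- c / (2 t)], one from the logarithm and one from the constant rate of [area],
    form the cross term that completes [a^2 / (n w)] and [w n / (4 t^2)] to a square. This is what
    fixes the coefficients in [energy]. *)
Lemma energy_derive (t : R) : t < 0 ->
  is_derive energy t (- RInt (fun p => dissipation p t) p0 p1).
Proof.
  intro Ht.
  assert (Ed : - RInt (fun p => dissipation p t) p0 p1 =
    RInt (fun p => ac p * ((- ac p / nc p t) * / wc p t)) p0 p1 - c / 2 * (/ t) +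
    (- c * (2 * t) - area t * 2) / (2 * t) ^ 2).
  { set (f1 := fun p => ac p * ((- ac p / nc p t) * / wc p t)).
    set (f2 := fun p => wc p t * nc p t).
    assert (X2 : ex_RInt f2 p0 p1).
    { apply continuity_pt_ex_RInt; [lra|]. intros p _. apply continuity_pt_mult.
      - apply (continuity_2d_pt_section wc). now apply wc_continuity.
      - apply (continuity_2d_pt_section nc). now apply nc_continuity. }
    assert (X1 : ex_RInt f1 p0 p1).
    { apply continuity_pt_ex_RInt; [lra|]. intros p _. apply continuity_pt_mult.
      - apply ac_continuity.
      - apply continuity_pt_mult.
        + apply (continuity_2d_pt_section (fun p t => - ac p / nc p t)). now apply speed_continuity.
        + apply continuity_pt_inv.
          * apply (continuity_2d_pt_section wc). now apply wc_continuity.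
          * apply Rgt_not_eq. now apply wc_pos. }
    assert (X3 := ex_RInt_ac).
    assert (Ea : area t = RInt f2 p0 p1 / 2) by reflexivity.
    rewrite Ea.
    assert (Q : RInt (fun p => dissipation p t) p0 p1 =
      - RInt f1 p0 p1 + / t * c + / (4 * t ^ 2) * RInt f2 p0 p1).
    { assert (Y1 : is_RInt (fun p => opp (f1 p)) p0 p1 (opp (RInt f1 p0 p1))).
      { apply @is_RInt_opp. now apply is_RInt_RInt. }
      assert (Y3 : is_RInt (fun p => scal (/ t) (ac p)) p0 p1 (scal (/ t) c)).
      { apply @is_RInt_scal. now apply is_RInt_RInt. }
      assert (Y2 : is_RInt (fun p => scal (/ (4 * t ^ 2)) (f2 p)) p0 p1
        (scal (/ (4 * t ^ 2)) (RInt f2 p0 p1))).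
      { apply @is_RInt_scal. now apply is_RInt_RInt. }
      apply is_RInt_unique.
      assert (Y := is_RInt_plus _ _ _ _ _ _ (is_RInt_plus _ _ _ _ _ _ Y1 Y3) Y2).
      apply is_RInt_ext with (2 := Y). intros p _.
      unfold plus, opp, scal; simpl; unfold mult; simpl. unfold dissipation, f1, f2.
      assert (N := nc_pos p t Ht). assert (P := wc_pos p t Ht). field. repeat split; lra. }
    rewrite Q. field. lra. }
  rewrite Ed. unfold energy.
  apply (is_derive_plus (fun t => entropy t - c / 2 * ln (- t)) (fun t => area t / (2 * t))).
  - apply (is_derive_minus entropy (fun t => c / 2 * ln (- t))); [now apply entropy_derive|].
    apply @is_derive_scal. auto_derive; [lra|]. field. lra.
  - apply is_derive_div; [now apply area_derive| |lra].
    auto_derive; [trivial|ring].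
Qed.

Lemma energy_nonincreasing (s t : R) : s <= t -> t < 0 -> energy t <= energy s.
Proof.
  intros Hst Ht. enough (- energy s <= - energy t) by lra.
  apply (derivative_nonneg_le (fun t => - energy t)
    (fun t => - - RInt (fun p => dissipation p t) p0 p1)).
  - exact Hst.
  - intros r Hr. apply @is_derive_opp. apply energy_derive. lra.
  - intros r Hr. apply continuity_pt_opp. eapply is_derive_continuity_pt. apply energy_derive. lra.
  - intros r Hr. rewrite Ropp_involutive. apply RInt_ge_0; [lra| |].
    + apply continuity_pt_ex_RInt; [lra|]. intros p _. apply dissipation_continuity. lra.
    + intros p _. unfold dissipation.
      assert (N := nc_pos p r). assert (P := wc_pos p r).
      apply Rdiv_le_0_compat; [apply pow2_ge_0|]. apply Rmult_lt_0_compat; [apply N|apply P]; lra.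
Qed.

(** Scaling by [b] adds [c ln b] to the entropy, which the logarithmic term takes away, while [area]
    and [t] both scale by [b ^ 2]. *)
Lemma energy_periodic (t : R) : t < 0 -> energy t = energy (t / b ^ 2).
Proof.
  intro Ht.
  assert (B2 : 0 < b ^ 2) by (apply pow_lt; lra).
  assert (Ht2 : t / b ^ 2 < 0).
  { unfold Rdiv. assert (0 < / b ^ 2) by now apply Rinv_0_lt_compat. nra. }
  assert (Sw : forall p, wc p t = b * wc p (t / b ^ 2)).
  { intro p. apply (lf_scale_w L); [apply pc_bounds|exact Ht]. }
  assert (Sn : forall p, nc p t = b * nc p (t / b ^ 2)).
  { intro p. apply (lf_scale_n L); [apply pc_bounds|exact Ht]. }
  assert (E1 : entropy t = ln b * c + entropy (t / b ^ 2)).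
  { unfold entropy, c.
    assert (Y1 : is_RInt (fun p => scal (ln b) (ac p)) p0 p1 (scal (ln b) (RInt ac p0 p1))).
    { apply @is_RInt_scal. apply is_RInt_RInt. apply ex_RInt_ac. }
    assert (Y2 : is_RInt (fun p => ac p * ln (wc p (t / b ^ 2))) p0 p1
      (RInt (fun p => ac p * ln (wc p (t / b ^ 2))) p0 p1)).
    { apply is_RInt_RInt. apply continuity_pt_ex_RInt; [lra|]. intros p _.
      apply continuity_pt_mult; [apply ac_continuity|].
      apply (continuity_pt_comp (fun p => wc p (t / b ^ 2)) ln).
      - apply (continuity_2d_pt_section wc). now apply wc_continuity.
      - eapply is_derive_continuity_pt. apply is_derive_ln. now apply wc_pos. }
    apply is_RInt_unique.
    assert (Y := is_RInt_plus _ _ _ _ _ _ Y1 Y2).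
    apply is_RInt_ext with (2 := Y). intros p _.
    change (ln b * ac p + ac p * ln (wc p (t / b ^ 2)) = ac p * ln (wc p t)).
    rewrite Sw, ln_mult; [ring|lra|now apply wc_pos]. }
  assert (E2 : area t = b ^ 2 * area (t / b ^ 2)).
  { unfold area.
    assert (Y : is_RInt (fun p => scal (b ^ 2) (wc p (t / b ^ 2) * nc p (t / b ^ 2))) p0 p1
      (scal (b ^ 2) (RInt (fun p => wc p (t / b ^ 2) * nc p (t / b ^ 2)) p0 p1))).
    { apply @is_RInt_scal. apply is_RInt_RInt.
      apply continuity_pt_ex_RInt; [lra|]. intros p _. apply continuity_pt_mult.
      - apply (continuity_2d_pt_section wc). now apply wc_continuity.
      - apply (continuity_2d_pt_section nc). now apply nc_continuity. }
    rewrite (is_RInt_unique (fun p => wc p t * nc p t) p0 p1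
      (scal (b ^ 2) (RInt (fun p => wc p (t / b ^ 2) * nc p (t / b ^ 2)) p0 p1))).
    - unfold scal, mult; simpl; unfold mult; simpl. field.
    - apply is_RInt_ext with (2 := Y). intros p _.
      change (b ^ 2 * (wc p (t / b ^ 2) * nc p (t / b ^ 2)) = wc p t * nc p t).
      rewrite Sw, Sn. ring. }
  assert (E3 : ln (- t) = 2 * ln b + ln (- (t / b ^ 2))).
  { replace (- t) with (b * (b * - (t / b ^ 2))) by (field; lra).
    rewrite ln_mult; [|lra|apply Rmult_lt_0_compat; lra].
    rewrite ln_mult by lra. ring. }
  unfold energy. rewrite E1, E2, E3. field. split; lra.
Qed.

(** The period is taken from [b t] to [t / b], so that [t] lies in its interior: positive total
    dissipation at the single instant [t] would make the energy drop strictly across it. The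
    integral of the squares thus vanishes, and so does the square at each slope. *)
Lemma legendre_flow_self_similar (p t : R) : p0 < p < p1 -> t < 0 ->
  n p t * w p t = - 2 * t * a p.
Proof.
  intros Hp Ht.
  assert (D := energy_derive t Ht).
  assert (Dn : 0 <= RInt (fun p => dissipation p t) p0 p1).
  { apply RInt_ge_0; [lra| |].
    - apply continuity_pt_ex_RInt; [lra|]. intros q _. now apply dissipation_continuity.
    - intros q _. unfold dissipation. apply Rdiv_le_0_compat; [apply pow2_ge_0|].
      apply Rmult_lt_0_compat; [now apply nc_pos|now apply wc_pos]. }
  assert (Dz : RInt (fun p => dissipation p t) p0 p1 = 0).
  { destruct Dn as [Dn|<-]; [exfalso|reflexivity].
    apply @is_derive_opp in D. unfold opp in D. simpl in D. rewrite Ropp_involutive in D.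
    destruct (is_derive_sign_right _ _ _ D Dn) as [d [Hd [H _]]].
    assert (Hib : / b < 1). { rewrite <- Rinv_1. apply Rinv_lt_contravar; lra. }
    assert (Hib0 : 0 < / b) by (apply Rinv_0_lt_compat; lra).
    assert (Htb : t < t / b < 0). { unfold Rdiv. split; nra. }
    set (s := Rmin (t / b) (t + d / 2)).
    assert (S1 : s <= t / b) by apply Rmin_l. assert (S2 : s <= t + d / 2) by apply Rmin_r.
    assert (S3 : t < s) by (apply Rmin_glb_lt; lra).
    assert (Q := H s). assert (- energy t < - energy s) by (apply Q; lra).
    assert (energy (t / b) <= energy s) by (apply energy_nonincreasing; lra).
    assert (energy t <= energy (b * t)) by (apply energy_nonincreasing; nra).
    assert (E := energy_periodic (b * t)).
    replace (b * t / b ^ 2) with (t / b) in E by (field; lra).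
    assert (energy (b * t) = energy (t / b)) by (apply E; nra). lra. }
  assert (Z := RInt_zero_nonneg (fun p => dissipation p t) p0 p1).
  assert (Zp : dissipation p t = 0).
  { apply Z; try assumption.
    - lra.
    - intro q. now apply dissipation_continuity.
    - intros q _. unfold dissipation. apply Rdiv_le_0_compat; [apply pow2_ge_0|].
      apply Rmult_lt_0_compat; [now apply nc_pos|now apply wc_pos]. }
  assert (N := nc_pos p t Ht). assert (P := wc_pos p t Ht).
  assert (Sq : (ac p + wc p t * nc p t / (2 * t)) ^ 2 = 0).
  { unfold dissipation in Zp.
    replace ((ac p + wc p t * nc p t / (2 * t)) ^ 2)
      with ((ac p + wc p t * nc p t / (2 * t)) ^ 2 / (nc p t * wc p t) * (nc p t * wc p t))
      by (field; lra).
    rewrite Zp. ring. }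
  assert (Lz : ac p + wc p t * nc p t / (2 * t) = 0) by nra.
  unfold ac, wc, nc in Lz. rewrite pc_id in Lz by lra.
  replace (n p t * w p t) with (2 * t * (w p t * n p t / (2 * t))) by (field; lra).
  replace (w p t * n p t / (2 * t)) with (- a p) by lra. ring.
Qed.

End Energy.

(** * Uniqueness for the Robin problem *)

Record robin_solution (a : R -> R) (p0 p1 T : R) (w x : R -> R) : Prop := {
  rs_slopes : - T < p0 /\ p0 < p1 /\ p1 < T;
  rs_a_pos : forall p, 0 < a p;
  rs_ca : forall p, continuity_pt a p;
  rs_cw : forall p, continuity_pt w p;
  rs_cx : forall p, continuity_pt x p;
  rs_pos : forall p, p0 <= p <= p1 -> 0 < w p;
  rs_dw : forall p, p0 < p < p1 -> is_derive w p (- x p);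
  rs_dx : forall p, p0 < p < p1 -> is_derive x p (- a p / w p);
  rs_right : w p0 = (T - p0) * x p0;
  rs_left : w p1 = - (T + p1) * x p1 }.

Arguments rs_slopes {a p0 p1 T w x} _.
Arguments rs_a_pos {a p0 p1 T w x} _.
Arguments rs_ca {a p0 p1 T w x} _.
Arguments rs_cw {a p0 p1 T w x} _.
Arguments rs_cx {a p0 p1 T w x} _.
Arguments rs_pos {a p0 p1 T w x} _.
Arguments rs_dw {a p0 p1 T w x} _.
Arguments rs_dx {a p0 p1 T w x} _.
Arguments rs_right {a p0 p1 T w x} _.
Arguments rs_left {a p0 p1 T w x} _.

Lemma robin_solution_reflect (a : R -> R) (p0 p1 T : R) (w x : R -> R) :
  robin_solution a p0 p1 T w x ->
  robin_solution (fun p => a (- p)) (- p1) (- p0) T (fun p => w (- p)) (fun p => - x (- p)).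
Proof.
  intro H.
  assert (Cm : forall f : R -> R, (forall p, continuity_pt f p) ->
    forall p, continuity_pt (fun p => f (- p)) p).
  { intros f Hf p. apply (continuity_pt_comp (fun p => - p) f); [|apply Hf].
    apply continuity_pt_opp, derivable_continuous_pt, derivable_pt_id. }
  constructor.
  - destruct (rs_slopes H). lra.
  - intro p. apply (rs_a_pos H).
  - apply Cm, (rs_ca H).
  - apply Cm, (rs_cw H).
  - intro p. apply continuity_pt_opp. apply Cm, (rs_cx H).
  - intros p Hp. apply (rs_pos H). lra.
  - intros p Hp. apply is_derive_reflect. apply (rs_dw H). lra.
  - intros p Hp. replace (- a (- p) / w (- p)) with (opp (- (- a (- p) / w (- p))))
      by (unfold opp; simpl; ring).
    apply @is_derive_opp. apply is_derive_reflect. apply (rs_dx H). lra.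
  - rewrite Ropp_involutive, (rs_left H). ring.
  - rewrite Ropp_involutive, (rs_right H). ring.
Qed.

(** [z] is the supremum of the points up to which [f] stays positive; continuity excludes both signs
    of [f z]. *)
Lemma first_zero (f : R -> R) (l r : R) :
  l < r -> (forall x, continuity_pt f x) -> 0 < f l -> f r <= 0 ->
  exists z, l < z <= r /\ f z = 0 /\ forall x, l <= x < z -> 0 < f x.
Proof.
  intros Hlr Cf Hl Hr.
  set (E := fun z => l <= z <= r /\ forall x, l <= x <= z -> 0 < f x).
  destruct (completeness E) as [z [Ub Lub]].
  - exists r. intros z [Hz _]. lra.
  - exists l. split; [lra|]. intros x Hx. replace x with l by lra. exact Hl.
  - assert (Hlz : l <= z).
    { apply Ub. split; [lra|]. intros x Hx. replace x with l by lra. exact Hl. }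
    assert (Hzr : z <= r). { apply Lub. intros y [Hy _]. lra. }
    assert (Bef : forall x, l <= x < z -> 0 < f x).
    { intros x Hx. destruct (Rlt_le_dec 0 (f x)) as [|Hn]; [assumption|exfalso].
      assert (z <= x); [|lra]. apply Lub. intros y [Hy1 Hy2].
      destruct (Rle_lt_dec y x) as [|G]; [assumption|].
      assert (0 < f x) by (apply Hy2; lra). lra. }
    assert (Z : f z = 0).
    { destruct (Rtotal_order (f z) 0) as [Hn|[H0|Hp]]; [exfalso|exact H0|exfalso].
      - assert (Hn' : 0 < - f z) by lra.
        destruct (proj1 (continuity_pt_locally f z) (Cf z) (mkposreal _ Hn')) as [d Hd].
        simpl in Hd. assert (Pd := cond_pos d).
        assert (Hlz' : l < z). { destruct Hlz as [|<-]; [assumption|lra]. }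
        set (y := Rmax l (z - d / 2)).
        assert (Y1 : l <= y) by apply Rmax_l. assert (Y2 : z - d / 2 <= y) by apply Rmax_r.
        assert (Y3 : y < z) by (apply Rmax_lub_lt; lra).
        assert (Q : Rabs (f y - f z) < - f z).
        { apply Hd. change (Rabs (y - z) < d). rewrite Rabs_left; lra. }
        apply Rabs_def2 in Q. assert (0 < f y) by (apply Bef; lra). lra.
      - destruct (proj1 (continuity_pt_locally f z) (Cf z) (mkposreal _ Hp)) as [d Hd].
        simpl in Hd. assert (Pd := cond_pos d).
        assert (Hzr' : z < r). { destruct Hzr as [|E0]; [assumption|]. rewrite E0 in Hp. lra. }
        set (y := Rmin r (z + d / 2)).
        assert (Y1 : y <= r) by apply Rmin_l. assert (Y2 : y <= z + d / 2) by apply Rmin_r.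
        assert (Y3 : z < y) by (apply Rmin_glb_lt; lra).
        assert (y <= z); [|lra]. apply Ub. split; [lra|]. intros x Hx.
        destruct (Rlt_le_dec x z) as [|G]; [apply Bef; lra|].
        assert (Q : Rabs (f x - f z) < f z).
        { apply Hd. change (Rabs (x - z) < d). rewrite Rabs_right; lra. }
        apply Rabs_def2 in Q. lra. }
    exists z. split; [|split; assumption]. split; [|exact Hzr].
    destruct Hlz as [|E0]; [assumption|]. rewrite E0 in Hl. lra.
Qed.

Section TwoSolutions.

Variables (a : R -> R) (p0 p1 T : R) (w1 x1 w2 x2 : R -> R).
Hypothesis H1 : robin_solution a p0 p1 T w1 x1.
Hypothesis H2 : robin_solution a p0 p1 T w2 x2.

Let Hsl := rs_slopes H1.

(* The sum and the difference of two solutions solve the linear equations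
   [S'' = G S] and [D'' = - G D] with the same [G = a / (w1 w2)]. *)
Let S (p : R) : R := w1 p + w2 p.
Let D (p : R) : R := w1 p - w2 p.
Let S' (p : R) : R := - (x1 p + x2 p).
Let D' (p : R) : R := - (x1 p - x2 p).
Let G (p : R) : R := a p / (w1 p * w2 p).

Lemma sum_diff_derivatives (p : R) : p0 < p < p1 ->
  is_derive S p (S' p) /\ is_derive D p (D' p) /\
  is_derive S' p (G p * S p) /\ is_derive D' p (- (G p * D p)).
Proof.
  intro Hp.
  assert (P1 : 0 < w1 p) by (apply (rs_pos H1); lra).
  assert (P2 : 0 < w2 p) by (apply (rs_pos H2); lra).
  assert (A1 := rs_dw H1 p Hp). assert (A2 := rs_dw H2 p Hp).
  assert (B1 := rs_dx H1 p Hp). assert (B2 := rs_dx H2 p Hp).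
  split; [|split; [|split]].
  - replace (S' p) with (- x1 p + - x2 p) by (unfold S'; ring). now apply @is_derive_plus.
  - replace (D' p) with (- x1 p - - x2 p) by (unfold D'; ring). now apply @is_derive_minus.
  - replace (G p * S p) with (opp (- a p / w1 p + - a p / w2 p))
      by (unfold G, S, opp; simpl; field; lra).
    apply @is_derive_opp. now apply @is_derive_plus.
  - replace (- (G p * D p)) with (opp (- a p / w1 p - - a p / w2 p))
      by (unfold G, D, opp; simpl; field; lra).
    apply @is_derive_opp. now apply @is_derive_minus.
Qed.

Lemma sum_diff_continuity (p : R) :
  continuity_pt S p /\ continuity_pt D p /\ continuity_pt S' p /\ continuity_pt D' p.
Proof.
  assert (A1 := rs_cw H1 p). assert (A2 := rs_cw H2 p).
  assert (B1 := rs_cx H1 p). assert (B2 := rs_cx H2 p).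
  split; [|split; [|split]].
  - now apply continuity_pt_plus.
  - now apply continuity_pt_minus.
  - apply continuity_pt_opp. now apply continuity_pt_plus.
  - apply continuity_pt_opp. now apply continuity_pt_minus.
Qed.

Lemma S_pos (p : R) : p0 <= p <= p1 -> 0 < S p.
Proof.
  intro Hp. assert (P1 := rs_pos H1 p Hp). assert (P2 := rs_pos H2 p Hp).
  unfold S. lra.
Qed.

Lemma G_pos (p : R) : p0 <= p <= p1 -> 0 < G p.
Proof.
  intro Hp. apply Rdiv_lt_0_compat; [apply (rs_a_pos H1)|].
  apply Rmult_lt_0_compat; [now apply (rs_pos H1)|now apply (rs_pos H2)].
Qed.

Lemma sum_diff_boundary :
  S p0 = - (T - p0) * S' p0 /\ D p0 = - (T - p0) * D' p0 /\
  S p1 = (T + p1) * S' p1 /\ D p1 = (T + p1) * D' p1.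
Proof.
  unfold S, D, S', D'.
  rewrite (rs_right H1), (rs_right H2), (rs_left H1),
    (rs_left H2). repeat split; ring.
Qed.

Ltac sum_diff_cont p :=
  destruct (sum_diff_continuity p) as [? [? [? ?]]];
  repeat first [ assumption | apply continuity_pt_minus | apply continuity_pt_plus
    | apply continuity_pt_mult    | apply continuity_pt_id
    | apply continuity_pt_cst ].

(** The Robin condition turns [D p0 = 0] into vanishing Cauchy data. Gronwall's argument then
    applies: [(D^2 + D'^2) exp (- C q)] is nonincreasing for [C = 1 + max G]. *)
Lemma zero_data_propagates : D p0 = 0 -> forall p, p0 <= p <= p1 -> D p = 0 /\ D' p = 0.
Proof.
  intros H0 p Hp.
  assert (H0' : D' p0 = 0).
  { destruct sum_diff_boundary as [_ [B _]]. rewrite H0 in B.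
    assert (N : - (T - p0) <> 0) by lra. symmetry in B. apply Rmult_integral in B.
    destruct B; [contradiction|assumption]. }
  destruct (continuity_ab_maj G p0 p1) as [m [Hm Im]]; [lra| |].
  { intros q Hq. apply continuity_pt_div.
    - apply (rs_ca H1).
    - apply continuity_pt_mult; [apply (rs_cw H1)|apply (rs_cw H2)].
    - assert (P1 := rs_pos H1 q Hq). assert (P2 := rs_pos H2 q Hq).
      apply Rgt_not_eq. now apply Rmult_lt_0_compat. }
  assert (De : forall k q, is_derive (fun q => exp (- k * q)) q (- k * exp (- k * q))).
  { intros k q. auto_derive; [trivial|ring]. }
  set (C := 1 + G m).
  set (e := fun q => (D q ^ 2 + D' q ^ 2) * exp (- C * q)).
  assert (Ce : forall q, continuity_pt e q).
  { intro q. unfold e. apply continuity_pt_mult.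
    - simpl. sum_diff_cont q.
    - apply is_derive_continuity_pt with (- C * exp (- C * q)). apply De. }
  assert (Q : - e p0 <= - e p).
  { apply (derivative_nonneg_le (fun q => - e q)
      (fun q => - ((2 * D q * D' q + 2 * D' q * - (G q * D q)) * exp (- C * q) +
        (D q ^ 2 + D' q ^ 2) * (- C * exp (- C * q))))).
    - lra.
    - intros q Hq. destruct (sum_diff_derivatives q) as [_ [E1 [_ E2]]]; [lra|].
      apply @is_derive_opp. unfold e.
      apply (is_derive_mult (fun q => D q ^ 2 + D' q ^ 2) (fun q => exp (- C * q))).
      + apply (is_derive_plus (fun q => D q ^ 2) (fun q => D' q ^ 2)).
        * replace (2 * D q * D' q) with (INR 2 * D' q * D q ^ pred 2) by (simpl; ring).
          now apply is_derive_pow.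
        * replace (2 * D' q * - (G q * D q)) with (INR 2 * - (G q * D q) * D' q ^ pred 2)
            by (simpl; ring).
          now apply is_derive_pow.
      + apply De.
      + intros u v. apply Rmult_comm.
    - intros q _. apply continuity_pt_opp. apply Ce.
    - intros q Hq. assert (Gq : 0 < G q <= G m) by (split; [apply G_pos|apply Hm]; lra).
      assert (Pe := exp_pos (- C * q)).
      assert (K : 2 * D q * D' q + 2 * D' q * - (G q * D q) <= C * (D q ^ 2 + D' q ^ 2)).
      { assert (S1 := pow2_ge_0 (D q - D' q)). assert (S2 := pow2_ge_0 (D q + D' q)).
        assert (I1 : 2 * D q * D' q <= D q ^ 2 + D' q ^ 2) by lra.
        assert (I2 : 2 * D' q * - D q <= D q ^ 2 + D' q ^ 2) by lra.
        assert (I3 : 0 <= D q ^ 2 + D' q ^ 2) by lra.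
        assert (I4 : G q * (2 * D' q * - D q) <= G q * (D q ^ 2 + D' q ^ 2))
          by (apply Rmult_le_compat_l; lra).
        assert (I5 : G q * (D q ^ 2 + D' q ^ 2) <= G m * (D q ^ 2 + D' q ^ 2))
          by (apply Rmult_le_compat_r; lra).
        unfold C. lra. }
      apply Rmult_le_compat_r with (r := exp (- C * q)) in K; lra. }
  unfold e in Q. rewrite H0, H0' in Q.
  assert (Pe := exp_pos (- C * p)).
  assert (Z : D p ^ 2 + D' p ^ 2 <= 0).
  { apply Rmult_le_reg_r with (1 := Pe). lra. }
  assert (S1 := pow2_ge_0 (D p)). assert (S2 := pow2_ge_0 (D' p)).
  split; apply Rsqr_0_uniq; unfold Rsqr; lra.
Qed.

(** The Wronskian of the sum and the difference. The opposite signs of their equations give it the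
    derivative [2 G S D], and the common Robin conditions make it vanish at both ends. *)
Let Wr (p : R) : R := S' p * D p - S p * D' p.
(** Polarisation of the quadratic form [(f - (T + p) f') (f + (T - p) f')], the product of the two
    Robin expressions taken at the running slope [p]. It therefore vanishes at [p0], and its
    derivative involves only the Wronskian. *)
Let Q (p : R) : R := S p * D p - (T ^ 2 - p ^ 2) * (S' p * D' p) - p * (S' p * D p + S p * D' p).
(** At a zero of [D] one has [Q = - D' Bo]. For a single solution, [(T^2 - p^2) w' + p w] is
    [T^2 - p^2] times the midpoint of the chord that the wedge cuts from the tangent line of slope
    [p], minus the contact point [- w']; [Bo] adds these quantities for the two solutions. *)
Let Bo (p : R) : R := (T ^ 2 - p ^ 2) * S' p + p * S p.

Lemma wronskian_derive (p : R) : p0 < p < p1 -> is_derive Wr p (2 * (G p * (S p * D p))).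
Proof.
  intro Hp. destruct (sum_diff_derivatives p Hp) as [E1 [E2 [E3 E4]]].
  replace (2 * (G p * (S p * D p))) with
    (G p * S p * D p + S' p * D' p - (S' p * D' p + S p * - (G p * D p))) by ring.
  apply (is_derive_minus (fun p => S' p * D p) (fun p => S p * D' p)).
  - apply (is_derive_mult S' D); [exact E3|exact E2|intros u v; apply Rmult_comm].
  - apply (is_derive_mult S D'); [exact E1|exact E4|intros u v; apply Rmult_comm].
Qed.

Lemma wronskian_boundary : Wr p0 = 0 /\ Wr p1 = 0.
Proof.
  destruct sum_diff_boundary as [B1 [B2 [B3 B4]]]. unfold Wr.
  rewrite B1, B2, B3, B4. split; ring.
Qed.

Lemma Q_derive (p : R) : p0 < p < p1 -> is_derive Q p ((T ^ 2 - p ^ 2) * (G p * Wr p)).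
Proof.
  intro Hp. destruct (sum_diff_derivatives p Hp) as [E1 [E2 [E3 E4]]].
  assert (Com : forall u v : R, mult u v = mult v u) by (intros u v; apply Rmult_comm).
  assert (M1 := is_derive_mult S D p _ _ E1 E2 Com).
  assert (M2 := is_derive_mult S' D' p _ _ E3 E4 Com).
  assert (M3 := is_derive_mult S' D p _ _ E3 E2 Com).
  assert (M4 := is_derive_mult S D' p _ _ E1 E4 Com).
  assert (T2 : is_derive (fun p => T ^ 2 - p ^ 2) p (- 2 * p)).
  { auto_derive; [trivial|ring]. }
  assert (Id : is_derive (fun p : R => p) p 1) by apply @is_derive_id.
  assert (N2 := is_derive_mult _ _ p _ _ T2 M2 Com).
  assert (N3 := is_derive_mult _ _ p _ _ Id (is_derive_plus _ _ p _ _ M3 M4) Com).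
  assert (F := is_derive_minus _ _ p _ _ (is_derive_minus _ _ p _ _ M1 N2) N3).
  unfold Q. unfold Wr.
  match type of F with is_derive _ _ ?l =>
    replace ((T ^ 2 - p ^ 2) * (G p * (S' p * D p - S p * D' p))) with l end.
  - exact F.
  - unfold minus, plus, opp, mult; simpl. unfold mult; simpl. ring.
Qed.

Lemma Q_left_zero : Q p0 = 0.
Proof.
  destruct sum_diff_boundary as [B1 [B2 _]]. unfold Q. rewrite B1, B2. ring.
Qed.

(** The derivative of [Bo] is [(T^2 - p^2) G S + (S - p S')]. The last bracket is half the sum of
    [S + (T - p) S'] and [S - (T + p) S'], both nonnegative: convexity of [S] makes the first
    increase from 0 at [p0] and the second decrease to 0 at [p1]. *)
Lemma bottom_sum_increasing (p q : R) : p0 < p -> p <= q -> q < p1 -> Bo p <= Bo q.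
Proof.
  intros Hp Hpq Hq.
  assert (Com : forall u v : R, mult u v = mult v u) by (intros u v; apply Rmult_comm).
  destruct sum_diff_boundary as [B1 [_ [B3 _]]].
  assert (A : forall r, p0 <= r <= p1 -> 0 <= (T - r) * S' r + S r).
  { intros r Hr. replace 0 with ((T - p0) * S' p0 + S p0) by (rewrite B1; ring).
    apply (derivative_nonneg_le (fun r => (T - r) * S' r + S r) (fun r => (T - r) * (G r * S r))).
    - lra.
    - intros z Hz. destruct (sum_diff_derivatives z) as [E1 [_ [E3 _]]]; [lra|].
      replace ((T - z) * (G z * S z)) with (-1 * S' z + (T - z) * (G z * S z) + S' z) by ring.
      apply (is_derive_plus (fun r => (T - r) * S' r) S); [|exact E1].
      apply (is_derive_mult (fun r => T - r) S'); [|exact E3|exact Com].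
      auto_derive; [trivial|ring].
    - intros z _. sum_diff_cont z.
    - intros z Hz. apply Rmult_le_pos; [lra|]. apply Rmult_le_pos; apply Rlt_le.
      + apply G_pos; lra.
      + apply S_pos; lra. }
  assert (B : forall r, p0 <= r <= p1 -> 0 <= S r - (T + r) * S' r).
  { intros r Hr. enough ((T + r) * S' r - S r <= 0) by lra.
    replace 0 with ((T + p1) * S' p1 - S p1) by (rewrite B3; ring).
    apply (derivative_nonneg_le (fun r => (T + r) * S' r - S r) (fun r => (T + r) * (G r * S r))).
    - lra.
    - intros z Hz. destruct (sum_diff_derivatives z) as [E1 [_ [E3 _]]]; [lra|].
      replace ((T + z) * (G z * S z)) with (1 * S' z + (T + z) * (G z * S z) - S' z) by ring.
      apply (is_derive_minus (fun r => (T + r) * S' r) S); [|exact E1].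
      apply (is_derive_mult (fun r => T + r) S'); [|exact E3|exact Com].
      auto_derive; [trivial|ring].
    - intros z _. sum_diff_cont z.
    - intros z Hz. apply Rmult_le_pos; [lra|]. apply Rmult_le_pos; apply Rlt_le.
      + apply G_pos; lra.
      + apply S_pos; lra. }
  apply (derivative_nonneg_le Bo (fun r => (T ^ 2 - r ^ 2) * (G r * S r) + (S r - r * S' r))).
  - exact Hpq.
  - intros z Hz. destruct (sum_diff_derivatives z) as [E1 [_ [E3 _]]]; [lra|].
    replace ((T ^ 2 - z ^ 2) * (G z * S z) + (S z - z * S' z)) with
      ((- 2 * z) * S' z + (T ^ 2 - z ^ 2) * (G z * S z) + (1 * S z + z * S' z)) by ring.
    apply (is_derive_plus (fun r => (T ^ 2 - r ^ 2) * S' r) (fun r => r * S r)).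
    + apply (is_derive_mult (fun r => T ^ 2 - r ^ 2) S'); [|exact E3|exact Com].
      auto_derive; [trivial|ring].
    + apply (is_derive_mult (fun r => r) S); [apply @is_derive_id|exact E1|exact Com].
  - intros z _. unfold Bo. simpl. sum_diff_cont z.
  - intros z Hz. assert (Az := A z). assert (Bz := B z).
    assert (Pg : 0 < G z) by (apply G_pos; lra). assert (Ps : 0 < S z) by (apply S_pos; lra).
    assert (0 <= (T ^ 2 - z ^ 2) * (G z * S z)).
    { apply Rmult_le_pos; [nra|]. apply Rmult_le_pos; lra. }
    lra.
Qed.

(** The Wronskian vanishes at both ends, so its derivative [2 G S D] cannot stay positive and [D]
    has a zero. Up to the first one, [Wr] and then [Q] increase from 0; at the zero, [Wr > 0] reads
    [D' < 0], and [Q = - D' Bo > 0] gives the sign of [Bo]. *)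
Lemma first_zero_of_difference : 0 < D p0 ->
  exists z, p0 < z < p1 /\ D z = 0 /\ (forall p, p0 <= p < z -> 0 < D p) /\ 0 < Bo z.
Proof.
  intro H0. destruct wronskian_boundary as [W0 W1].
  assert (Hq : exists q, p0 < q < p1 /\ D q <= 0).
  { assert (CW : forall p, continuity_pt Wr p) by (intro p; unfold Wr; sum_diff_cont p).
    destruct (mean_value Wr (fun p => 2 * (G p * (S p * D p))) p0 p1) as [q [Hq E]].
    - lra.
    - intros p Hp. now apply wronskian_derive.
    - intros p _. apply CW.
    - exists q. split; [exact Hq|]. rewrite W0, W1 in E.
      assert (Pg : 0 < G q) by (apply G_pos; lra). assert (Ps : 0 < S q) by (apply S_pos; lra).
      destruct (Rle_lt_dec (D q) 0) as [|Hp]; [assumption|exfalso].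
      assert (0 < 2 * (G q * (S q * D q)) * (p1 - p0)).
      { apply Rmult_lt_0_compat; [|lra]. apply Rmult_lt_0_compat; [lra|].
        apply Rmult_lt_0_compat; [lra|]. now apply Rmult_lt_0_compat. }
      lra. }
  destruct Hq as [q [Hq Dq]].
  destruct (first_zero D p0 q) as [z [Hz [Dz Bef]]]; [lra| |exact H0|exact Dq|].
  { intro p. apply sum_diff_continuity. }
  exists z. split; [lra|]. split; [exact Dz|]. split; [exact Bef|].
  assert (Wpos : forall p, p0 < p <= z -> 0 < Wr p).
  { intros p Hp. rewrite <- W0.
    apply (derivative_pos_lt Wr (fun p => 2 * (G p * (S p * D p)))).
    - lra.
    - intros r Hr. apply wronskian_derive. lra.
    - intros r _. unfold Wr. sum_diff_cont r.
    - intros r Hr.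
      assert (Pg : 0 < G r) by (apply G_pos; lra). assert (Ps : 0 < S r) by (apply S_pos; lra).
      assert (Pd : 0 < D r) by (apply Bef; lra).
      apply Rmult_lt_0_compat; [lra|].
      apply Rmult_lt_0_compat; [lra|]. now apply Rmult_lt_0_compat. }
  assert (Qpos : 0 < Q z).
  { rewrite <- Q_left_zero.
    apply (derivative_pos_lt Q (fun p => (T ^ 2 - p ^ 2) * (G p * Wr p))).
    - lra.
    - intros r Hr. apply Q_derive. lra.
    - intros r _. unfold Q. simpl. sum_diff_cont r.
    - intros r Hr. assert (Pg : 0 < G r) by (apply G_pos; lra).
      assert (Pw : 0 < Wr r) by (apply Wpos; lra).
      apply Rmult_lt_0_compat; [nra|]. now apply Rmult_lt_0_compat. }
  assert (Wz := Wpos z). unfold Wr in Wz. rewrite Dz in Wz.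
  assert (Ps : 0 < S z) by (apply S_pos; lra).
  assert (Dn : D' z < 0). { assert (0 < S' z * 0 - S z * D' z) by (apply Wz; lra).
    apply Rmult_lt_reg_l with (1 := Ps). lra. }
  unfold Q in Qpos. rewrite Dz in Qpos. unfold Bo.
  apply Rmult_lt_reg_l with (- D' z); lra.
Qed.

End TwoSolutions.

Section Uniqueness.

Variables (a : R -> R) (p0 p1 T : R).

(** The first zero of the difference has [Bo > 0]. Reflection changes the sign of [Bo], so the last
    zero, which cannot precede the first, has [Bo < 0], against the monotonicity of [Bo]. If the
    difference vanishes at [p1], it propagates back to [p0]. *)
Lemma robin_difference_pos_absurd (w1 x1 w2 x2 : R -> R) :
  robin_solution a p0 p1 T w1 x1 -> robin_solution a p0 p1 T w2 x2 ->
  ~ 0 < w1 p0 - w2 p0.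
Proof.
  intros H1 H2 H0.
  destruct (rs_slopes H1) as [Sl1 [Sl2 Sl3]].
  destruct (first_zero_of_difference _ _ _ _ _ _ _ _ H1 H2 H0) as [z1 [B1 [D1 [_ R1]]]].
  assert (R1' := robin_solution_reflect _ _ _ _ _ _ H1).
  assert (R2' := robin_solution_reflect _ _ _ _ _ _ H2).
  assert (Fin : forall z2, z1 <= z2 < p1 ->
    (T ^ 2 - z2 ^ 2) * - (x1 z2 + x2 z2) + z2 * (w1 z2 + w2 z2) < 0 -> False).
  { intros z2 Hz2 R2.
    assert (M := bottom_sum_increasing _ _ _ _ _ _ _ _ H1 H2 z1 z2). lra. }
  destruct (Rtotal_order (w1 p1 - w2 p1) 0) as [Hn|[Hz|Hp]].
  - destruct (first_zero_of_difference _ _ _ _ _ _ _ _ R2' R1') as [z [Bz [Dz [Af Rz]]]].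
    { rewrite !Ropp_involutive. lra. }
    simpl in Dz, Af, Rz. apply (Fin (- z)).
    + split; [|lra]. destruct (Rle_lt_dec z1 (- z)) as [|G]; [assumption|exfalso].
      assert (N := Af (- z1)). rewrite Ropp_involutive in N.
      assert (0 < w2 z1 - w1 z1) by (apply N; lra). lra.
    + replace ((- z) ^ 2) with (z ^ 2) by ring. lra.
  - destruct (zero_data_propagates _ _ _ _ _ _ _ _ R1' R2') with (p := - p0) as [E _].
    + rewrite !Ropp_involutive. exact Hz.
    + lra.
    + rewrite !Ropp_involutive in E. lra.
  - destruct (first_zero_of_difference _ _ _ _ _ _ _ _ R1' R2') as [z [Bz [Dz [Af Rz]]]].
    { rewrite !Ropp_involutive. lra. }
    simpl in Dz, Af, Rz. apply (Fin (- z)).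
    + split; [|lra]. destruct (Rle_lt_dec z1 (- z)) as [|G]; [assumption|exfalso].
      assert (N := Af (- z1)). rewrite Ropp_involutive in N.
      assert (0 < w1 z1 - w2 z1) by (apply N; lra). lra.
    + replace ((- z) ^ 2) with (z ^ 2) by ring. lra.
Qed.

Lemma robin_solution_unique (w1 x1 w2 x2 : R -> R) :
  robin_solution a p0 p1 T w1 x1 -> robin_solution a p0 p1 T w2 x2 ->
  forall p, p0 <= p <= p1 -> w1 p = w2 p /\ x1 p = x2 p.
Proof.
  intros H1 H2 p Hp.
  assert (N1 := robin_difference_pos_absurd _ _ _ _ H1 H2).
  assert (N2 := robin_difference_pos_absurd _ _ _ _ H2 H1).
  assert (Z : w1 p0 - w2 p0 = 0) by lra.
  destruct (zero_data_propagates _ _ _ _ _ _ _ _ H1 H2 Z p Hp) as [E1 E2]. lra.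
Qed.

End Uniqueness.

(** * Shooting *)

Lemma RInt_derive_continuous (f : R -> R) (l x : R) :
  (forall y, continuity_pt f y) -> is_derive (fun y => RInt f l y) x (f x).
Proof.
  intro Cf. apply is_derive_RInt with l.
  - apply filter_forall. intro y. apply is_RInt_RInt.
    apply (ex_RInt_continuous f). intros z _. now apply continuity_pt_continuous.
  - now apply continuity_pt_continuous.
Qed.

(** Integrating the weight [exp (N (y - l))] gains a factor [1 / N]; this gain makes the shooting
    map a contraction on an interval of any length. *)
Lemma RInt_exp_bound (f : R -> R) (l r C N : R) :
  l <= r -> 0 < N -> 0 <= C -> (forall y, continuity_pt f y) ->
  (forall y, l <= y <= r -> Rabs (f y) <= C * exp (N * (y - l))) ->
  Rabs (RInt f l r) <= C / N * exp (N * (r - l)).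
Proof.
  intros Hlr HN HC Cf Hf.
  assert (De : forall y, is_derive (fun y => C / N * exp (N * (y - l))) y (C * exp (N * (y - l)))).
  { intro y. auto_derive; [trivial|]. unfold Rminus. field. lra. }
  assert (P : 0 <= C / N) by (apply Rmult_le_pos; [exact HC|apply Rlt_le, Rinv_0_lt_compat, HN]).
  assert (Gen : forall g : R -> R, (forall y, continuity_pt g y) ->
    (forall y, l <= y <= r -> g y <= C * exp (N * (y - l))) ->
    RInt g l r <= C / N * exp (N * (r - l))).
  { intros g Cg Hg.
    assert (Q : C / N * exp (N * (l - l)) - RInt g l l <= C / N * exp (N * (r - l)) - RInt g l r).
    { apply (derivative_nonneg_le (fun y => C / N * exp (N * (y - l)) - RInt g l y)
        (fun y => C * exp (N * (y - l)) - g y)).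
      - exact Hlr.
      - intros y _. apply @is_derive_minus; [apply De|now apply RInt_derive_continuous].
      - intros y _. apply continuity_pt_minus.
        + apply is_derive_continuity_pt with (1 := De y).
        + apply is_derive_continuity_pt with (g y). now apply RInt_derive_continuous.
      - intros y Hy. assert (g y <= C * exp (N * (y - l))) by (apply Hg; lra). lra. }
    rewrite RInt_point in Q. change (@zero _) with 0 in Q.
    rewrite Rminus_diag, Rmult_0_r, exp_0 in Q. lra. }
  apply Rabs_le. split.
  - enough (- RInt f l r <= C / N * exp (N * (r - l))) by lra.
    assert (E : RInt (fun y => opp (f y)) l r = - RInt f l r).
    { apply (RInt_opp f). apply continuity_pt_ex_RInt; [exact Hlr|]. intros y _. apply Cf. }
    rewrite <- E. apply Gen.
    + intro y. apply continuity_pt_opp. apply Cf.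
    + intros y Hy. assert (Q := Hf y Hy). apply Rabs_le_between in Q. unfold opp; simpl. lra.
  - apply Gen; [exact Cf|]. intros y Hy. assert (Q := Hf y Hy). apply Rabs_le_between in Q. lra.
Qed.

Lemma continuity_pt_uniform_limit (f : nat -> R -> R) (g : R -> R) :
  (forall n x, continuity_pt (f n) x) ->
  (forall eps, 0 < eps -> exists n, forall x, Rabs (f n x - g x) <= eps) ->
  forall x, continuity_pt g x.
Proof.
  intros Cf Hu x. apply continuity_pt_locally. intro eps. assert (Pe := cond_pos eps).
  destruct (Hu (eps / 4)) as [n Hn]; [lra|].
  assert (He : 0 < eps / 4) by lra.
  destruct (proj1 (continuity_pt_locally (f n) x) (Cf n x) (mkposreal _ He)) as [d Hd].
  exists d. intros y Hy. specialize (Hd y Hy). simpl in Hd.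
  assert (A := Hn x). assert (B := Hn y).
  apply Rabs_def2 in Hd. apply Rabs_le_between in A, B. apply Rabs_def1; lra.
Qed.

Section Shooting.

Variables (a : R -> R) (p0 p1 T M : R).
Hypothesis Hsl : - T < p0 /\ p0 < p1 /\ p1 < T.
Hypothesis Ha : forall p, 0 < a p.
Hypothesis Ca : forall p, continuity_pt a p.
Hypothesis HM : 0 < M.

Let pc := clamp p0 p1.
(** With [z = 1] at [p0], the Robin condition there forces the initial slope [s0]; [m] is the value
    at [p1] of the line with these data. *)
Let s0 := - / (T - p0).
Let m := (T - p1) / (T - p0).

(* [z'' = mu a / z], [z(p0) = 1], [z'(p0) = s0]; by convexity [z] stays above its initial
   tangent, hence above [m], so that the truncation [Rmax z m] is harmless. *)
Definition shoot_slope (mu : R) (z : R -> R) (p : R) : R :=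
  s0 + mu * RInt (fun q => a q / Rmax (z q) m) p0 p.

(** The upper limit is clamped, so every iterate is constant on each side of the interval of slopes
    and the estimates hold on the whole line. *)
Definition shoot_map (mu : R) (z : R -> R) (p : R) : R :=
  1 + RInt (shoot_slope mu z) p0 (pc p).

Lemma m_pos : 0 < m.
Proof. apply Rdiv_lt_0_compat; lra. Qed.

Lemma truncated_continuity (z : R -> R) : (forall p, continuity_pt z p) ->
  forall p, continuity_pt (fun q => a q / Rmax (z q) m) p.
Proof.
  intros Cz p. assert (Pm := m_pos). apply continuity_pt_div.
  - apply Ca.
  - apply continuity_pt_locally. intro eps.
    destruct (proj1 (continuity_pt_locally z p) (Cz p) eps) as [d Hd].
    exists d. intros q Hq. specialize (Hd q Hq).
    apply Rle_lt_trans with (2 := Hd). unfold Rmax, Rabs.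
    repeat destruct Rle_dec; repeat destruct Rcase_abs; lra.
  - apply Rgt_not_eq. apply Rlt_le_trans with (1 := Pm). apply Rmax_r.
Qed.

Lemma shoot_slope_derive (mu : R) (z : R -> R) : (forall p, continuity_pt z p) ->
  forall p, is_derive (shoot_slope mu z) p (mu * (a p / Rmax (z p) m)).
Proof.
  intros Cz p. unfold shoot_slope.
  rewrite <- (Rplus_0_l (mu * (a p / Rmax (z p) m))).
  apply (is_derive_plus (fun _ => s0) (fun p => mu * RInt (fun q => a q / Rmax (z q) m) p0 p)).
  - apply @is_derive_const.
  - apply @is_derive_scal. apply (RInt_derive_continuous (fun q => a q / Rmax (z q) m)).
    now apply truncated_continuity.
Qed.

Lemma shoot_slope_continuity (mu : R) (z : R -> R) : (forall p, continuity_pt z p) ->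
  forall p, continuity_pt (shoot_slope mu z) p.
Proof.
  intros Cz p. eapply is_derive_continuity_pt. now apply shoot_slope_derive.
Qed.

Lemma shoot_map_continuity (mu : R) (z : R -> R) : (forall p, continuity_pt z p) ->
  forall p, continuity_pt (shoot_map mu z) p.
Proof.
  intros Cz p. unfold shoot_map. apply continuity_pt_plus.
  - apply continuity_pt_cst.
  - apply (continuity_pt_comp pc (fun y => RInt (shoot_slope mu z) p0 y)).
    + apply (clamp_continuity (fun _ => p0) (fun _ => p1) (fun q => q)).
      * apply continuity_pt_cst.
      * apply continuity_pt_cst.
      * apply continuity_pt_id.
    + eapply is_derive_continuity_pt. apply RInt_derive_continuous.
      now apply shoot_slope_continuity.
Qed.

(** * Contraction in a weighted norm, and dependence on the parameter *)

Variable A : R.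
Hypothesis HA : 0 < A /\ forall p, p0 <= p <= p1 -> a p <= A.

Lemma truncated_lipschitz (p y z : R) : p0 <= p <= p1 ->
  Rabs (a p / Rmax y m - a p / Rmax z m) <= A / m ^ 2 * Rabs (y - z).
Proof.
  intros Hp. assert (Pm := m_pos). destruct HA as [PA BA]. specialize (BA p Hp).
  assert (Pa := Ha p).
  assert (Y := Rmax_r y m). assert (Z := Rmax_r z m).
  set (Y' := Rmax y m) in *. set (Z' := Rmax z m) in *.
  assert (D : Rabs (Z' - Y') <= Rabs (y - z)).
  { unfold Y', Z', Rmax, Rabs. repeat destruct Rle_dec; repeat destruct Rcase_abs; lra. }
  replace (a p / Y' - a p / Z') with (a p / (Y' * Z') * (Z' - Y')) by (field; lra).
  rewrite Rabs_mult. apply Rmult_le_compat; try apply Rabs_pos; [|exact D].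
  assert (Pyz : 0 < Y' * Z') by (apply Rmult_lt_0_compat; lra).
  assert (Pm2 : 0 < m ^ 2) by (now apply pow_lt).
  rewrite Rabs_right by (apply Rle_ge, Rlt_le, Rdiv_lt_0_compat; lra).
  apply Rmult_le_compat; [lra|apply Rlt_le, Rinv_0_lt_compat; lra|lra|].
  apply Rinv_le_contravar; [lra|]. simpl. rewrite Rmult_1_r. apply Rmult_le_compat; lra.
Qed.

(** [K0] is a Lipschitz constant and [K1] a bound for [z -> a / Rmax z m]. [N] is large enough for
    [M K0 / N <= 1 / 2] and [1 / N <= 1]. *)
Let K0 := A / m ^ 2.
Let K1 := A / m.
Let N := 1 + 2 * (M * K0).
Let ex (p : R) : R := exp (N * (p - p0)).

Lemma shoot_constants : 0 < K0 /\ 0 < K1 /\ 1 < N /\ 0 < M * K0.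
Proof.
  assert (Pm := m_pos). destruct HA as [PA _].
  assert (0 < K0). { apply Rdiv_lt_0_compat; [lra|]. now apply pow_lt. }
  assert (0 < K1) by (apply Rdiv_lt_0_compat; lra).
  assert (0 < M * K0) by (apply Rmult_lt_0_compat; lra).
  unfold N. repeat split; lra.
Qed.

Lemma shoot_slope_difference (mu nu : R) (y z : R -> R) (C p : R) :
  0 <= mu <= M -> (forall p, continuity_pt y p) -> (forall p, continuity_pt z p) -> 0 <= C ->
  (forall q, p0 <= q <= p1 -> Rabs (y q - z q) <= C * ex q) -> p0 <= p <= p1 ->
  Rabs (shoot_slope mu y p - shoot_slope nu z p) <=
  (M * K0 * C + Rabs (mu - nu) * K1) / N * ex p.
Proof.
  intros Hmu Cy Cz HC Hyz Hp. destruct shoot_constants as [PK0 [PK1 [PN PMK]]].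
  assert (Pm := m_pos).
  set (f := fun q => mu * (a q / Rmax (y q) m) - nu * (a q / Rmax (z q) m)).
  assert (Cf : forall q, continuity_pt f q).
  { intro q. unfold f. apply continuity_pt_minus; apply continuity_pt_mult;
      try (apply continuity_pt_cst); now apply truncated_continuity. }
  assert (Ex : forall y : R -> R, (forall p, continuity_pt y p) ->
    is_RInt (fun q => a q / Rmax (y q) m) p0 p (RInt (fun q => a q / Rmax (y q) m) p0 p)).
  { intros z' Cz'. apply is_RInt_RInt. apply continuity_pt_ex_RInt; [lra|]. intros q _.
    now apply truncated_continuity. }
  assert (E : shoot_slope mu y p - shoot_slope nu z p = RInt f p0 p).
  { symmetry. apply is_RInt_unique.
    assert (Q := is_RInt_minus _ _ _ _ _ _ (is_RInt_scal _ _ _ mu _ (Ex y Cy))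
      (is_RInt_scal _ _ _ nu _ (Ex z Cz))).
    unfold shoot_slope.
    replace (s0 + mu * RInt (fun q => a q / Rmax (y q) m) p0 p -
      (s0 + nu * RInt (fun q => a q / Rmax (z q) m) p0 p)) with
      (minus (scal mu (RInt (fun q => a q / Rmax (y q) m) p0 p))
        (scal nu (RInt (fun q => a q / Rmax (z q) m) p0 p))).
    - exact Q.
    - unfold minus, plus, opp, scal; simpl; unfold mult; simpl. ring. }
  rewrite E. apply RInt_exp_bound; [lra|lra| |exact Cf|].
  { apply Rplus_le_le_0_compat; apply Rmult_le_pos; try lra. apply Rabs_pos. }
  intros q Hq. fold (ex q).
  assert (Q1 : p0 <= q <= p1) by lra.
  assert (Eq1 : 1 <= ex q).
  { unfold ex. apply Rle_trans with (1 + N * (q - p0)).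
    - assert (0 <= N * (q - p0)) by (apply Rmult_le_pos; lra). lra.
    - apply exp_ineq1_le. }
  replace (f q) with (mu * (a q / Rmax (y q) m - a q / Rmax (z q) m) +
    (mu - nu) * (a q / Rmax (z q) m)) by (unfold f; ring).
  apply Rle_trans with (1 := Rabs_triang _ _).
  rewrite Rmult_plus_distr_r. apply Rplus_le_compat.
  - rewrite Rabs_mult, (Rabs_right mu) by lra.
    apply Rle_trans with (M * (K0 * (C * ex q))); [|apply Req_le; ring].
    apply Rmult_le_compat; [lra|apply Rabs_pos|lra|].
    apply Rle_trans with (1 := truncated_lipschitz q (y q) (z q) Q1).
    apply Rmult_le_compat_l; [fold K0; lra|]. now apply Hyz.
  - rewrite Rabs_mult, Rmult_assoc. apply Rmult_le_compat_l; [apply Rabs_pos|].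
    destruct HA as [PA BA]. specialize (BA q Q1). assert (Pa := Ha q).
    assert (Zm := Rmax_r (z q) m).
    rewrite Rabs_right by (apply Rle_ge, Rlt_le, Rdiv_lt_0_compat; lra).
    apply Rle_trans with K1.
    + unfold K1. apply Rmult_le_compat; [lra|apply Rlt_le, Rinv_0_lt_compat; lra|lra|].
      apply Rinv_le_contravar; lra.
    + rewrite <- (Rmult_1_r K1) at 1. apply Rmult_le_compat_l; lra.
Qed.

Lemma pc_in (p : R) : p0 <= pc p <= p1.
Proof. apply clamp_bounds. lra. Qed.

Lemma pc_of (p : R) : p0 <= p <= p1 -> pc p = p.
Proof. intro H. now apply clamp_id. Qed.

(** The integration that yields the slope gains [1 / N], hence the factor [1 / 2]; the one that
    yields [z] costs nothing because [N > 1]. For [mu = nu] this is the contraction, otherwise it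
    measures the dependence on the parameter. *)
Lemma shoot_map_difference (mu nu : R) (y z : R -> R) (C p : R) :
  0 <= mu <= M -> (forall p, continuity_pt y p) -> (forall p, continuity_pt z p) -> 0 <= C ->
  (forall q, Rabs (y q - z q) <= C * ex (pc q)) ->
  Rabs (shoot_map mu y p - shoot_map nu z p) <= (C / 2 + Rabs (mu - nu) * K1) * ex (pc p).
Proof.
  intros Hmu Cy Cz HC Hyz. destruct shoot_constants as [PK0 [PK1 [PN PMK]]].
  assert (Hp := pc_in p).
  set (f := fun q => shoot_slope mu y q - shoot_slope nu z q).
  assert (E : shoot_map mu y p - shoot_map nu z p = RInt f p0 (pc p)).
  { unfold shoot_map.
    assert (R1 : RInt f p0 (pc p) = RInt (shoot_slope mu y) p0 (pc p) -
      RInt (shoot_slope nu z) p0 (pc p)).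
    { apply (RInt_minus (shoot_slope mu y) (shoot_slope nu z));
        (apply continuity_pt_ex_RInt; [lra|]; intros q _; now apply shoot_slope_continuity). }
    rewrite R1. ring. }
  assert (PD := Rabs_pos (mu - nu)).
  assert (PC : 0 <= M * K0 * C + Rabs (mu - nu) * K1).
  { apply Rplus_le_le_0_compat; apply Rmult_le_pos; lra. }
  rewrite E.
  assert (B : Rabs (RInt f p0 (pc p)) <=
    (M * K0 * C + Rabs (mu - nu) * K1) / N / N * ex (pc p)).
  { apply RInt_exp_bound; [lra|lra| | |].
    - apply Rdiv_le_0_compat; lra.
    - intro q. apply continuity_pt_minus; now apply shoot_slope_continuity.
    - intros q Hq. apply shoot_slope_difference; try assumption; [|lra].
      intros r Hr. rewrite <- (pc_of r Hr) at 3. apply Hyz. }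
  apply Rle_trans with (1 := B). apply Rmult_le_compat_r; [apply Rlt_le, exp_pos|].
  assert (B1 : (M * K0 * C + Rabs (mu - nu) * K1) / N <= C / 2 + Rabs (mu - nu) * K1).
  { apply Rmult_le_reg_r with N; [lra|]. unfold Rdiv at 1. rewrite Rmult_assoc, Rinv_l by lra.
    assert (0 <= Rabs (mu - nu) * K1 * (N - 1)) by (apply Rmult_le_pos; [apply Rmult_le_pos|]; lra).
    assert (EN : C / 2 * N = C / 2 + M * K0 * C) by (unfold N; field). lra. }
  apply Rle_trans with (2 := B1).
  apply Rmult_le_reg_r with N; [lra|]. unfold Rdiv at 1. rewrite Rmult_assoc, Rinv_l by lra.
  assert (0 <= (M * K0 * C + Rabs (mu - nu) * K1) / N) by (apply Rdiv_le_0_compat; lra).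
  rewrite Rmult_1_r. rewrite <- (Rmult_1_r (_ / N)) at 1. apply Rmult_le_compat_l; lra.
Qed.

Fixpoint shoot_iter (mu : R) (n : nat) : R -> R :=
  match n with
  | O => fun _ => 1
  | S k => shoot_map mu (shoot_iter mu k)
  end.

Lemma shoot_iter_continuity (mu : R) (n : nat) (p : R) : continuity_pt (shoot_iter mu n) p.
Proof.
  revert p. induction n as [|n IH]; intro p; simpl.
  - apply continuity_pt_cst.
  - now apply shoot_map_continuity.
Qed.

(** [2 |mu - nu| K1] is the fixed point of [r -> r / 2 + |mu - nu| K1], so the bound is uniform in
    [n] and passes to the limit. *)
Lemma shoot_iter_lipschitz (mu nu : R) (n : nat) (p : R) : 0 <= mu <= M ->
  Rabs (shoot_iter mu n p - shoot_iter nu n p) <= 2 * (Rabs (mu - nu) * K1) * ex (pc p).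
Proof.
  intro Hmu. destruct shoot_constants as [PK0 [PK1 [PN PMK]]].
  assert (PD := Rabs_pos (mu - nu)).
  assert (PC : 0 <= Rabs (mu - nu) * K1) by (apply Rmult_le_pos; lra).
  revert p. induction n as [|n IH]; intro p; simpl.
  - rewrite Rminus_diag, Rabs_R0. apply Rmult_le_pos; [lra|apply Rlt_le, exp_pos].
  - replace (2 * (Rabs (mu - nu) * K1)) with
      (2 * (Rabs (mu - nu) * K1) / 2 + Rabs (mu - nu) * K1) by field.
    apply shoot_map_difference; try assumption; try lra; intro; apply shoot_iter_continuity.
Qed.

Lemma shoot_iter_cauchy (mu : R) : 0 <= mu <= M ->
  exists C, 0 <= C /\ forall n p, Rabs (shoot_iter mu (S n) p - shoot_iter mu n p) <=
    C * (1 / 2) ^ n * ex (pc p).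
Proof.
  intro Hmu. destruct shoot_constants as [PK0 [PK1 [PN PMK]]].
  destruct (continuity_ab_maj (fun p => Rabs (shoot_map mu (fun _ => 1) p - 1)) p0 p1)
    as [c [Hc Ic]]; [lra| |].
  { intros q _. apply (continuity_pt_comp (fun p => shoot_map mu (fun _ => 1) p - 1) Rabs).
    - apply continuity_pt_minus; [|apply continuity_pt_cst].
      apply shoot_map_continuity. intro. apply continuity_pt_cst.
    - apply Rcontinuity_abs. }
  set (C := Rabs (shoot_map mu (fun _ => 1) c - 1)) in *.
  assert (PC : 0 <= C) by apply Rabs_pos.
  exists C. split; [exact PC|].
  induction n as [|n IH]; intro p.
  - simpl. rewrite Rmult_1_r.
    assert (E : shoot_map mu (fun _ => 1) p = shoot_map mu (fun _ => 1) (pc p)).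
    { unfold shoot_map. now rewrite (pc_of (pc p)) by apply pc_in. }
    assert (Hp := pc_in p). rewrite E. apply Rle_trans with C; [now apply Hc|].
    rewrite <- (Rmult_1_r C) at 1. apply Rmult_le_compat_l; [exact PC|].
    unfold ex. apply Rle_trans with (1 + N * (pc p - p0)); [|apply exp_ineq1_le].
    assert (0 <= N * (pc p - p0)) by (apply Rmult_le_pos; lra). lra.
  - assert (P2 : 0 <= C * (1 / 2) ^ n).
    { apply Rmult_le_pos; [exact PC|]. apply pow_le. lra. }
    replace (C * (1 / 2) ^ S n) with (C * (1 / 2) ^ n / 2 + Rabs (mu - mu) * K1)
      by (rewrite Rminus_diag, Rabs_R0; simpl; field).
    apply (shoot_map_difference mu mu (shoot_iter mu (S n)) (shoot_iter mu n)); try assumption;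
      intro; apply shoot_iter_continuity.
Qed.

Let B := exp (N * (p1 - p0)).

Lemma ex_bound (p : R) : 0 < ex (pc p) <= B.
Proof.
  destruct shoot_constants as [PK0 [PK1 [PN PMK]]]. assert (Hp := pc_in p).
  split; [apply exp_pos|]. unfold ex, B.
  destruct (Rle_lt_or_eq_dec (pc p) p1 (proj2 Hp)) as [Hl|He].
  - apply Rlt_le, exp_increasing. apply Rmult_lt_compat_l; lra.
  - rewrite He. lra.
Qed.

Lemma shoot_fixpoint (mu : R) : 0 <= mu <= M ->
  exists z, (forall p, continuity_pt z p) /\ (forall p, z p = shoot_map mu z p) /\
    forall p, Un_cv (fun n => shoot_iter mu n p) (z p).
Proof.
  intro Hmu. destruct shoot_constants as [PK0 [PK1 [PN PMK]]].
  destruct (shoot_iter_cauchy mu Hmu) as [C [PC HC]].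
  assert (PB : 0 < B) by apply exp_pos.
  assert (Step : forall n k p, Rabs (shoot_iter mu (n + k) p - shoot_iter mu n p) <=
    2 * C * B * (1 / 2) ^ n).
  { intros n k p.
    (* Keeping the tail [(1 / 2) ^ (n + k)] of the geometric sum in the bound is what closes the
       induction on [k]. *)
    enough (Q : Rabs (shoot_iter mu (n + k) p - shoot_iter mu n p) <=
      2 * C * B * ((1 / 2) ^ n - (1 / 2) ^ (n + k))).
    { apply Rle_trans with (1 := Q). apply Rmult_le_compat_l.
      - apply Rmult_le_pos; lra.
      - assert (0 <= (1 / 2) ^ (n + k)) by (apply pow_le; lra). lra. }
    induction k as [|k IH].
    - rewrite Nat.add_0_r, !Rminus_diag, Rabs_R0. lra.
    - rewrite Nat.add_succ_r.
      replace (shoot_iter mu (S (n + k)) p - shoot_iter mu n p) with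
        ((shoot_iter mu (S (n + k)) p - shoot_iter mu (n + k) p) +
         (shoot_iter mu (n + k) p - shoot_iter mu n p)) by ring.
      apply Rle_trans with (1 := Rabs_triang _ _).
      assert (H1 := HC (n + k)%nat p). destruct (ex_bound p) as [E1 E2].
      assert (P2 : 0 <= C * (1 / 2) ^ (n + k)).
      { apply Rmult_le_pos; [exact PC|]. apply pow_le. lra. }
      assert (H2 : C * (1 / 2) ^ (n + k) * ex (pc p) <= C * (1 / 2) ^ (n + k) * B)
        by (apply Rmult_le_compat_l; lra).
      change ((1 / 2) ^ S (n + k)) with (1 / 2 * (1 / 2) ^ (n + k)). lra. }
  assert (Small : forall eps, 0 < eps -> exists n, 2 * C * B * (1 / 2) ^ n < eps).
  { intros eps Heps.
    assert (Q : 0 < eps / (2 * C * B + 1)).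
    { apply Rdiv_lt_0_compat; [exact Heps|]. assert (0 <= 2 * C * B) by (apply Rmult_le_pos; lra). lra. }
    destruct (pow_lt_1_zero (1 / 2)) with (y := eps / (2 * C * B + 1)) as [n Hn].
    - rewrite Rabs_right; lra.
    - exact Q.
    - exists n. specialize (Hn n (Nat.le_refl n)).
      assert (P2 : 0 < (1 / 2) ^ n) by (apply pow_lt; lra).
      rewrite Rabs_right in Hn by lra.
      assert (P3 : 0 <= 2 * C * B) by (apply Rmult_le_pos; lra).
      apply Rle_lt_trans with ((2 * C * B + 1) * (1 / 2) ^ n).
      + apply Rmult_le_compat_r; lra.
      + apply Rmult_lt_compat_l with (r := 2 * C * B + 1) in Hn; [|lra].
        replace ((2 * C * B + 1) * (eps / (2 * C * B + 1))) with eps in Hn by (field; lra).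
        exact Hn. }
  assert (Cau : forall p, Cauchy_crit (fun n => shoot_iter mu n p)).
  { intros p eps Heps. destruct (Small (eps / 2)) as [n0 Hn0]; [lra|].
    exists n0. intros i j Hi Hj. unfold Rdist.
    assert (Si := Step n0 (i - n0)%nat p). assert (Sj := Step n0 (j - n0)%nat p).
    replace (n0 + (i - n0))%nat with i in Si by lia.
    replace (n0 + (j - n0))%nat with j in Sj by lia.
    apply Rabs_le_between in Si, Sj. apply Rabs_def1; lra. }
  set (z := fun p => proj1_sig (Rcomplete.R_complete _ (Cau p))).
  assert (Lim : forall p, Un_cv (fun n => shoot_iter mu n p) (z p)).
  { intro p. exact (proj2_sig (Rcomplete.R_complete _ (Cau p))). }
  assert (Uni : forall n p, Rabs (shoot_iter mu n p - z p) <= 2 * C * B * (1 / 2) ^ n).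
  { intros n p. apply Rle_plus_epsilon. intros e He.
    destruct (Lim p e He) as [n1 Hn1].
    assert (Q := Hn1 (n + n1)%nat). unfold Rdist in Q.
    assert (Q' : Rabs (shoot_iter mu (n + n1) p - z p) < e) by (apply Q; lia).
    assert (Sn := Step n n1 p).
    apply Rabs_def2 in Q'. apply Rabs_le_between in Sn. apply Rabs_le. lra. }
  assert (Cz : forall p, continuity_pt z p).
  { apply (continuity_pt_uniform_limit (shoot_iter mu)).
    - intros n p. apply shoot_iter_continuity.
    - intros eps Heps. destruct (Small eps Heps) as [n Hn]. exists n. intro p.
      apply Rle_trans with (1 := Uni n p). lra. }
  exists z. split; [exact Cz|]. split; [|exact Lim].
  intro p. apply cond_eq. intros eps Heps.
  destruct (Small (eps / (2 * B + 2))) as [n Hn].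
  { apply Rdiv_lt_0_compat; lra. }
  set (d := 2 * C * B * (1 / 2) ^ n) in *.
  assert (Pd : 0 <= d).
  { apply Rmult_le_pos; [apply Rmult_le_pos; lra|]. apply pow_le; lra. }
  assert (D1 : Rabs (shoot_map mu (shoot_iter mu n) p - shoot_map mu z p) <=
    (d / 2 + Rabs (mu - mu) * K1) * ex (pc p)).
  { apply shoot_map_difference; try assumption.
    - intro. apply shoot_iter_continuity.
    - intro q. apply Rle_trans with (1 := Uni n q). fold d.
      rewrite <- (Rmult_1_r d) at 1. apply Rmult_le_compat_l; [exact Pd|].
      assert (Hq := pc_in q).
      unfold ex. apply Rle_trans with (1 + N * (pc q - p0)); [|apply exp_ineq1_le].
      assert (0 <= N * (pc q - p0)) by (apply Rmult_le_pos; lra). lra. }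
  rewrite Rminus_diag, Rabs_R0, Rmult_0_l, Rplus_0_r in D1.
  destruct (ex_bound p) as [E1 E2].
  assert (D3 : d / 2 * ex (pc p) <= d / 2 * B) by (apply Rmult_le_compat_l; lra).
  assert (D2 := Uni (S n) p).
  change (shoot_iter mu (S n) p) with (shoot_map mu (shoot_iter mu n) p) in D2.
  assert (D4 : 2 * C * B * (1 / 2) ^ S n <= d).
  { unfold d. simpl. assert (0 <= 2 * C * B * (1 / 2) ^ n) by exact Pd. lra. }
  assert (D5 : d * (2 * B + 2) < eps).
  { apply Rmult_lt_compat_r with (r := 2 * B + 2) in Hn; [|lra].
    replace (eps / (2 * B + 2) * (2 * B + 2)) with eps in Hn by (field; lra). exact Hn. }
  assert (0 <= d * B) by (apply Rmult_le_pos; lra).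
  apply Rabs_le_between in D1, D2. apply Rabs_def1; lra.
Qed.

(** [Z] has to be one function of the parameter, so it is the limit of the explicit iterates at the
    clamped parameter, instead of a choice of one fixed point for each [mu]. *)
Lemma shoot_family : exists Z : R -> R -> R,
  (forall mu, 0 <= mu <= M -> forall p, continuity_pt (Z mu) p) /\
  (forall mu, 0 <= mu <= M -> forall p, Z mu p = shoot_map mu (Z mu) p) /\
  (forall mu nu p, 0 <= mu <= M -> 0 <= nu <= M ->
     Rabs (Z mu p - Z nu p) <= 2 * (Rabs (mu - nu) * K1) * ex (pc p)).
Proof.
  set (mc := clamp 0 M).
  assert (Bm : forall mu, 0 <= mc mu <= M) by (intro; apply clamp_bounds; lra).
  assert (Cau : forall mu p, {l : R | Un_cv (fun n => shoot_iter (mc mu) n p) l}).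
  { intros mu p. apply Rcomplete.R_complete.
    destruct (shoot_fixpoint (mc mu) (Bm mu)) as [z [_ [_ Hz]]].
    apply CV_Cauchy. exists (z p). apply Hz. }
  set (Z := fun mu p => proj1_sig (Cau mu p)).
  assert (Lim : forall mu p, Un_cv (fun n => shoot_iter (mc mu) n p) (Z mu p)).
  { intros mu p. exact (proj2_sig (Cau mu p)). }
  assert (Fix : forall mu, exists z, (forall p, continuity_pt z p) /\
    (forall p, z p = shoot_map (mc mu) z p) /\ forall p, z p = Z mu p).
  { intro mu. destruct (shoot_fixpoint (mc mu) (Bm mu)) as [z [Cz [Ez Lz]]].
    exists z. split; [exact Cz|]. split; [exact Ez|]. intro p.
    now apply UL_sequence with (fun n => shoot_iter (mc mu) n p). }
  assert (Cid : forall mu, 0 <= mu <= M -> mc mu = mu) by (intros; now apply clamp_id).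
  assert (CZ : forall mu, 0 <= mu <= M -> forall p, continuity_pt (Z mu) p).
  { intros mu Hmu p. destruct (Fix mu) as [z [Cz [_ E]]].
    apply continuity_pt_ext with (1 := E). apply Cz. }
  exists Z. split; [exact CZ|]. split.
  - intros mu Hmu p. destruct (Fix mu) as [z [Cz [Fz E]]]. rewrite (Cid mu Hmu) in Fz.
    rewrite <- E, Fz. unfold shoot_map. f_equal. apply RInt_eq. intro q.
    unfold shoot_slope. f_equal. f_equal. apply RInt_eq. intro r. now rewrite E.
  - intros mu nu p Hmu Hnu. apply Rle_plus_epsilon. intros e He.
    destruct (Lim mu p (e / 2)) as [n1 H1]; [lra|]. destruct (Lim nu p (e / 2)) as [n2 H2]; [lra|].
    specialize (H1 (n1 + n2)%nat). specialize (H2 (n1 + n2)%nat). unfold Rdist in H1, H2.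
    rewrite (Cid mu Hmu) in H1. rewrite (Cid nu Hnu) in H2.
    assert (H1' : Rabs (shoot_iter mu (n1 + n2) p - Z mu p) < e / 2) by (apply H1; lia).
    assert (H2' : Rabs (shoot_iter nu (n1 + n2) p - Z nu p) < e / 2) by (apply H2; lia).
    assert (H3 := shoot_iter_lipschitz mu nu (n1 + n2) p Hmu).
    apply Rabs_def2 in H1', H2'. apply Rabs_le_between in H3. apply Rabs_le. lra.
Qed.

(* The root in [mu] of this function gives the Robin condition at [p1]. *)
Let defect (Z : R -> R -> R) (mu : R) : R := (T + p1) * shoot_slope mu (Z mu) p1 - Z mu p1.

(** Both terms of the defect are Lipschitz in the parameter on [[0, M]]; clamping extends this to
    the whole line, as the intermediate value theorem requires. *)
Lemma defect_continuity (Z : R -> R -> R) :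
  (forall mu, 0 <= mu <= M -> forall p, continuity_pt (Z mu) p) ->
  (forall mu nu p, 0 <= mu <= M -> 0 <= nu <= M ->
     Rabs (Z mu p - Z nu p) <= 2 * (Rabs (mu - nu) * K1) * ex (pc p)) ->
  forall mu, continuity_pt (fun mu => defect Z (clamp 0 M mu)) mu.
Proof.
  intros CZ LZ mu. destruct shoot_constants as [PK0 [PK1 [PN PMK]]].
  assert (PB : 0 < B) by apply exp_pos.
  assert (Bm : forall mu, 0 <= clamp 0 M mu <= M) by (intro; apply clamp_bounds; lra).
  set (L1 := (M * K0 * (2 * K1) + K1) / N * B).
  assert (PL1 : 0 < L1).
  { unfold L1. apply Rmult_lt_0_compat; [|exact PB]. apply Rdiv_lt_0_compat; [|lra].
    assert (0 < M * K0 * (2 * K1)) by (apply Rmult_lt_0_compat; lra). lra. }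
  set (L := (T + p1) * L1 + 2 * K1 * B).
  assert (PL : 0 < L).
  { assert (0 < (T + p1) * L1) by (apply Rmult_lt_0_compat; lra).
    assert (0 < 2 * K1 * B) by (apply Rmult_lt_0_compat; lra). unfold L. lra. }
  assert (Eb : ex (pc p1) = B). { unfold ex, B. now rewrite pc_of by lra. }
  assert (Lip : forall mu nu, 0 <= mu <= M -> 0 <= nu <= M ->
    Rabs (defect Z mu - defect Z nu) <= L * Rabs (mu - nu)).
  { intros x y Hx Hy.
    assert (D1 : Rabs (shoot_slope x (Z x) p1 - shoot_slope y (Z y) p1) <= L1 * Rabs (x - y)).
    { apply Rle_trans with ((M * K0 * (2 * (Rabs (x - y) * K1)) + Rabs (x - y) * K1) / N * ex p1).
      - apply shoot_slope_difference; try assumption; try (now apply CZ).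
        + assert (P := Rabs_pos (x - y)).
          assert (0 <= Rabs (x - y) * K1) by (apply Rmult_le_pos; lra). lra.
        + intros q Hq. rewrite <- (pc_of q Hq) at 3. now apply LZ.
        + lra.
      - apply Req_le. rewrite <- (pc_of p1) by lra. rewrite Eb. unfold L1. field. lra. }
    assert (D2 := LZ x y p1 Hx Hy). rewrite Eb in D2.
    unfold defect.
    replace ((T + p1) * shoot_slope x (Z x) p1 - Z x p1 -
      ((T + p1) * shoot_slope y (Z y) p1 - Z y p1)) with
      ((T + p1) * (shoot_slope x (Z x) p1 - shoot_slope y (Z y) p1) + - (Z x p1 - Z y p1)) by ring.
    apply Rle_trans with (1 := Rabs_triang _ _).
    rewrite Rabs_Ropp, Rabs_mult, (Rabs_right (T + p1)) by lra.
    apply Rmult_le_compat_l with (r := T + p1) in D1; [|lra]. unfold L. lra. }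
  apply continuity_pt_locally. intro eps.
  assert (Hd : 0 < eps / L) by (apply Rdiv_lt_0_compat; [apply cond_pos|exact PL]).
  exists (mkposreal _ Hd). intros nu Hnu. change (Rabs (nu - mu) < eps / L) in Hnu.
  apply Rle_lt_trans with (1 := Lip _ _ (Bm nu) (Bm mu)).
  assert (Q := clamp_lipschitz 0 M nu 0 M mu). rewrite !Rminus_diag, Rabs_R0, !Rplus_0_l in Q.
  apply Rle_lt_trans with (L * Rabs (nu - mu)); [apply Rmult_le_compat_l; lra|].
  apply Rmult_lt_compat_l with (r := L) in Hnu; [|exact PL].
  replace (L * (eps / L)) with (pos eps) in Hnu by (field; lra). exact Hnu.
Qed.

Lemma shoot_properties (mu : R) (z : R -> R) : 0 <= mu ->
  (forall p, continuity_pt z p) -> (forall p, z p = shoot_map mu z p) ->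
  (forall p, p0 <= p <= p1 -> m <= z p) /\
  (forall p, p0 < p < p1 -> is_derive z p (shoot_slope mu z p)) /\
  (forall p, p0 < p < p1 -> is_derive (shoot_slope mu z) p (mu * (a p / z p))) /\
  z p0 = 1 /\ shoot_slope mu z p0 = s0.
Proof.
  intros Hmu Cz Ez. assert (Pm := m_pos).
  assert (Z0 : z p0 = 1).
  { rewrite Ez. unfold shoot_map. rewrite pc_of by lra. rewrite RInt_point.
    change (@zero _) with 0. ring. }
  assert (V0 : shoot_slope mu z p0 = s0).
  { unfold shoot_slope. rewrite RInt_point. change (@zero _) with 0. ring. }
  assert (Dz : forall p, p0 < p < p1 -> is_derive z p (shoot_slope mu z p)).
  { intros p Hp. apply is_derive_ext_loc with (fun p => 1 + RInt (shoot_slope mu z) p0 p).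
    - generalize (locally_between p0 p1 p Hp). apply filter_imp. intros y Hy.
      rewrite (Ez y). unfold shoot_map. now rewrite pc_of by lra.
    - rewrite <- (Rplus_0_l (shoot_slope mu z p)).
      apply (is_derive_plus (fun _ => 1) (fun p => RInt (shoot_slope mu z) p0 p)).
      + apply @is_derive_const.
      + apply RInt_derive_continuous. now apply shoot_slope_continuity. }
  assert (Vge : forall p, p0 <= p <= p1 -> s0 <= shoot_slope mu z p).
  { intros p Hp. rewrite <- V0.
    apply (derivative_nonneg_le (shoot_slope mu z) (fun p => mu * (a p / Rmax (z p) m))).
    - lra.
    - intros q _. now apply shoot_slope_derive.
    - intros q _. now apply shoot_slope_continuity.
    - intros q _. apply Rmult_le_pos; [exact Hmu|]. apply Rlt_le, Rdiv_lt_0_compat; [apply Ha|].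
      apply Rlt_le_trans with (1 := Pm). apply Rmax_r. }
  assert (Zge : forall p, p0 <= p <= p1 -> m <= z p).
  { intros p Hp.
    assert (Q : z p0 - s0 * p0 <= z p - s0 * p).
    { apply (derivative_nonneg_le (fun p => z p - s0 * p) (fun p => shoot_slope mu z p - s0)).
      - lra.
      - intros q Hq. apply @is_derive_minus; [apply Dz; lra|].
        auto_derive; [trivial|ring].
      - intros q _. apply continuity_pt_minus; [apply Cz|].
        apply continuity_pt_mult; [apply continuity_pt_cst|].
        apply continuity_pt_id.
      - intros q Hq. assert (s0 <= shoot_slope mu z q) by (apply Vge; lra). lra. }
    rewrite Z0 in Q.
    assert (Em : m = 1 + s0 * (p1 - p0)) by (unfold m, s0; field; lra).
    assert (Ps0 : s0 < 0). { unfold s0. assert (0 < / (T - p0)) by (apply Rinv_0_lt_compat; lra). lra. }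
    assert (s0 * p1 <= s0 * p) by (apply Rmult_le_compat_neg_l; lra). lra. }
  split; [exact Zge|]. split; [exact Dz|]. split; [|split; assumption].
  intros p Hp. assert (Q := shoot_slope_derive mu z Cz p).
  rewrite Rmax_left in Q by (apply Zge; lra). exact Q.
Qed.

(* If the defect were nonpositive, [z / (T + p)] would be nonincreasing, so [z] would be bounded
   independently of [mu], and [z''] would be too large. *)
Lemma defect_pos (z : R -> R) (al : R) : 0 < al -> (forall p, p0 <= p <= p1 -> al <= a p) ->
  (forall p, continuity_pt z p) -> (forall p, z p = shoot_map M z p) ->
  2 * T / (T - p0) < M * ((T + p0) * al / (2 * T / (T + p0)) * (p1 - p0)) ->
  0 < (T + p1) * shoot_slope M z p1 - z p1.
Proof.
  intros Hal Bal Cz Ez Hbig. assert (Pm := m_pos).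
  destruct (shoot_properties M z) as [Zge [Dz [Dv [Z0 V0]]]]; [lra|exact Cz|exact Ez|].
  destruct (Rlt_le_dec 0 ((T + p1) * shoot_slope M z p1 - z p1)) as [|Hn]; [assumption|exfalso].
  set (v := shoot_slope M z) in *.
  set (F := fun p => (T + p) * v p - z p).
  assert (Com : forall x y : R, mult x y = mult y x) by (intros x y; apply Rmult_comm).
  assert (CF : forall p, continuity_pt F p).
  { intro p. apply continuity_pt_minus; [|apply Cz]. apply continuity_pt_mult.
    - apply continuity_pt_plus; [apply continuity_pt_cst|].
      apply continuity_pt_id.
    - now apply shoot_slope_continuity. }
  assert (DF : forall p, p0 < p < p1 -> is_derive F p ((T + p) * (M * (a p / z p)))).
  { intros p Hp. replace ((T + p) * (M * (a p / z p))) with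
      (1 * v p + (T + p) * (M * (a p / z p)) - v p) by ring.
    apply (is_derive_minus (fun p => (T + p) * v p) z); [|now apply Dz].
    apply (is_derive_mult (fun p => T + p) v); [|now apply Dv|exact Com].
    auto_derive; [trivial|ring]. }
  assert (Zpos : forall p, p0 <= p <= p1 -> 0 < z p).
  { intros p Hp. assert (Q := Zge p Hp). lra. }
  assert (Fneg : forall p, p0 <= p <= p1 -> F p <= 0).
  { intros p Hp. apply Rle_trans with (2 := Hn).
    change (F p <= F p1).
    apply (derivative_nonneg_le F (fun p => (T + p) * (M * (a p / z p)))).
    - lra.
    - intros q Hq. apply DF. lra.
    - intros q _. apply CF.
    - intros q Hq. apply Rmult_le_pos; [lra|]. apply Rmult_le_pos; [lra|].
      apply Rlt_le, Rdiv_lt_0_compat; [apply Ha|apply Zpos; lra]. }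
  (* Starting from [z p0 = 1], monotonicity gives [z p <= (T + p) / (T + p0)], and
     [T + p <= 2 T]. *)
  assert (Zle : forall p, p0 <= p <= p1 -> z p <= 2 * T / (T + p0)).
  { intros p Hp.
    assert (Q : - (z p0 / (T + p0)) <= - (z p / (T + p))).
    { apply (derivative_nonneg_le (fun p => - (z p / (T + p)))
        (fun p => - ((v p * (T + p) - z p * 1) / (T + p) ^ 2))).
      - lra.
      - intros q Hq. apply @is_derive_opp. apply is_derive_div; [apply Dz; lra| |lra].
        auto_derive; [trivial|ring].
      - intros q Hq. apply continuity_pt_opp, continuity_pt_div; [apply Cz| |lra].
        apply continuity_pt_plus; [apply continuity_pt_cst|].
        apply continuity_pt_id.
      - intros q Hq. assert (Fq : F q <= 0) by (apply Fneg; lra). unfold F in Fq.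
        assert (P2 : 0 < (T + q) ^ 2) by (apply pow_lt; lra).
        replace (- ((v q * (T + q) - z q * 1) / (T + q) ^ 2)) with
          (- ((T + q) * v q - z q) / (T + q) ^ 2) by (field; lra).
        apply Rdiv_le_0_compat; lra. }
    rewrite Z0 in Q.
    assert (Q2 : z p <= 1 / (T + p0) * (T + p)).
    { apply Rle_trans with (z p / (T + p) * (T + p)); [apply Req_le; field; lra|].
      apply Rmult_le_compat_r; lra. }
    apply Rle_trans with (1 := Q2).
    replace (2 * T / (T + p0)) with (1 / (T + p0) * (2 * T)) by (field; lra).
    apply Rmult_le_compat_l; [apply Rlt_le, Rdiv_lt_0_compat; lra|lra]. }
  (* [F p0 = - 2 T / (T - p0)] does not depend on [M], while the derivative of [F] is at least
     [M (T + p0) al / (2 T / (T + p0))]; the hypothesis on [M] pushes [F p1] above 0, against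
     [Fneg]. *)
  destruct (mean_value F (fun p => (T + p) * (M * (a p / z p))) p0 p1) as [q [Hq E]].
  - lra.
  - exact DF.
  - intros p _. apply CF.
  - assert (F0 : F p0 = - (2 * T / (T - p0))).
    { unfold F. rewrite Z0, V0. unfold s0. field. lra. }
    assert (F1 : F p1 <= 0) by (apply Fneg; lra).
    assert (Zq := Zle q). assert (Pzq := Zpos q). assert (Aq := Bal q).
    assert (Low : (T + p0) * al / (2 * T / (T + p0)) <= (T + q) * (a q / z q)).
    { unfold Rdiv at 1. rewrite Rmult_assoc. apply Rmult_le_compat.
      - lra.
      - apply Rmult_le_pos; [lra|]. apply Rlt_le, Rinv_0_lt_compat, Rdiv_lt_0_compat; lra.
      - lra.
      - apply Rmult_le_compat; [lra| |apply Aq; lra|].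
        + apply Rlt_le, Rinv_0_lt_compat, Rdiv_lt_0_compat; lra.
        + apply Rinv_le_contravar; [apply Pzq; lra|apply Zq; lra]. }
    assert (Low2 : M * ((T + p0) * al / (2 * T / (T + p0)) * (p1 - p0)) <=
      (T + q) * (M * (a q / z q)) * (p1 - p0)).
    { replace ((T + q) * (M * (a q / z q)) * (p1 - p0)) with
        (M * ((T + q) * (a q / z q) * (p1 - p0))) by ring.
      apply Rmult_le_compat_l; [lra|]. apply Rmult_le_compat_r; lra. }
    lra.
Qed.

End Shooting.

(** The intermediate value theorem in [mu]: at [mu = 0] the slope is the negative constant [s0]
    while [z] is positive at [p1], so the defect is negative; at a large [M] it is positive by
    [defect_pos]. *)
Lemma robin_solution_exists (a : R -> R) (p0 p1 T : R) :
  - T < p0 /\ p0 < p1 /\ p1 < T -> (forall p, 0 < a p) -> (forall p, continuity_pt a p) ->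
  exists w x, robin_solution a p0 p1 T w x.
Proof.
  intros Hsl Ha Ca.
  destruct (continuity_ab_maj a p0 p1) as [q1 [H1 _]]; [lra|intros; apply Ca|].
  destruct (continuity_ab_min a p0 p1) as [q0 [H0 _]]; [lra|intros; apply Ca|].
  set (al := a q0) in *. assert (Pal : 0 < al) by apply Ha.
  set (c := (T + p0) * al / (2 * T / (T + p0)) * (p1 - p0)).
  assert (Pc : 0 < c).
  { apply Rmult_lt_0_compat; [|lra]. apply Rdiv_lt_0_compat.
    - apply Rmult_lt_0_compat; lra.
    - apply Rdiv_lt_0_compat; lra. }
  set (M := 2 * T / (T - p0) / c + 1).
  assert (PT : 0 < 2 * T / (T - p0)) by (apply Rdiv_lt_0_compat; lra).
  assert (PM : 0 < M).
  { assert (0 < 2 * T / (T - p0) / c) by (now apply Rdiv_lt_0_compat). unfold M. lra. }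
  assert (Big : 2 * T / (T - p0) < M * c).
  { replace (M * c) with (2 * T / (T - p0) + c) by (unfold M; field; lra). lra. }
  assert (HA : 0 < a q1 /\ forall p, p0 <= p <= p1 -> a p <= a q1) by (split; [apply Ha|exact H1]).
  destruct (shoot_family a p0 p1 T M Hsl Ha Ca PM (a q1) HA) as [Z [CZ [EZ LZ]]].
  set (slope := shoot_slope a p0 p1 T).
  set (defect := fun mu => (T + p1) * slope mu (Z mu) p1 - Z mu p1).
  assert (Cd := defect_continuity a p0 p1 T M Hsl Ha Ca PM (a q1) HA Z CZ LZ).
  assert (I0 : 0 <= 0 <= M) by lra. assert (IM : 0 <= M <= M) by lra.
  assert (D0 : defect 0 < 0).
  { unfold defect, slope, shoot_slope. rewrite Rmult_0_l, Rplus_0_r.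
    destruct (shoot_properties a p0 p1 T Hsl Ha Ca 0 (Z 0)) as [Zge _];
      [lra|now apply CZ|now apply EZ|].
    assert (Q := Zge p1). assert (Pm := m_pos p0 p1 T Hsl).
    assert (0 < Z 0 p1) by (apply Rlt_le_trans with (1 := Pm); apply Q; lra).
    assert (0 < (T + p1) * / (T - p0)).
    { apply Rmult_lt_0_compat; [lra|]. apply Rinv_0_lt_compat. lra. }
    lra. }
  assert (DM : 0 < defect M).
  { apply (defect_pos a p0 p1 T M Hsl Ha Ca PM (Z M) al Pal H0);
      [now apply CZ|now apply EZ|exact Big]. }
  destruct (IVT (fun mu => defect (clamp 0 M mu)) 0 M) as [mu [Hmu Emu]].
  - exact Cd.
  - exact PM.
  - now rewrite clamp_id by lra.
  - now rewrite clamp_id by lra.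
  - rewrite clamp_id in Emu by lra.
    assert (Pmu : 0 < mu).
    { destruct Hmu as [[|<-] _]; [assumption|]. lra. }
    destruct (shoot_properties a p0 p1 T Hsl Ha Ca mu (Z mu)) as [Zge [Dz [Dv [Z0 V0]]]];
      [lra|now apply CZ|now apply EZ|].
    fold slope in Dz, Dv, V0.
    assert (Pm := m_pos p0 p1 T Hsl).
    assert (Zpos : forall p, p0 <= p <= p1 -> 0 < Z mu p).
    { intros p Hp. apply Rlt_le_trans with (1 := Pm). now apply Zge. }
    (* For [w = k z] the equation [z'' = mu a / z] becomes [w'' = a / w] exactly when
       [k ^ 2 mu = 1]; the Robin conditions are homogeneous and survive the scaling. *)
    set (k := / sqrt mu).
    assert (Ps : 0 < sqrt mu) by (now apply sqrt_lt_R0).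
    assert (Pk : 0 < k) by (now apply Rinv_0_lt_compat).
    assert (Ek : k * k * mu = 1).
    { unfold k. rewrite <- (sqrt_sqrt mu) at 3 by lra. field. lra. }
    exists (fun p => k * Z mu p), (fun p => - (k * slope mu (Z mu) p)).
    constructor.
    + exact Hsl.
    + exact Ha.
    + exact Ca.
    + intro p. apply continuity_pt_mult; [apply continuity_pt_cst|now apply CZ].
    + intro p. apply continuity_pt_opp, continuity_pt_mult;
        [apply continuity_pt_cst|].
      apply (shoot_slope_continuity a p0 p1 T Hsl Ca). now apply CZ.
    + intros p Hp. apply Rmult_lt_0_compat; [exact Pk|now apply Zpos].
    + intros p Hp. rewrite Ropp_involutive. apply @is_derive_scal. now apply Dz.
    + intros p Hp. assert (Pz := Zpos p).
      replace (- a p / (k * Z mu p)) with (- (k * (mu * (a p / Z mu p)))).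
      * apply @is_derive_opp. apply @is_derive_scal. now apply Dv.
      * assert (0 < Z mu p) by (apply Pz; lra).
        replace (k * (mu * (a p / Z mu p))) with (k * k * mu * a p / (k * Z mu p)) by (field; lra).
        rewrite Ek. field. lra.
    + rewrite Z0, V0. field. lra.
    + unfold defect in Emu. replace (Z mu p1) with ((T + p1) * slope mu (Z mu) p1) by lra. ring.
Qed.

(** * Discrete self-similar solutions *)

Lemma derivative_on_continuity (D : R -> Prop) (f f' : R -> R) (x : R) :
  derivative_on D f f' -> D x -> filterlim f (within D (locally x)) (locally (f x)).
Proof.
  intros H Hx. apply (filterdiff_continuous_aux f).
  - eexists. now apply H.
  - intros P HP. apply filter_le_within. exact HP.
Qed.

Lemma discrete_homogeneous_constant (k : R -> R) (b : R) :
  1 < b -> C2_on nonneg_half_line k -> (forall u, 0 <= u -> k u = k (b * u)) ->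
  forall u, 0 <= u -> k u = k 0.
Proof.
  intros Hb [k' [k'' [Hk _]]] Hs u Hu.
  assert (Hc := derivative_on_continuity _ _ _ 0 Hk (Rle_refl 0)).
  assert (It : forall n, k (u / b ^ n) = k u).
  { intro n. induction n as [|n IH].
    - simpl. f_equal. field.
    - rewrite <- IH. rewrite Hs.
      + f_equal. simpl. field. split; [|lra]. apply pow_nonzero. lra.
      + apply Rdiv_le_0_compat; [exact Hu|]. apply pow_lt. lra. }
  apply cond_eq. intros eps Heps.
  destruct (Hc (fun y => Rabs (y - k 0) < eps)) as [d Hd].
  { exists (mkposreal _ Heps). intros y Hy. exact Hy. }
  destruct (pow_lt_1_zero (/ b)) with (y := d / (u + 1)) as [n Hn].
  - rewrite Rabs_right; [|apply Rle_ge, Rlt_le, Rinv_0_lt_compat; lra].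
    rewrite <- Rinv_1. apply Rinv_lt_contravar; lra.
  - apply Rdiv_lt_0_compat; [apply cond_pos|lra].
  - specialize (Hn n (Nat.le_refl n)).
    assert (Pb : 0 < (/ b) ^ n) by (apply pow_lt, Rinv_0_lt_compat; lra).
    rewrite Rabs_right in Hn by lra.
    assert (Eu : u / b ^ n = u * (/ b) ^ n) by (rewrite pow_inv; reflexivity).
    rewrite <- (It n). apply Hd.
    + change (Rabs (u / b ^ n - 0) < d). rewrite Rminus_0_r, Eu.
      rewrite Rabs_right by (apply Rle_ge, Rmult_le_pos; lra).
      apply Rle_lt_trans with ((u + 1) * (/ b) ^ n); [apply Rmult_le_compat_r; lra|].
      apply Rmult_lt_compat_l with (r := u + 1) in Hn; [|lra].
      replace ((u + 1) * (d / (u + 1))) with (pos d) in Hn by (field; lra). exact Hn.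
    + unfold nonneg_half_line. rewrite Eu. apply Rmult_le_pos; lra.
Qed.

Lemma C2_on_R_derivative (a : R -> R) : C2_on (fun _ => True) a ->
  exists a', (forall p, is_derive a p (a' p)) /\ forall p, continuity_pt a' p.
Proof.
  intros [a' [a'' [H1 [H2 _]]]].
  assert (Le : forall x : R, filter_le (within (fun _ => True) (locally x)) (locally x)).
  { intros x P HP. now apply filter_le_within. }
  assert (Ge : forall x : R, filter_le (locally x) (within (fun _ => True) (locally x))).
  { intros x P HP. unfold within in HP. generalize HP. apply filter_imp. auto. }
  exists a'. split.
  - intro p. destruct (H1 p I) as [Hl Hd]. split; [exact Hl|]. intros x Hx eps.
    apply (Ge p). apply Hd. exact (is_filter_lim_filter_le x (Le p) Hx).
  - intro p. apply continuity_pt_filterlim.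
    apply filterlim_filter_le_1 with (1 := Ge p). now apply (derivative_on_continuity _ _ _ p H2).
Qed.

Lemma C1_locally_lipschitz (a a' : R -> R) :
  (forall p, is_derive a p (a' p)) -> (forall p, continuity_pt a' p) ->
  forall r, exists L, 0 <= L /\ forall p q, Rabs p <= r -> Rabs q <= r ->
    Rabs (a p - a q) <= L * Rabs (p - q).
Proof.
  intros Hd Hc r. destruct (Rlt_le_dec r 0) as [Hr|Hr].
  { exists 0. split; [lra|]. intros p q Hp. assert (Q := Rabs_pos p). lra. }
  destruct (continuity_ab_maj (fun p => Rabs (a' p)) (- r) r) as [m [Hm _]]; [lra| |].
  { intros p _. apply (continuity_pt_comp a' Rabs); [apply Hc|apply Rcontinuity_abs]. }
  exists (Rabs (a' m)). split; [apply Rabs_pos|].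
  assert (Key : forall p q, p < q -> Rabs p <= r -> Rabs q <= r ->
    Rabs (a q - a p) <= Rabs (a' m) * Rabs (q - p)).
  { intros p q Hpq Hp Hq. apply Rabs_le_between in Hp, Hq.
    destruct (mean_value a a' p q Hpq) as [c [Hcc E]].
    - intros x _. apply Hd.
    - intros x _. apply is_derive_continuity_pt with (a' x). apply Hd.
    - rewrite E, Rabs_mult. apply Rmult_le_compat_r; [apply Rabs_pos|]. apply Hm. lra. }
  intros p q Hp Hq. destruct (Rtotal_order p q) as [Hlt|[->|Hgt]].
  - rewrite (Rabs_minus_sym (a p)), (Rabs_minus_sym p). now apply Key.
  - rewrite !Rminus_diag, Rabs_R0, Rmult_0_r. lra.
  - now apply Key.
Qed.

Lemma is_derive_dilation (f : R -> R) (c x l : R) :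
  is_derive f (x / c) l -> is_derive (fun y => f (y / c)) x (l / c).
Proof.
  intro H. replace (l / c) with (scal (/ c) l)
    by (unfold scal; simpl; unfold mult; simpl; unfold Rdiv; ring).
  apply (is_derive_comp f (fun y => y / c)); [exact H|].
  unfold Rdiv. auto_derive; [trivial|ring].
Qed.

(** [V] is arbitrary off the closed region, whence the composition with [region_clamp]. The scaling
    laws for [ux], [uxx] and [ut] come from differentiating the one for [V] at interior points, and
    reach the lateral boundary by continuity in [x]; so does the equation. *)
Lemma self_similar_wedge_flow (beta : R) (a k1 k2 : R -> R) (b kap1 kap2 : R)
    (V : R -> R -> R) (xi1 xi2 : R -> R) :
  1 < b -> (forall p, 0 < a p) ->
  (forall r, exists L, 0 <= L /\ forall p q, Rabs p <= r -> Rabs q <= r ->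
    Rabs (a p - a q) <= L * Rabs (p - q)) ->
  (forall p, continuity_pt a p) ->
  (forall u, 0 <= u -> k1 u = kap1) -> (forall u, 0 <= u -> k2 u = kap2) ->
  Rabs kap1 < tan beta -> Rabs kap2 < tan beta -> kap1 + kap2 < 0 ->
  discrete_shrinking_self_similar beta a k1 k2 b V xi1 xi2 ->
  exists ux uxx ut, wedge_flow a kap2 (- kap1) (tan beta) b xi1 xi2
    (fun x t => V (region_clamp xi1 xi2 x t) t) ux uxx ut.
Proof.
  intros Hb Ha Lip Ca Hk1 Hk2 B1 B2 Hneg [[C1 [C2 [Hpos [Vpos [CV [vx [vxx [vt
    [[Cvx Dx] [[Cvxx Dxx] [[Cvt Dt] [PDE [BL BR]]]]]]]]]]]]] [SV Sxi]].
  set (rc := region_clamp xi1 xi2).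
  assert (Irc : forall x t, closed_region xi1 xi2 (x, t) -> rc x t = x).
  { intros x t H. now apply region_clamp_id. }
  assert (Hbox : forall x t, open_region xi1 xi2 (x, t) -> closed_region xi1 xi2 (x, t))
    by (intros; now apply open_closed).
  assert (Lx : forall (f : R -> R -> R) x t l, open_region xi1 xi2 (x, t) ->
    is_derive (fun y => f y t) x l -> is_derive (fun y => f (rc y t) t) x l).
  { intros f x t l O H. apply is_derive_ext_loc with (2 := H).
    generalize (open_region_in_x xi1 xi2 x t O). apply filter_imp. intros y Hy.
    now rewrite Irc by (now apply Hbox). }
  assert (Lt : forall (f : R -> R -> R) x t l, open_region xi1 xi2 (x, t) ->
    is_derive (fun s => f x s) t l -> is_derive (fun s => f (rc x s) s) t l).
  { intros f x t l O H. apply is_derive_ext_loc with (2 := H).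
    generalize (open_region_in_t xi1 xi2 C1 C2 x t O). apply filter_imp. intros s Hs.
    now rewrite Irc by (now apply Hbox). }
  assert (Ext : forall v, continuous_on_region xi1 xi2 v -> forall x t, t < 0 ->
    continuity_2d_pt (fun x t => v (rc x t) t) x t).
  { intros v Hv x t Ht. now apply (clamp_extension_continuity xi1 xi2 C1 C2 Hpos). }
  assert (Clo : forall F : R -> R -> R, (forall x t, t < 0 -> continuity_pt (fun y => F y t) x) ->
    (forall x t, open_region xi1 xi2 (x, t) -> F x t = 0) ->
    forall x t, closed_region xi1 xi2 (x, t) -> F x t = 0).
  { intros F CF HF x t [Ht Hx]. simpl in Ht, Hx. destruct (Hpos t Ht).
    apply (zero_at_closure (fun y => F y t) (- xi1 t) (xi2 t)); [lra| | |exact Hx].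
    - intros y _. now apply CF.
    - intros y Hy. apply HF. split; simpl; lra. }
  assert (Hneg' : forall t, t < 0 -> t / b ^ 2 < 0).
  { intros t Ht. assert (0 < / b ^ 2) by (apply Rinv_0_lt_compat, pow_lt; lra).
    unfold Rdiv. nra. }
  assert (RS : forall x t, (closed_region xi1 xi2 (x, t) -> closed_region xi1 xi2 (x / b, t / b ^ 2)) /\
    (open_region xi1 xi2 (x, t) -> open_region xi1 xi2 (x / b, t / b ^ 2))).
  { intros x t. now apply region_scale. }
  assert (Sc : forall v w c, continuous_on_region xi1 xi2 v -> continuous_on_region xi1 xi2 w ->
    (forall x t, open_region xi1 xi2 (x, t) -> c * v x t = w (x / b) (t / b ^ 2)) ->
    forall x t, closed_region xi1 xi2 (x, t) -> c * v x t = w (x / b) (t / b ^ 2)).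
  { intros v w c Cv Cw Ho x t Hc.
    assert (Q := Clo (fun x t => c * v (rc x t) t - w (rc (x / b) (t / b ^ 2)) (t / b ^ 2))).
    assert (E : c * v (rc x t) t - w (rc (x / b) (t / b ^ 2)) (t / b ^ 2) = 0).
    { apply Q; [| |exact Hc].
      - intros y s Hs. apply continuity_pt_minus.
        + apply continuity_pt_mult; [apply continuity_pt_cst|].
          apply (continuity_2d_pt_section (fun x t => v (rc x t) t)). now apply Ext.
        + apply (continuity_pt_comp (fun y => y / b)
            (fun z => w (rc z (s / b ^ 2)) (s / b ^ 2))).
          * apply continuity_pt_mult; [apply continuity_pt_id|].
            apply continuity_pt_cst.
          * apply (continuity_2d_pt_section (fun x t => w (rc x t) t)). apply Ext; [exact Cw|].
            now apply Hneg'.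
      - intros y s O. rewrite (Irc y s) by (now apply Hbox).
        rewrite (Irc (y / b) (s / b ^ 2)) by (now apply Hbox, RS). rewrite (Ho y s O). ring. }
    rewrite (Irc x t Hc), (Irc (x / b) (t / b ^ 2)) in E by (now apply RS). lra. }
  assert (Oux : forall x t, open_region xi1 xi2 (x, t) -> vx x t = vx (x / b) (t / b ^ 2)).
  { intros x t O. rewrite <- (is_derive_unique _ _ _ (Dx x t O)). apply is_derive_unique.
    apply is_derive_ext_loc with (fun y => b * V (y / b) (t / b ^ 2)).
    - generalize (open_region_in_x xi1 xi2 x t O). apply filter_imp. intros y Hy.
      symmetry. now apply SV, Hbox.
    - replace (vx (x / b) (t / b ^ 2)) with (b * (vx (x / b) (t / b ^ 2) / b)) by (field; lra).
      apply @is_derive_scal. apply (is_derive_dilation (fun y => V y (t / b ^ 2))).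
      now apply Dx, RS. }
  assert (Ouxx : forall x t, open_region xi1 xi2 (x, t) -> b * vxx x t = vxx (x / b) (t / b ^ 2)).
  { intros x t O. rewrite <- (is_derive_unique _ _ _ (Dxx x t O)).
    rewrite (is_derive_unique (fun y => vx y t) x (vxx (x / b) (t / b ^ 2) / b)).
    - field. lra.
    - apply is_derive_ext_loc with (fun y => vx (y / b) (t / b ^ 2)).
      + generalize (open_region_in_x xi1 xi2 x t O). apply filter_imp. intros y Hy.
        symmetry. now apply Oux.
      + apply (is_derive_dilation (fun y => vx y (t / b ^ 2))). now apply Dxx, RS. }
  assert (Out : forall x t, open_region xi1 xi2 (x, t) -> b * vt x t = vt (x / b) (t / b ^ 2)).
  { intros x t O. rewrite <- (is_derive_unique _ _ _ (Dt x t O)).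
    rewrite (is_derive_unique (fun s => V x s) t (b * (vt (x / b) (t / b ^ 2) / b ^ 2))).
    - field. lra.
    - apply is_derive_ext_loc with (fun s => b * V (x / b) (s / b ^ 2)).
      + generalize (open_region_in_t xi1 xi2 C1 C2 x t O). apply filter_imp. intros s Hs.
        symmetry. now apply SV, Hbox.
      + apply @is_derive_scal. apply (is_derive_dilation (fun s => V (x / b) s)).
        now apply Dt, RS. }
  apply Rabs_def2 in B1, B2.
  exists (fun x t => vx (rc x t) t), (fun x t => vxx (rc x t) t), (fun x t => vt (rc x t) t).
  constructor.
  - exact Hb.
  - lra.
  - exact Ha.
  - exact Lip.
  - exact C1.
  - exact C2.
  - exact Hpos.
  - intros x t H. fold rc. rewrite (Irc x t H). now apply Vpos.
  - now apply Ext.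
  - now apply Ext.
  - now apply Ext.
  - now apply Ext.
  - intros x t O. rewrite (Irc x t) by (now apply Hbox). apply (Lx V); [exact O|now apply Dx].
  - intros x t O. rewrite (Irc x t) by (now apply Hbox). apply (Lx vx); [exact O|now apply Dxx].
  - intros x t O. rewrite (Irc x t) by (now apply Hbox). apply (Lt V); [exact O|now apply Dt].
  - intros x t H. apply Rminus_diag_uniq.
    apply (Clo (fun x t => vt (rc x t) t - a (vx (rc x t) t) * vxx (rc x t) t)); [| |exact H].
    + intros y s Hs. apply continuity_pt_minus; [|apply continuity_pt_mult].
      * apply (continuity_2d_pt_section (fun x t => vt (rc x t) t)). now apply Ext.
      * apply (continuity_pt_comp (fun y => vx (rc y s) s) a); [|apply Ca].
        apply (continuity_2d_pt_section (fun x t => vx (rc x t) t)). now apply Ext.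
      * apply (continuity_2d_pt_section (fun x t => vxx (rc x t) t)). now apply Ext.
    + intros y s O. rewrite (Irc y s) by (now apply Hbox). rewrite (PDE y s O). ring.
  - intros t Ht. destruct (Hpos t Ht).
    assert (K : closed_region xi1 xi2 (- xi1 t, t)) by (split; simpl; lra).
    fold rc. rewrite (Irc _ _ K). destruct (BL (- xi1 t) t Ht eq_refl) as [E1 E2]. split.
    + rewrite E1, Hk1; [reflexivity|]. apply Rlt_le. now apply Vpos.
    + rewrite E2. ring.
  - intros t Ht. destruct (Hpos t Ht).
    assert (K : closed_region xi1 xi2 (xi2 t, t)) by (split; simpl; lra).
    fold rc. rewrite (Irc _ _ K). destruct (BR (xi2 t) t Ht eq_refl) as [E1 E2]. split.
    + rewrite E1, Hk2; [reflexivity|]. apply Rlt_le. now apply Vpos.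
    + rewrite E2. ring.
  - exact Sxi.
  - intros x t H. fold rc. rewrite (Irc x t H), (Irc (x / b)) by (now apply RS). now apply SV.
  - intros x t H. rewrite (Irc x t H), (Irc (x / b)) by (now apply RS).
    rewrite <- (Rmult_1_l (vx x t)). apply Sc; try assumption.
    intros y s O. rewrite Rmult_1_l. now apply Oux.
  - intros x t H. rewrite (Irc x t H), (Irc (x / b)) by (now apply RS). now apply Sc.
  - intros x t H. rewrite (Irc x t H), (Irc (x / b)) by (now apply RS). now apply Sc.
Qed.

(** The rigidity [n w = - 2 t a] turns [x' = - n] into an equation in which time is only a positive
    factor of the coefficient, so that each instant can be treated separately. *)
Lemma legendre_flow_robin_solution (a : R -> R) (p0 p1 T b : R) (w x n : R -> R -> R) (t : R) :
  legendre_flow a p0 p1 T b w x n -> t < 0 ->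
  robin_solution (fun p => - 2 * t * a p) p0 p1 T
    (fun p => w (clamp p0 p1 p) t) (fun p => x (clamp p0 p1 p) t).
Proof.
  intros L Ht. assert (Hsl := lf_slopes L).
  assert (Cc : forall f : R -> R -> R, (forall p t, t < 0 -> continuity_2d_pt f p t) ->
    forall p, continuity_pt (fun p => f (clamp p0 p1 p) t) p).
  { intros f Hf p. apply (continuity_pt_comp (clamp p0 p1) (fun q => f q t)).
    - apply (clamp_continuity (fun _ => p0) (fun _ => p1) (fun q => q)).
      + apply continuity_pt_cst.
      + apply continuity_pt_cst.
      + apply continuity_pt_id.
    - apply continuity_2d_pt_section. now apply Hf. }
  constructor.
  - exact Hsl.
  - intro p. assert (P := lf_a_pos L p). nra.
  - intro p. apply continuity_pt_mult; [apply continuity_pt_cst|].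
    apply (lf_ca L).
  - apply Cc, (lf_cw L).
  - apply Cc, (lf_cx L).
  - intros p Hp. rewrite clamp_id by exact Hp. now apply (lf_w_pos L).
  - intros p Hp. exact (wc_dp _ _ _ _ _ _ _ _ L p t Hp Ht).
  - intros p Hp. assert (D := xc_dp _ _ _ _ _ _ _ _ L p t Hp Ht).
    assert (E := legendre_flow_self_similar _ _ _ _ _ _ _ _ L p t Hp Ht).
    assert (P : 0 < w p t) by (apply (lf_w_pos L); [lra|exact Ht]).
    cbv zeta beta in D. rewrite (clamp_id p0 p1 p) in D |- * by lra.
    replace (- (- 2 * t * a p) / w p t) with (- n p t); [exact D|].
    rewrite <- E. field. lra.
  - rewrite clamp_id by lra. now apply (lf_right L).
  - rewrite clamp_id by lra. now apply (lf_left L).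
Qed.

(** The transform determines the flow: the extreme slopes give the free boundaries, and every point
    of a slice is [x p t] for some slope [p], where [u = w + p x]. *)
Lemma wedge_flow_unique (a : R -> R) (p0 p1 T b : R) (xi1 xi2 eta1 eta2 : R -> R)
    (u ux uxx ut v vx vxx vt : R -> R -> R) :
  wedge_flow a p0 p1 T b xi1 xi2 u ux uxx ut ->
  wedge_flow a p0 p1 T b eta1 eta2 v vx vxx vt ->
  (forall t, t < 0 -> xi1 t = eta1 t /\ xi2 t = eta2 t) /\
  (forall x t, closed_region xi1 xi2 (x, t) -> u x t = v x t).
Proof.
  intros W1 W2. assert (Hsl := wf_slopes W1).
  destruct (wedge_flow_legendre W1) as [w1 [x1 [n1 [L1 [E1 [U1 S1]]]]]].
  destruct (wedge_flow_legendre W2) as [w2 [x2 [n2 [L2 [E2 [U2 S2]]]]]].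
  assert (Eq : forall p t, p0 <= p <= p1 -> t < 0 -> w1 p t = w2 p t /\ x1 p t = x2 p t).
  { intros p t Hp Ht.
    assert (Q := robin_solution_unique _ _ _ _ _ _ _ _
      (legendre_flow_robin_solution _ _ _ _ _ _ _ _ t L1 Ht)
      (legendre_flow_robin_solution _ _ _ _ _ _ _ _ t L2 Ht) p Hp).
    cbv beta in Q. now rewrite clamp_id in Q by exact Hp. }
  split.
  - intros t Ht. destruct (E1 t Ht) as [R1 R2]. destruct (E2 t Ht) as [R3 R4].
    destruct (Eq p0 t) as [_ Q0]; [lra|exact Ht|]. destruct (Eq p1 t) as [_ Q1]; [lra|exact Ht|].
    lra.
  - intros x t H. assert (Ht := proj1 H). simpl in Ht.
    destruct (S1 x t H) as [p [Hp Ex]].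
    destruct (Eq p t Hp Ht) as [Qw Qx].
    assert (A1 := U1 p t Hp Ht). assert (A2 := U2 p t Hp Ht).
    rewrite <- Qx, <- Qw in A2. rewrite Ex in A1, A2. lra.
Qed.

(** * The self-similar solution *)

(** The bound [g >= g0 > 0] makes [f] fall at least linearly, hence onto the whole line; continuity
    of the inverse follows from monotonicity and its derivative from [is_derive_inverse]. *)
Lemma decreasing_bijection_inverse (f g : R -> R) (g0 : R) :
  0 < g0 -> (forall q, g0 <= g q) -> (forall q, is_derive f q (- g q)) ->
  exists h, (forall y, f (h y) = y) /\ (forall q, h (f q) = q) /\
    (forall y, continuity_pt h y) /\ (forall y, is_derive h y (- / g (h y))) /\
    (forall y z, y <= z -> h z <= h y).
Proof.
  intros Hg0 Hg Hd.
  assert (Cf : continuity f) by (intro q; apply is_derive_continuity_pt with (1 := Hd q)).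
  assert (Low : forall p q, p <= q -> f q <= f p - g0 * (q - p)).
  { intros p q Hpq. enough (- f p - g0 * p <= - f q - g0 * q) by lra.
    apply (derivative_nonneg_le (fun q => - f q - g0 * q) (fun q => - - g q - g0)).
    - exact Hpq.
    - intros x _. apply @is_derive_minus; [apply @is_derive_opp, Hd|]. auto_derive; [trivial|ring].
    - intros x _. apply continuity_pt_minus; [apply continuity_pt_opp, Cf|].
      apply continuity_pt_mult; [apply continuity_pt_cst|].
      apply continuity_pt_id.
    - intros x _. rewrite Ropp_involutive. specialize (Hg x). lra. }
  assert (Dec : forall p q, p < q -> f q < f p).
  { intros p q Hpq. assert (Q := Low p q). assert (0 < g0 * (q - p)) by (apply Rmult_lt_0_compat; lra).
    lra. }
  assert (Sur : forall y, {q : R | f q = y}).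
  { intro y. set (r := Rabs (y - f 0) / g0).
    assert (Pr : 0 <= r) by (apply Rdiv_le_0_compat; [apply Rabs_pos|exact Hg0]).
    assert (Er : g0 * r = Rabs (y - f 0)) by (unfold r; field; lra).
    assert (A1 := Low 0 r Pr). assert (A2 := Low (- r) 0).
    assert (B1 := Rle_abs (y - f 0)). assert (B2 := Rle_abs (- (y - f 0))).
    rewrite Rabs_Ropp in B2.
    destruct (IVT_gen f (- r) r y Cf) as [q [_ Hq]]; [|now exists q].
    assert (A2' : f 0 <= f (- r) - g0 * (0 - - r)) by (apply A2; lra).
    rewrite Rmin_right, Rmax_left; lra. }
  set (h := fun y => proj1_sig (Sur y)).
  assert (Hfh : forall y, f (h y) = y) by (intro y; exact (proj2_sig (Sur y))).
  assert (Inj : forall p q, f p = f q -> p = q).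
  { intros p q E. destruct (Rtotal_order p q) as [H|[H|H]]; [|exact H|];
      apply Dec in H; lra. }
  assert (Hmon : forall y z, y <= z -> h z <= h y).
  { intros y z Hyz. destruct (Rle_lt_dec (h z) (h y)) as [|H]; [assumption|exfalso].
    apply Dec in H. rewrite !Hfh in H. lra. }
  assert (Ch : forall y, continuity_pt h y).
  { intro y. apply continuity_pt_locally. intro eps. assert (Pe := cond_pos eps).
    assert (D1 := Dec (h y - eps) (h y)). assert (D2 := Dec (h y) (h y + eps)).
    rewrite Hfh in D1, D2.
    assert (Hm : 0 < Rmin (f (h y - eps) - y) (y - f (h y + eps))).
    { assert (y < f (h y - eps)) by (apply D1; lra). assert (f (h y + eps) < y) by (apply D2; lra).
      apply Rmin_pos; lra. }
    assert (M1 := Rmin_l (f (h y - eps) - y) (y - f (h y + eps))).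
    assert (M2 := Rmin_r (f (h y - eps) - y) (y - f (h y + eps))).
    exists (mkposreal _ Hm). intros z Hz.
    change (Rabs (z - y) < Rmin (f (h y - eps) - y) (y - f (h y + eps))) in Hz.
    apply Rabs_def2 in Hz.
    apply Rabs_def1.
    - destruct (Rlt_le_dec (h z) (h y + eps)) as [|[H|H]]; [lra| |].
      + apply Dec in H. rewrite Hfh in H. lra.
      + assert (E : f (h y + eps) = z) by (rewrite H; apply Hfh). lra.
    - destruct (Rlt_le_dec (h y - eps) (h z)) as [|[H|H]]; [lra| |].
      + apply Dec in H. rewrite Hfh in H. lra.
      + assert (E : f (h y - eps) = z) by (rewrite <- H; apply Hfh). lra. }
  exists h. split; [exact Hfh|]. split; [|split; [exact Ch|split; [|exact Hmon]]].
  - intro q. apply Inj. apply Hfh.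
  - intro y. replace (- / g (h y)) with (/ - g (h y)).
    + apply (is_derive_inverse f h y (- g (h y)) 1); [apply Hd| |apply Ch|lra|now intros z _].
      specialize (Hg (h y)). lra.
    + specialize (Hg (h y)). field. lra.
Qed.

Lemma continuity_2d_continuous_on_region (xi1 xi2 : R -> R) (v : R -> R -> R) :
  (forall x t, t < 0 -> continuity_2d_pt v x t) -> continuous_on_region xi1 xi2 v.
Proof.
  intros Hv [x t] [Ht _]. simpl in Ht.
  apply (filterlim_filter_le_1 (F := locally (x, t))).
  - apply filter_le_within.
  - apply continuity_2d_pt_filterlim. now apply Hv.
Qed.

(* The profile [phi] of the self-similar solution and its derivative [P]; [w] is the Legendre
   transform of [phi], and [P] is inverse to [- w']. *)
Lemma profile_exists (a : R -> R) (p0 p1 T : R) :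
  - T < p0 /\ p0 < p1 /\ p1 < T -> (forall p, 0 < a p) -> (forall p, continuity_pt a p) ->
  exists (phi P P' : R -> R) (c1 c2 : R),
    0 < c1 /\ 0 < c2 /\
    (forall y, is_derive phi y (P y)) /\ (forall y, is_derive P y (P' y)) /\
    (forall y, continuity_pt P' y) /\
    (forall y, - c1 <= y <= c2 -> a (P y) * P' y = - (phi y - y * P y) /\
      0 < phi y - y * P y /\ 0 < phi y) /\
    P (- c1) = p1 /\ phi (- c1) = T * c1 /\ P c2 = p0 /\ phi c2 = T * c2.
Proof.
  intros Hsl Ha Ca.
  destruct (robin_solution_exists a p0 p1 T Hsl Ha Ca) as [w [x H]].
  set (pc := clamp p0 p1).
  assert (Bpc : forall p, p0 <= pc p <= p1) by (intro; apply clamp_bounds; lra).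
  assert (Ipc : forall p, p0 <= p <= p1 -> pc p = p) by (intros; now apply clamp_id).
  assert (Cpc : forall p, continuity_pt pc p).
  { intro p. apply (clamp_continuity (fun _ => p0) (fun _ => p1) (fun q => q)).
    - apply continuity_pt_cst.
    - apply continuity_pt_cst.
    - apply continuity_pt_id. }
  assert (Wpos : forall q, 0 < w (pc q)) by (intro q; now apply (rs_pos H)).
  set (g := fun q => a (pc q) / w (pc q)).
  assert (Cg : forall q, continuity_pt g q).
  { intro q. apply continuity_pt_div.
    - apply (continuity_pt_comp pc a); [apply Cpc|apply Ca].
    - apply (continuity_pt_comp pc w); [apply Cpc|apply (rs_cw H)].
    - apply Rgt_not_eq, Wpos. }
  destruct (continuity_ab_min g p0 p1) as [qm [Hqm _]]; [lra|intros; apply Cg|].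
  assert (Pg : forall q, 0 < g q) by (intro q; apply Rdiv_lt_0_compat; [apply Ha|apply Wpos]).
  assert (Lg : forall q, g qm <= g q).
  { intro q. apply Rle_trans with (g (pc q)); [now apply Hqm|].
    apply Req_le. unfold g. now rewrite (Ipc (pc q)). }
  (* [X], and [Wt] below, continue [x] and [w] past the interval of slopes by integrating the
     clamped density [g]; the profile is then differentiable on the whole line, in the two-sided
     sense at [- c1] and [c2]. *)
  set (X := fun q => x p0 - RInt g p0 q).
  assert (DX : forall q, is_derive X q (- g q)).
  { intro q. unfold X. rewrite <- (Rminus_0_l (g q)).
    apply (is_derive_minus (fun _ => x p0) (fun q => RInt g p0 q)).
    - apply @is_derive_const.
    - now apply RInt_derive_continuous. }
  assert (EX : forall q, p0 <= q <= p1 -> X q = x q).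
  { intros q Hq.
    assert (Q : X p0 - x p0 = X q - x q).
    { apply (derivative_zero_const (fun q => X q - x q) (fun q => - g q - - a q / w q)).
      - lra.
      - intros r Hr. apply @is_derive_minus; [apply DX|]. apply (rs_dx H). lra.
      - intros r _. apply continuity_pt_minus; [|apply (rs_cx H)].
        apply is_derive_continuity_pt with (1 := DX r).
      - intros r Hr. unfold g. rewrite Ipc by lra. unfold Rdiv. ring. }
    unfold X at 1 in Q. rewrite RInt_point in Q. change (@zero _) with 0 in Q. lra. }
  set (Wt := fun q => w p0 - RInt X p0 q).
  assert (CX : forall q, continuity_pt X q).
  { intro q. apply is_derive_continuity_pt with (1 := DX q). }
  assert (DW : forall q, is_derive Wt q (- X q)).
  { intro q. unfold Wt. rewrite <- (Rminus_0_l (X q)).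
    apply (is_derive_minus (fun _ => w p0) (fun q => RInt X p0 q)).
    - apply @is_derive_const.
    - now apply RInt_derive_continuous. }
  assert (EW : forall q, p0 <= q <= p1 -> Wt q = w q).
  { intros q Hq.
    assert (Q : Wt p0 - w p0 = Wt q - w q).
    { apply (derivative_zero_const (fun q => Wt q - w q) (fun q => - X q - - x q)).
      - lra.
      - intros r Hr. apply @is_derive_minus; [apply DW|]. apply (rs_dw H). lra.
      - intros r _. apply continuity_pt_minus; [|apply (rs_cw H)].
        apply is_derive_continuity_pt with (1 := DW r).
      - intros r Hr. rewrite EX by lra. ring. }
    unfold Wt at 1 in Q. rewrite RInt_point in Q. change (@zero _) with 0 in Q. lra. }
  destruct (decreasing_bijection_inverse X g (g qm) (Pg qm) Lg DX) as [P [XP [PX [CP [DP MP]]]]].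
  set (phi := fun y => Wt (P y) + y * P y).
  set (P' := fun y => - / g (P y)).
  set (c1 := - x p1). set (c2 := x p0).
  assert (Pw0 : 0 < w p0) by (apply (rs_pos H); lra).
  assert (Pw1 : 0 < w p1) by (apply (rs_pos H); lra).
  assert (Ew0 := rs_right H). assert (Ew1 := rs_left H).
  assert (Pc1 : 0 < c1).
  { apply Rmult_lt_reg_l with (T + p1); [lra|]. unfold c1. lra. }
  assert (Pc2 : 0 < c2).
  { apply Rmult_lt_reg_l with (T - p0); [lra|]. unfold c2. lra. }
  assert (PL : P (- c1) = p1).
  { unfold c1. rewrite Ropp_involutive, <- (EX p1) by lra. apply PX. }
  assert (PR : P c2 = p0). { unfold c2. rewrite <- (EX p0) by lra. apply PX. }
  assert (phiL : phi (- c1) = T * c1).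
  { unfold phi. rewrite PL, EW by lra. rewrite Ew1. unfold c1. ring. }
  assert (phiR : phi c2 = T * c2).
  { unfold phi. rewrite PR, EW by lra. rewrite Ew0. unfold c2. ring. }
  assert (Dphi : forall y, is_derive phi y (P y)).
  { intro y. unfold phi.
    replace (P y) with (P' y * - X (P y) + (1 * P y + y * P' y)) by (rewrite XP; ring).
    apply (is_derive_plus (fun y => Wt (P y)) (fun y => y * P y)).
    - apply (is_derive_comp Wt P); [apply DW|apply DP].
    - apply (is_derive_mult (fun y => y) P); [apply @is_derive_id|apply DP|].
      intros u v. apply Rmult_comm. }
  assert (Cphi : forall y, continuity_pt phi y).
  { intro y. apply is_derive_continuity_pt with (1 := Dphi y). }
  exists phi, P, P', c1, c2.
  split; [exact Pc1|]. split; [exact Pc2|]. split; [exact Dphi|]. split; [exact DP|].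
  split; [|split].
  - intro y. apply continuity_pt_opp, continuity_pt_inv; [|apply Rgt_not_eq, Pg].
    apply (continuity_pt_comp P g); [apply CP|apply Cg].
  - intros y Hy.
    assert (HP : p0 <= P y <= p1).
    { split.
      - rewrite <- PR. apply MP. lra.
      - rewrite <- PL. apply MP. lra. }
    assert (Ephi : phi y - y * P y = w (P y)).
    { unfold phi. rewrite EW by exact HP. ring. }
    rewrite Ephi. assert (Pwy := rs_pos H (P y) HP).
    split; [|split; [exact Pwy|]].
    + unfold P', g. rewrite Ipc by exact HP. assert (Pa := Ha (P y)). field. lra.
    (* [P] is nonincreasing, so [phi] is concave and is bounded below by one of its end values,
       which are positive; the sign of [P y] tells which end to use. *)
    + destruct (Rle_lt_dec 0 (P y)) as [Hs|Hs].
      * apply Rlt_le_trans with (phi (- c1)).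
        { rewrite phiL. apply Rmult_lt_0_compat; lra. }
        apply (derivative_nonneg_le phi P); [lra|intros; apply Dphi|intros; apply Cphi|].
        intros z Hz. apply Rle_trans with (1 := Hs). apply MP. lra.
      * apply Rlt_le_trans with (phi c2).
        { rewrite phiR. apply Rmult_lt_0_compat; lra. }
        enough (- phi y <= - phi c2) by lra.
        apply (derivative_nonneg_le (fun y => - phi y) (fun y => - P y)).
        -- lra.
        -- intros z _. apply @is_derive_opp, Dphi.
        -- intros z _. apply continuity_pt_opp, Cphi.
        -- intros z Hz. assert (P z <= P y) by (apply MP; lra). lra.
  - repeat split; assumption.
Qed.

(** Because [lam' = - 1 / lam], both [u_t] and [a u_xx] carry a factor [1 / lam] and the equation
    reduces to [a(P) P' = - (phi - y P)]. The bracket is the positive Legendre transform, which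
    gives the sign of [Ut]; the boundaries are positive multiples of [lam]. *)
Lemma self_similar_solution_exists (beta : R) (a k1 k2 : R -> R) (b kap1 kap2 : R) :
  1 < b -> (forall p, 0 < a p) -> (forall p, continuity_pt a p) ->
  (forall u, 0 <= u -> k1 u = kap1) -> (forall u, 0 <= u -> k2 u = kap2) ->
  Rabs kap1 < tan beta -> Rabs kap2 < tan beta -> kap1 + kap2 < 0 ->
  exists U Xi1 Xi2,
    discrete_shrinking_self_similar beta a k1 k2 b U Xi1 Xi2 /\
    (exists Ut, is_dt Xi1 Xi2 U Ut /\
       (forall x t, closed_region Xi1 Xi2 (x, t) -> Ut x t < 0)) /\
    (forall t, t < 0 -> Derive Xi1 t < 0 /\ Derive Xi2 t < 0).
Proof.
  intros Hb Ha Ca Hk1 Hk2 B1 B2 Hneg.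
  apply Rabs_def2 in B1, B2.
  destruct (profile_exists a kap2 (- kap1) (tan beta)) as
    [phi [P [P' [c1 [c2 [Pc1 [Pc2 [Dphi [DP [CP' [Ode [PL [phiL [PR phiR]]]]]]]]]]]]]];
    [lra|exact Ha|exact Ca|].
  set (lam := fun t => sqrt (- 2 * t)).
  assert (Plam : forall t, t < 0 -> 0 < lam t) by (intros t Ht; apply sqrt_lt_R0; lra).
  assert (Dlam : forall t, t < 0 -> is_derive lam t (- / lam t)).
  { intros t Ht. assert (Q := Plam t Ht). unfold lam in *. auto_derive; [lra|]. field. lra. }
  assert (Clam : forall t, t < 0 -> continuity_pt lam t).
  { intros t Ht. apply is_derive_continuity_pt with (1 := Dlam t Ht). }
  assert (B2pos : 0 < b ^ 2) by (apply pow_lt; lra).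
  assert (Slam : forall t, t < 0 -> lam t = b * lam (t / b ^ 2)).
  { intros t Ht. unfold lam. rewrite <- (sqrt_pow2 b) at 1 by lra.
    rewrite <- sqrt_mult_alt by lra. f_equal. field. lra. }
  assert (DXi : forall c t, t < 0 -> is_derive (fun t => c * lam t) t (c * - / lam t)).
  { intros c t Ht. apply @is_derive_scal. now apply Dlam. }
  assert (C1Xi : forall c, C1_neg (fun t => c * lam t)).
  { intros c t Ht. split; [eexists; now apply DXi|].
    apply continuous_ext_loc with (fun t => c * - / lam t).
    - generalize (locally_neg t Ht). apply filter_imp. intros s Hs. symmetry.
      apply is_derive_unique. now apply DXi.
    - apply continuity_pt_continuous. apply continuity_pt_mult;
        [apply continuity_pt_cst|].
      apply continuity_pt_opp, continuity_pt_inv; [now apply Clam|].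
      apply Rgt_not_eq. now apply Plam. }
  assert (Ceta : forall x t, t < 0 -> continuity_2d_pt (fun x t => x / lam t) x t).
  { intros x t Ht. apply continuity_2d_pt_mult; [apply continuity_2d_pt_id1|].
    apply continuity_2d_pt_inv; [apply (continuity_2d_pt_snd lam); now apply Clam|].
    apply Rgt_not_eq. now apply Plam. }
  assert (Cc : forall f : R -> R, (forall y, continuity_pt f y) -> forall x t, t < 0 ->
    continuity_2d_pt (fun x t => f (x / lam t)) x t).
  { intros f Cf x t Ht. apply (continuity_1d_2d_pt_comp f (fun x t => x / lam t)); [apply Cf|].
    now apply Ceta. }
  assert (Cl : forall x t, t < 0 -> continuity_2d_pt (fun _ t => lam t) x t).
  { intros x t Ht. apply continuity_2d_pt_snd. now apply Clam. }
  assert (Cil : forall x t, t < 0 -> continuity_2d_pt (fun _ t => / lam t) x t).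
  { intros x t Ht. apply (continuity_2d_pt_inv (fun _ t => lam t)); [now apply Cl|].
    apply Rgt_not_eq. now apply Plam. }
  assert (Cphi : forall y, continuity_pt phi y).
  { intro y. apply is_derive_continuity_pt with (1 := Dphi y). }
  assert (CP : forall y, continuity_pt P y).
  { intro y. apply is_derive_continuity_pt with (1 := DP y). }
  set (Xi1 := fun t => c1 * lam t). set (Xi2 := fun t => c2 * lam t).
  set (U := fun x t => lam t * phi (x / lam t)).
  set (Ut := fun x t => - / lam t * (phi (x / lam t) - x / lam t * P (x / lam t))).
  assert (HDt : is_dt Xi1 Xi2 U Ut).
  { split.
    - apply continuity_2d_continuous_on_region. intros x t Ht. unfold Ut.
      apply continuity_2d_pt_mult; [apply continuity_2d_pt_opp; now apply Cil|].
      apply continuity_2d_pt_minus; [now apply Cc|].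
      apply continuity_2d_pt_mult; [now apply Ceta|now apply Cc].
    - intros x t [Ht _]. simpl in Ht. assert (Q := Plam t Ht). unfold U, Ut.
      assert (De : is_derive (fun t => x / lam t) t (x / lam t * / lam t * / lam t)).
      { replace (x / lam t * / lam t * / lam t) with ((0 * lam t - x * - / lam t) / lam t ^ 2)
          by (field; lra).
        apply is_derive_div; [apply @is_derive_const|now apply Dlam|lra]. }
      replace (- / lam t * (phi (x / lam t) - x / lam t * P (x / lam t))) with
        (- / lam t * phi (x / lam t) + lam t * (x / lam t * / lam t * / lam t * P (x / lam t)))
        by (field; lra).
      apply (is_derive_mult lam (fun t => phi (x / lam t))).
      + now apply Dlam.
      + apply (is_derive_comp phi (fun t => x / lam t)); [apply Dphi|exact De].
      + intros u v. apply Rmult_comm. }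
  assert (Prof : forall x t, closed_region Xi1 Xi2 (x, t) -> - c1 <= x / lam t <= c2).
  { intros x t [Ht Hx]. simpl in Ht, Hx. assert (Q := Plam t Ht). unfold Xi1, Xi2 in Hx.
    assert (E : x = x / lam t * lam t) by (field; lra). rewrite E in Hx.
    split; apply Rmult_le_reg_r with (lam t); lra. }
  assert (HXi : forall t, t < 0 -> 0 < Xi1 t /\ 0 < Xi2 t).
  { intros t Ht. assert (Q := Plam t Ht). split; now apply Rmult_lt_0_compat. }
  assert (Upos : forall x t, closed_region Xi1 Xi2 (x, t) -> 0 < U x t).
  { intros x t Hc. apply Rmult_lt_0_compat; [apply Plam, Hc|]. now apply (Ode _ (Prof x t Hc)). }
  exists U, Xi1, Xi2. split; [split; [|split]|split].
  - split; [apply C1Xi|]. split; [apply C1Xi|]. split; [exact HXi|]. split; [exact Upos|].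
    split.
    { apply continuity_2d_continuous_on_region. intros x t Ht. apply continuity_2d_pt_mult;
        [now apply Cl|now apply Cc]. }
    exists (fun x t => P (x / lam t)), (fun x t => P' (x / lam t) * / lam t), Ut.
    split; [|split; [|split; [exact HDt|split; [|split]]]].
    + split.
      * apply continuity_2d_continuous_on_region. intros x t Ht. now apply Cc.
      * intros x t [Ht _]. simpl in Ht. assert (Q := Plam t Ht). unfold U.
        replace (P (x / lam t)) with (lam t * (P (x / lam t) / lam t)) by (field; lra).
        apply @is_derive_scal. apply (is_derive_dilation phi). apply Dphi.
    + split.
      * apply continuity_2d_continuous_on_region. intros x t Ht. apply continuity_2d_pt_mult;
          [now apply Cc|now apply Cil].
      * intros x t [Ht _]. apply (is_derive_dilation P). apply DP.
    + intros x t O. assert (Hc := open_closed _ _ _ O).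
      destruct (Ode _ (Prof x t Hc)) as [E _].
      rewrite <- Rmult_assoc, E. unfold Ut. ring.
    + intros x t Ht ->. assert (Q := Plam t Ht). destruct (HXi t Ht).
      assert (Up : 0 < U (- Xi1 t) t) by (apply Upos; split; simpl; lra).
      rewrite Hk1 by lra. unfold U, Xi1.
      replace (- (c1 * lam t) / lam t) with (- c1) by (field; lra).
      rewrite PL, phiL. split; ring.
    + intros x t Ht ->. assert (Q := Plam t Ht). destruct (HXi t Ht).
      assert (Up : 0 < U (Xi2 t) t) by (apply Upos; split; simpl; lra).
      rewrite Hk2 by lra. unfold U, Xi2.
      replace (c2 * lam t / lam t) with c2 by (field; lra).
      rewrite PR, phiR. split; ring.
  - intros x t [Ht _]. simpl in Ht. unfold U. rewrite (Slam t Ht).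
    assert (Q : 0 < lam (t / b ^ 2)).
    { apply Plam. assert (0 < / b ^ 2) by now apply Rinv_0_lt_compat. unfold Rdiv. nra. }
    replace (x / (b * lam (t / b ^ 2))) with (x / b / lam (t / b ^ 2)) by (field; lra). ring.
  - intros t Ht. unfold Xi1, Xi2. rewrite (Slam t Ht) at 1 2. split; ring.
  - exists Ut. split; [exact HDt|]. intros x t Hc. assert (Q := Plam t (proj1 Hc)). simpl in Q.
    destruct (Ode _ (Prof x t Hc)) as [_ [E _]]. unfold Ut.
    assert (0 < / lam t) by (now apply Rinv_0_lt_compat).
    assert (0 < / lam t * (phi (x / lam t) - x / lam t * P (x / lam t)))
      by (now apply Rmult_lt_0_compat). lra.
  - intros t Ht. assert (Q := Plam t Ht). assert (Pi : 0 < / lam t) by (now apply Rinv_0_lt_compat).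
    rewrite (is_derive_unique _ _ _ (DXi c1 t Ht) : Derive Xi1 t = _).
    rewrite (is_derive_unique _ _ _ (DXi c2 t Ht) : Derive Xi2 t = _).
    assert (0 < c1 * / lam t) by (now apply Rmult_lt_0_compat).
    assert (0 < c2 * / lam t) by (now apply Rmult_lt_0_compat). split; lra.
Qed.

Theorem theorem1p6 (beta : R) (a k1 k2 : R -> R) (sigma m1 m2 b : R)
  (hbeta : 0 < beta < PI / 2)
  (ha : C2_on (fun _ => True) a)
  (ha_pos : forall p, 0 < a p)
  (hk1 : C2_on nonneg_half_line k1)
  (hk2 : C2_on nonneg_half_line k2)
  (hsigma : 0 < sigma < tan beta)
  (hk1_bound : forall u, 0 <= u -> Rabs (k1 u) <= tan beta - sigma)
  (hk2_bound : forall u, 0 <= u -> Rabs (k2 u) <= tan beta - sigma)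
  (hm1 : is_max_on nonneg_half_line k1 m1)
  (hm2 : is_max_on nonneg_half_line k2 m2)
  (hmax : m1 + m2 < 0)
  (hb : 1 < b)
  (hk1_b : forall u, 0 <= u -> k1 u = k1 (b * u))
  (hk2_b : forall u, 0 <= u -> k2 u = k2 (b * u)) :
  exists (U : R -> R -> R) (Xi1 Xi2 : R -> R),
    discrete_shrinking_self_similar beta a k1 k2 b U Xi1 Xi2 /\
    (forall (V : R -> R -> R) (Eta1 Eta2 : R -> R),
       discrete_shrinking_self_similar beta a k1 k2 b V Eta1 Eta2 ->
       same_solution U Xi1 Xi2 V Eta1 Eta2) /\
    (exists Ut : R -> R -> R,
       is_dt Xi1 Xi2 U Ut /\
       (forall x t, closed_region Xi1 Xi2 (x, t) -> Ut x t < 0)) /\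
    (forall t, t < 0 -> Derive Xi1 t < 0 /\ Derive Xi2 t < 0).
Proof.
  assert (E1 := discrete_homogeneous_constant k1 b hb hk1 hk1_b).
  assert (E2 := discrete_homogeneous_constant k2 b hb hk2 hk2_b).
  assert (B1 : Rabs (k1 0) < tan beta) by (assert (Q := hk1_bound 0 (Rle_refl 0)); lra).
  assert (B2 : Rabs (k2 0) < tan beta) by (assert (Q := hk2_bound 0 (Rle_refl 0)); lra).
  assert (Hneg : k1 0 + k2 0 < 0).
  { assert (k1 0 <= m1) by (apply hm1, Rle_refl). assert (k2 0 <= m2) by (apply hm2, Rle_refl). lra. }
  destruct (C2_on_R_derivative a ha) as [a' [Da Ca']].
  assert (Ca : forall p, continuity_pt a p).
  { intro p. apply is_derive_continuity_pt with (1 := Da p). }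
  assert (Lip := C1_locally_lipschitz a a' Da Ca').
  destruct (self_similar_solution_exists beta a k1 k2 b (k1 0) (k2 0) hb ha_pos Ca E1 E2 B1 B2 Hneg)
    as [U [Xi1 [Xi2 [HU [Hmono Hxi]]]]].
  exists U, Xi1, Xi2. split; [exact HU|]. split; [|split; assumption].
  intros V Eta1 Eta2 HV.
  destruct (self_similar_wedge_flow beta a k1 k2 b (k1 0) (k2 0) U Xi1 Xi2 hb ha_pos Lip Ca
    E1 E2 B1 B2 Hneg HU) as [ux [uxx [ut WU]]].
  destruct (self_similar_wedge_flow beta a k1 k2 b (k1 0) (k2 0) V Eta1 Eta2 hb ha_pos Lip Ca
    E1 E2 B1 B2 Hneg HV) as [vx [vxx [vt WV]]].
  destruct (wedge_flow_unique _ _ _ _ _ _ _ _ _ _ _ _ _ _ _ _ _ WU WV) as [Exi Eu].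
  split; [exact Exi|]. intros x t Hc. assert (Q := Eu x t Hc).
  rewrite (region_clamp_id Xi1 Xi2 x t Hc) in Q.
  rewrite (region_clamp_id Eta1 Eta2 x t) in Q; [exact Q|].
  destruct Hc as [Ht Hx]. simpl in Ht, Hx. destruct (Exi t Ht) as [X1 X2].
  split; simpl; [exact Ht|]. rewrite <- X1, <- X2. exact Hx.
Qed.
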